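(* Let $X$ be $\mathbb{R}^d$, $\mathbb{C}$, $\mathbb{H}$, or $\mathbb{O}$, with a lattice $\mathcal{Z}$ that is integral, unit-generated, norm-Euclidean, nicely invertible with respect to an inversion $\iota$, and either 3-remote or 7-remote; let $K$ be its Dirichlet region and $T$ the associated continued fraction map. Let $\mu$ be the unique $T$-invariant probability measure equivalent to Lebesgue measure $\lambda$. Then $\mu$ has a density $d\mu/d\lambda$ that is (real-)analytic on each connected component of $K\setminus\bigcup_{n\ge0}T^n\partial K$.
   Context: $\mathbb{C},\mathbb{H},\mathbb{O}$ are identified with $\mathbb{R}^2,\mathbb{R}^4,\mathbb{R}^8$; norms, distances, dot products are Euclidean. An inversion is a map $\iota:X\setminus\{0\}\to X\setminus\{0\}$ with $|\iota x|=1/|x|$ and $d(\iota x,\iota y)=d(x,y)/(|x||y|)$ (equivalently $\iota(x)=\mathcal{O}(x)/|x|^2$, $\mathcal{O}$ orthogonal), assumed to satisfy $\iota\circ\iota=\mathrm{id}$; $\iota(0)=0$. A lattice is a discrete additive subgroup with compact quotient. Dirichlet region $K=\{x:d(x,0)\le d(x,z)\ \forall z\in\mathcal{Z}\}$ with a boundary choice so each $x$ has a unique $[x]\in\mathcal{Z}$ with $x-[x]\in K$; $\operatorname{rad}(K)=\sup_{x\in K}|x|$. $Tx=\iota x-[\iota x]$ for $x\ne0$, $T0=0$. Integral: $z\cdot z\in\mathbb{Z}$ for all $z\in\mathcal{Z}$. Unit-generated: every element is a sum of lattice points of norm $1$. Nicely invertible: $|z|^2\iota(z)\in\mathcal{Z}$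 for all nonzero $z\in\mathcal{Z}$. Norm-Euclidean: $\operatorname{rad}(K)<1$. 3-remote: $\inf_{x\in K}d(z,x)\ge1$ for all $z\in\mathcal{Z}$ with $|z|=\sqrt3$. 7-remote: $\inf_{x\in K}d(z/2,x)\ge1/2$ for all $z\in\mathcal{Z}$ with $|z|=\sqrt7$. *)

(* Defs.v *)
From HB Require Import structures.
From mathcomp Require Import all_boot all_order all_algebra.
From mathcomp Require Import all_classical all_reals all_analysis.
Set Implicit Arguments. Unset Strict Implicit. Unset Printing Implicit Defensive.
Import Order.TTheory GRing.Theory Num.Theory.
Import numFieldNormedType.Exports.
Local Open Scope classical_set_scope.
Local Open Scope ring_scope.

(* The space X = R^n, realised as n.-tuple R (which carries MathComp-Analysis'
   product (Borel) sigma-algebra).  Euclidean structure defined by hand. *)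
Section Euclid.
Variables (R : realType) (n : nat).
Local Notation V := (n.-tuple R).

Definition vzero : V := [tuple 0 | i < n].
Definition vadd (x y : V) : V := [tuple tnth x i + tnth y i | i < n].
Definition vopp (x : V) : V := [tuple - tnth x i | i < n].
Definition vsub (x y : V) : V := vadd x (vopp y).
Definition vscale (a : R) (x : V) : V := [tuple a * tnth x i | i < n].
Definition vsum (s : seq V) : V := foldr vadd vzero s.
Definition dot (x y : V) : R := \sum_(i < n) tnth x i * tnth y i.
Definition enorm (x : V) : R := Num.sqrt (dot x x).
Definition edist (x y : V) : R := enorm (vsub x y).

Definition eball (x : V) (r : R) : set V := [set y | edist y x < r].
Definition eopen (A : set V) : Prop :=
  forall x, A x -> exists2 r : R, 0 < r & eball x r `<=` A.
Definition einterior (A : set V) : set V :=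
  [set x | exists2 r : R, 0 < r & eball x r `<=` A].
Definition eclosure (A : set V) : set V :=
  [set x | forall r : R, 0 < r -> exists y, A y /\ edist y x < r].
Definition eboundary (A : set V) : set V := eclosure A `\` einterior A.
Definition econnected (S : set V) : Prop :=
  ~ exists U W : set V, eopen U /\ eopen W /\ S `<=` U `|` W /\
      (exists u, S u /\ U u) /\ (exists w, S w /\ W w) /\
      (forall v, S v -> U v -> W v -> False).
Definition ecomponent (S : set V) (x : V) : set V :=
  [set y | exists C : set V, [/\ econnected C, C `<=` S, C x & C y]].

Definition hom_part (c : ('I_n -> nat) -> R) (h : V) (k : nat) : R :=
  \sum_(a : {ffun 'I_n -> 'I_k.+1} | (\sum_(i < n) (a i : nat))%N == k)
     c (fun i => (a i : nat)) * \prod_(i < n) tnth h i ^+ (a i : nat).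
Definition hom_part_abs (c : ('I_n -> nat) -> R) (h : V) (k : nat) : R :=
  \sum_(a : {ffun 'I_n -> 'I_k.+1} | (\sum_(i < n) (a i : nat))%N == k)
     `|c (fun i => (a i : nat))| * \prod_(i < n) `|tnth h i| ^+ (a i : nat).
Definition analytic_on (f : V -> R) (S : set V) : Prop :=
  forall x, S x -> exists c : ('I_n -> nat) -> R, exists2 r : R, 0 < r &
    forall y, eball x r y -> S y ->
      cvgn (series (hom_part_abs c (vsub y x))) /\
      series (hom_part c (vsub y x)) @ \oo --> f y.

Definition is_inversion (iota : V -> V) : Prop :=
  [/\ iota vzero = vzero,
      forall x, x <> vzero -> enorm (iota x) = (enorm x)^-1,
      forall x y, x <> vzero -> y <> vzero ->
        edist (iota x) (iota y) = edist x y / (enorm x * enorm y)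
    & forall x, iota (iota x) = x].

Definition is_lattice (Z : set V) : Prop :=
  [/\ Z vzero,
      forall z w, Z z -> Z w -> Z (vsub z w),
      forall z, Z z -> exists2 r : R, 0 < r & forall w, Z w -> edist w z < r -> w = z
    & (* compact quotient: a bounded set of representatives *)
      exists M : R, forall x, exists2 z, Z z & edist x z <= M].

Definition dirichlet (Z : set V) : set V :=
  [set x | forall z, Z z -> enorm x <= edist x z].

(* K is the Dirichlet region with a boundary choice *)
Definition dirichlet_choice (Z : set V) (K : set V) : Prop :=
  K `<=` dirichlet Z /\
  forall x, exists z, [/\ Z z, K (vsub x z) &
                         forall z', Z z' -> K (vsub x z') -> z' = z].

Definition lfloor (Z K : set V) (x : V) : V :=
  xget vzero [set z | Z z /\ K (vsub x z)].

Definition cf_map (iota : V -> V) (Z K : set V) (x : V) : V :=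
  if x == vzero then vzero else vsub (iota x) (lfloor Z K (iota x)).

Definition integral_lattice (Z : set V) : Prop :=
  forall z, Z z -> exists k : int, dot z z = k%:~R.
Definition unit_generated (Z : set V) : Prop :=
  forall z, Z z -> exists s : seq V,
    (forall u, u \in s -> Z u /\ enorm u = 1) /\ z = vsum s.
Definition nicely_invertible (iota : V -> V) (Z : set V) : Prop :=
  forall z, Z z -> z <> vzero -> Z (vscale (enorm z ^+ 2) (iota z)).
Definition norm_euclidean (K : set V) : Prop :=
  exists2 r : R, r < 1 & forall x, K x -> enorm x <= r.
Definition remote3 (Z K : set V) : Prop :=
  forall z, Z z -> enorm z = Num.sqrt 3 -> forall x, K x -> 1 <= edist z x.
Definition remote7 (Z K : set V) : Prop :=
  forall z, Z z -> enorm z = Num.sqrt 7 ->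
    forall x, K x -> 2^-1 <= edist (vscale 2^-1 z) x.

Definition ebox (a b : V) : set V :=
  [set x | forall i, tnth a i <= tnth x i <= tnth b i].

End Euclid.

(* lam is Lebesgue measure on the (Borel) sets of R^n: the measure giving every
   box its volume (this characterises it uniquely). *)
Definition is_lebesgue (R : realType) (n : nat)
  (lam : {measure set (n.-tuple R) -> \bar R}) : Prop :=
  forall a b : n.-tuple R, (forall i, tnth a i <= tnth b i) ->
    lam (ebox a b) = (\prod_(i < n) (tnth b i - tnth a i))%:E.

(* Main.v *)
(** Around a point x of K outside the forward orbit of the boundary, all branches of
    the iterates T^k are simultaneously well defined. Indeed the sphere walls
    A|x|^2 - 2<x,z> + C = 0 with z in Z, |z|^2 = 1 + AC and |A| <= N form a locally finite
    family on K, contain the sides of K, and are carried into each other by lattice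
    translations and by iota; remoteness (with N = 1 or N = 2) guarantees that a wall with
    |C| > N, whose image would leave the family, misses the interior of K. So a neighbour of x
    lying on the same side of every wall as x has the same admissible branches.

    A branch is a Moebius map that sends the ball of centre y and radius t to a ball whose
    radius is an explicit constant times t / (|1 + q (y - x)|^2 - |q|^2 t^2), with q bounded
    uniformly over all branches at x. Approximating the Radon-Nikodym density of mu in L^1 by a
    Lipschitz function g, and using T-invariance together with the contraction of the branches,
    mu of this ball is uniformly close to a finite positive sum of terms
    w t^n / (|1 + q (y - x)|^2 - |q|^2 t^2)^n. The power series of these sums have uniformly bounded
    coefficients, so an ultrafilter limit is an analytic function F with
    mu(ball(y, t)) / vol(ball(y, t)) --> F y. Averaging over balls (Tonelli) and Fatou's lemma
    identify F with the density almost everywhere. *)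

(* The density of [mu] is only an L^1 class, so the transfer operator cannot be evaluated at a
   point; masses of balls can, and inversions carry balls to balls with explicit radii. The error of
   the finite branch sums is uniform in the centre and in the radius t, but it is not proportional
   to t^n, so the order of the limits matters: at each fixed t the approximation is refined first,
   which yields exact two-sided bounds with a relative gap of order t^2, and only then does t tend
   to 0. The gap is uniform because every q is bounded by the reciprocal of the radius of one ball
   on which all branches live: a branch sends that ball to a genuine ball, so its denominator is
   positive there. The total weight of the sums is controlled by the mass of a single ball about x.
   The density is finally redefined as the limit of the ball ratios at good points, so the power
   series found around different points agree automatically. *)
From Pilot Require Import Defs.
From HB Require Import structures.
From mathcomp Require Import all_boot all_order all_algebra.
From mathcomp Require Import all_classical all_reals all_analysis.
From mathcomp Require Import measurable_realfun.
From mathcomp Require Import ring lra zify.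
(* Imported again: MathComp-Analysis has its own [edist], which would shadow that of Defs. *)
Import Pilot.Defs.
Set Implicit Arguments. Unset Strict Implicit. Unset Printing Implicit Defensive.
Import Order.TTheory GRing.Theory Num.Theory.
Import numFieldNormedType.Exports.
Local Open Scope classical_set_scope.
Local Open Scope ring_scope.

(** * Euclidean vectors *)

Section EuclideanSpace.
Variables (R : realType) (n : nat).
Local Notation V := (n.-tuple R).
Implicit Types (x y z u v w : V) (a b r s t : R).

Lemma tnth_vzero i : tnth (vzero R n) i = 0.
Proof. by rewrite tnth_mktuple. Qed.
Lemma tnth_vadd x y i : tnth (vadd x y) i = tnth x i + tnth y i.
Proof. by rewrite tnth_mktuple. Qed.
Lemma tnth_vopp x i : tnth (vopp x) i = - tnth x i.
Proof. by rewrite tnth_mktuple. Qed.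
Lemma tnth_vsub x y i : tnth (vsub x y) i = tnth x i - tnth y i.
Proof. by rewrite tnth_vadd tnth_vopp. Qed.
Lemma tnth_vscale a x i : tnth (vscale a x) i = a * tnth x i.
Proof. by rewrite tnth_mktuple. Qed.
Definition tnthE := (tnth_vzero, tnth_vsub, tnth_vadd, tnth_vopp, tnth_vscale).

Lemma vsubK x y : vadd (vsub x y) y = x.
Proof. by apply: eq_from_tnth => i; rewrite !tnthE subrK. Qed.
Lemma vaddK x y : vsub (vadd x y) y = x.
Proof. by apply: eq_from_tnth => i; rewrite !tnthE addrK. Qed.
Lemma vaddC x y : vadd x y = vadd y x.
Proof. by apply: eq_from_tnth => i; rewrite !tnthE addrC. Qed.
Lemma vaddA x y z : vadd x (vadd y z) = vadd (vadd x y) z.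
Proof. by apply: eq_from_tnth => i; rewrite !tnthE addrA. Qed.
Lemma vadd0 x : vadd x (vzero R n) = x.
Proof. by apply: eq_from_tnth => i; rewrite !tnthE addr0. Qed.
Lemma v0add x : vadd (vzero R n) x = x.
Proof. by apply: eq_from_tnth => i; rewrite !tnthE add0r. Qed.
Lemma vsub0 x : vsub x (vzero R n) = x.
Proof. by apply: eq_from_tnth => i; rewrite !tnthE subr0. Qed.
Lemma vsubxx x : vsub x x = vzero R n.
Proof. by apply: eq_from_tnth => i; rewrite !tnthE subrr. Qed.
Lemma vscale1 x : vscale 1 x = x.
Proof. by apply: eq_from_tnth => i; rewrite !tnthE mul1r. Qed.
Lemma vscaleA a b x : vscale a (vscale b x) = vscale (a * b) x.
Proof. by apply: eq_from_tnth => i; rewrite !tnthE mulrA. Qed.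
Lemma vscale0 a : vscale a (vzero R n) = vzero R n.
Proof. by apply: eq_from_tnth => i; rewrite !tnthE mulr0. Qed.
Lemma vsub_eq0 x y : vsub x y = vzero R n -> x = y.
Proof.
move=> h; apply: eq_from_tnth => i.
have := congr1 (fun v => tnth v i) h; rewrite /= !tnthE => /eqP.
by rewrite subr_eq0 => /eqP.
Qed.

Lemma dotC x y : dot x y = dot y x.
Proof. by apply: eq_bigr => i _; rewrite mulrC. Qed.
Lemma dotDl x y z : dot (vadd x y) z = dot x z + dot y z.
Proof. by rewrite -big_split; apply: eq_bigr => i _; rewrite !tnthE mulrDl. Qed.
Lemma dotNl x z : dot (vopp x) z = - dot x z.
Proof. by rewrite -sumrN; apply: eq_bigr => i _; rewrite !tnthE mulNr. Qed.
Lemma dotZl a x z : dot (vscale a x) z = a * dot x z.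
Proof. by rewrite mulr_sumr; apply: eq_bigr => i _; rewrite !tnthE mulrA. Qed.
Lemma dotBl x y z : dot (vsub x y) z = dot x z - dot y z.
Proof. by rewrite dotDl dotNl. Qed.
Lemma dotDr x y z : dot z (vadd x y) = dot z x + dot z y.
Proof. by rewrite dotC dotDl !(dotC z). Qed.
Lemma dotNr x z : dot z (vopp x) = - dot z x.
Proof. by rewrite dotC dotNl dotC. Qed.
Lemma dotBr x y z : dot z (vsub x y) = dot z x - dot z y.
Proof. by rewrite dotC dotBl !(dotC z). Qed.
Lemma dotZr a x z : dot z (vscale a x) = a * dot z x.
Proof. by rewrite dotC dotZl dotC. Qed.
Lemma dot0l z : dot (vzero R n) z = 0.
Proof. by apply: big1 => i _; rewrite tnthE mul0r. Qed.
Lemma dot0r z : dot z (vzero R n) = 0.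
Proof. by rewrite dotC dot0l. Qed.
Definition dotE := (dotDl, dotDr, dotNl, dotNr, dotBl, dotBr, dotZl, dotZr, dot0l, dot0r).

Lemma dot_ge0 x : 0 <= dot x x.
Proof. by apply: sumr_ge0 => i _; rewrite -expr2 sqr_ge0. Qed.
Lemma dot_eq0 x : dot x x = 0 -> x = vzero R n.
Proof.
move=> h; apply: eq_from_tnth => i; rewrite tnthE.
have /psumr_eq0P : (forall i, true -> 0 <= tnth x i * tnth x i).
  by move=> j _; rewrite -expr2 sqr_ge0.
move=> /(_ h i isT) /eqP.
by rewrite mulf_eq0 orbb => /eqP.
Qed.
Lemma dot_gt0 x : x <> vzero R n -> 0 < dot x x.
Proof.
move=> x0; rewrite lt_neqAle dot_ge0 andbT eq_sym; apply/eqP => /dot_eq0; exact: x0.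
Qed.

Lemma enorm_ge0 x : 0 <= enorm x. Proof. exact: sqrtr_ge0. Qed.
Lemma enorm_sqr x : enorm x ^+ 2 = dot x x.
Proof. by rewrite sqr_sqrtr // dot_ge0. Qed.
Lemma enorm0 : enorm (vzero R n) = 0.
Proof. by rewrite /enorm dot0l sqrtr0. Qed.
Lemma enorm_eq0 x : enorm x = 0 -> x = vzero R n.
Proof. by move=> h; apply: dot_eq0; rewrite -enorm_sqr h expr0n. Qed.
Lemma enorm_gt0 x : x <> vzero R n -> 0 < enorm x.
Proof. by move=> x0; rewrite sqrtr_gt0 dot_gt0. Qed.
Lemma enormZ a x : enorm (vscale a x) = `|a| * enorm x.
Proof.
by rewrite /enorm !dotE mulrA -expr2 sqrtrM ?sqr_ge0// sqrtr_sqr.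
Qed.
Lemma enormN x : enorm (vopp x) = enorm x.
Proof. by rewrite /enorm !dotE opprK. Qed.
Lemma enorm_le x r : 0 <= r -> (enorm x <= r) = (dot x x <= r ^+ 2).
Proof. by move=> r0; rewrite -enorm_sqr ler_pXn2r// nnegrE enorm_ge0. Qed.
Lemma enorm_lt x r : 0 <= r -> (enorm x < r) = (dot x x < r ^+ 2).
Proof. by move=> r0; rewrite -enorm_sqr ltr_pXn2r// nnegrE enorm_ge0. Qed.
Lemma enorm_ge x r : 0 <= r -> (r <= enorm x) = (r ^+ 2 <= dot x x).
Proof. by move=> r0; rewrite -enorm_sqr ler_pXn2r// nnegrE enorm_ge0. Qed.
Lemma enorm1 x : enorm x = 1 <-> dot x x = 1.
Proof.
split => h; first by rewrite -enorm_sqr h expr1n.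
by rewrite /enorm h sqrtr1.
Qed.

Lemma dot_CS x y : dot x y <= enorm x * enorm y.
Proof.
have [->|x0] := pselect (x = vzero R n); first by rewrite dot0l enorm0 mul0r.
have [->|y0] := pselect (y = vzero R n); first by rewrite dot0r enorm0 mulr0.
have a0 := enorm_gt0 x0; have b0 := enorm_gt0 y0.
have := dot_ge0 (vsub (vscale (enorm y) x) (vscale (enorm x) y)).
rewrite !dotE (dotC y x) -!enorm_sqr => h.
have ab0 : 0 < enorm x * enorm y by rewrite mulr_gt0.
rewrite -(ler_pM2l ab0); lra.
Qed.
Lemma dot_abs x y : `|dot x y| <= enorm x * enorm y.
Proof.
rewrite ler_norml dot_CS andbT lerNl -dotNl (le_trans (dot_CS _ _)) //.
by rewrite enormN.
Qed.
Lemma enormD x y : enorm (vadd x y) <= enorm x + enorm y.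
Proof.
rewrite enorm_le ?addr_ge0 ?enorm_ge0// !dotE (dotC y x) -!enorm_sqr.
have := dot_CS x y; lra.
Qed.

Lemma edistC x y : edist x y = edist y x.
Proof.
rewrite /edist -enormN; congr enorm; apply: eq_from_tnth => i; rewrite !tnthE; ring.
Qed.
Lemma edist_ge0 x y : 0 <= edist x y. Proof. exact: enorm_ge0. Qed.
Lemma edistxx x : edist x x = 0. Proof. by rewrite /edist vsubxx enorm0. Qed.
Lemma edist0 x : edist x (vzero R n) = enorm x. Proof. by rewrite /edist vsub0. Qed.
Lemma edist_tri y x z : edist x z <= edist x y + edist y z.
Proof.
rewrite /edist; have -> : vsub x z = vadd (vsub x y) (vsub y z).
  by apply: eq_from_tnth => i; rewrite !tnthE; ring.
exact: enormD.
Qed.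
Lemma edistDr x y z : edist (vadd x z) (vadd y z) = edist x y.
Proof.
by rewrite /edist; congr enorm; apply: eq_from_tnth => i; rewrite !tnthE; ring.
Qed.
Lemma edist_sqr x y : edist x y ^+ 2 = dot x x - 2 * dot x y + dot y y.
Proof. by rewrite enorm_sqr !dotE (dotC y x); ring. Qed.
Lemma edist_lt x y r : 0 <= r ->
  (edist x y < r) = (dot x x - 2 * dot x y + dot y y < r ^+ 2).
Proof. by move=> r0; rewrite -edist_sqr ltr_pXn2r// nnegrE enorm_ge0. Qed.

Lemma tnth_le_enorm x i : `|tnth x i| <= enorm x.
Proof.
rewrite -(@ler_pXn2r _ 2) ?nnegrE ?enorm_ge0// enorm_sqr real_normK ?num_real//.
rewrite /dot (bigD1 i)//= -expr2 lerDl sumr_ge0// => j _.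
by rewrite -expr2 sqr_ge0.
Qed.
Lemma enorm_le_sum x : enorm x <= \sum_(i < n) `|tnth x i|.
Proof.
have S0 : 0 <= \sum_(i < n) `|tnth x i| by apply: sumr_ge0.
rewrite enorm_le// expr2 mulr_suml; apply: ler_sum => i _.
have : tnth x i * tnth x i = `|tnth x i| * `|tnth x i|.
  by rewrite -normrM ger0_norm// -expr2 sqr_ge0.
move=> ->; apply: ler_wpM2l => //.
by rewrite (bigD1 i)//= lerDl sumr_ge0.
Qed.

Lemma eball_center x r : 0 < r -> eball x r x.
Proof. by rewrite /eball /= edistxx. Qed.

End EuclideanSpace.

(** * Inversions and unit-generated lattices *)

Lemma dot_ext (R : realType) (n : nat) (x y : n.-tuple R) :
  (forall w, dot x w = dot y w) -> x = y.
Proof.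
move=> h; apply: vsub_eq0; apply: dot_eq0.
by rewrite dotBl h subrr.
Qed.

Section Inversion.
Variables (R : realType) (n : nat) (iota : n.-tuple R -> n.-tuple R).
Hypothesis iotaP : is_inversion iota.
Local Notation V := (n.-tuple R).
Implicit Types x y u v w : V.

Lemma iota0 : iota (vzero R n) = vzero R n. Proof. by case: iotaP. Qed.
Lemma iotaK x : iota (iota x) = x. Proof. by case: iotaP. Qed.
Lemma iota_neq0 x : x <> vzero R n -> iota x <> vzero R n.
Proof. by move=> x0 h; apply: x0; rewrite -(iotaK x) h iota0. Qed.
Lemma iota_norm x : enorm (iota x) = (enorm x)^-1.
Proof.
case: iotaP => i0 h _ _; have [->|/h//] := pselect (x = vzero R n).
by rewrite i0 enorm0 invr0.
Qed.
Lemma iota_sq x : dot (iota x) (iota x) = (dot x x)^-1.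
Proof. by rewrite -!enorm_sqr iota_norm exprVn. Qed.
(** Polarisation: the squared distance rule of an inversion determines dot products. Zero vectors
    fit in because [0^-1 = 0]. *)
Lemma iota_dot x y : dot (iota x) (iota y) = dot x y / (dot x x * dot y y).
Proof.
have [->|x0] := pselect (x = vzero R n); first by rewrite iota0 !dot0l mul0r.
have [->|y0] := pselect (y = vzero R n); first by rewrite iota0 !dot0r mul0r.
have a0 := dot_gt0 x0; have b0 := dot_gt0 y0.
case: iotaP => _ _ /(_ x y x0 y0) /(congr1 (fun r => r ^+ 2)) h _.
move: h; rewrite edist_sqr expr_div_n edist_sqr exprMn !enorm_sqr !iota_sq => h.
apply: (@mulfI _ (- 2)); first by rewrite oppr_eq0 pnatr_eq0.
have -> : -2 * dot (iota x) (iota y) =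
  ((dot x x)^-1 - 2 * dot (iota x) (iota y) + (dot y y)^-1) - (dot x x)^-1 - (dot y y)^-1 by ring.
rewrite h; field; by rewrite !lt0r_neq0.
Qed.

(* The orthogonal map x |-> |x|^2 iota x of the equivalent description of inversions. *)
Definition orth_part x := vscale (dot x x) (iota x).

Lemma orth_partE x : iota x = vscale (dot x x)^-1 (orth_part x).
Proof.
have [->|x0] := pselect (x = vzero R n); first by rewrite /orth_part iota0 !vscale0.
by rewrite vscaleA mulVf ?vscale1// gt_eqF// dot_gt0.
Qed.
Lemma dot_orth_part x y : dot (orth_part x) (orth_part y) = dot x y.
Proof.
have [->|x0] := pselect (x = vzero R n); first by rewrite /orth_part iota0 !vscale0 !dot0l.
have [->|y0] := pselect (y = vzero R n); first by rewrite /orth_part iota0 !vscale0 !dot0r.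
have := dot_gt0 x0; have := dot_gt0 y0 => ? ?.
rewrite !dotE iota_dot; field; by rewrite !lt0r_neq0.
Qed.
(** Writing [y] as [iota (iota y)] reduces this to [iota_dot]; symmetry is the involutivity of
    [iota] in linear form. *)
Lemma orth_part_sym x y : dot (orth_part x) y = dot x (orth_part y).
Proof.
have [->|x0] := pselect (x = vzero R n); first by rewrite /orth_part iota0 !vscale0 !dot0l.
have [->|y0] := pselect (y = vzero R n); first by rewrite /orth_part iota0 !vscale0 !dot0r.
have := dot_gt0 x0; have := dot_gt0 y0 => ? ?.
rewrite !dotE -{1}(iotaK y) iota_dot iota_sq; field; by rewrite !lt0r_neq0.
Qed.
Lemma orth_partK x : orth_part (orth_part x) = x.
Proof. by apply: dot_ext => w; rewrite orth_part_sym dot_orth_part. Qed.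
Lemma iota_dotr x w : dot (iota x) w = dot x (orth_part w) / dot x x.
Proof. by rewrite orth_partE dotZl orth_part_sym mulrC. Qed.

Lemma iota_dist x y : x <> vzero R n -> y <> vzero R n ->
  edist (iota x) (iota y) = edist x y * enorm (iota x) * enorm (iota y).
Proof.
by move=> x0 y0; case: (iotaP) => _ _ -> // _; rewrite !iota_norm invfM mulrA.
Qed.

End Inversion.

Section Lattice.
Variables (R : realType) (n : nat) (Z : set (n.-tuple R)).
Local Notation V := (n.-tuple R).
Hypothesis Zlat : is_lattice Z.
Implicit Types x y z u v w : V.

Lemma lattice0 : Z (vzero R n). Proof. by case: Zlat. Qed.
Lemma latticeB z w : Z z -> Z w -> Z (vsub z w). Proof. by case: Zlat => _ h _ _; apply: h. Qed.
Lemma latticeN z : Z z -> Z (vopp z).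
Proof.
move=> Zz; have -> : vopp z = vsub (vzero R n) z; last exact: latticeB lattice0 Zz.
by apply: eq_from_tnth => i; rewrite !tnthE sub0r.
Qed.
Lemma latticeD z w : Z z -> Z w -> Z (vadd z w).
Proof.
move=> Zz Zw; have -> : vadd z w = vsub z (vopp w); last by apply: latticeB => //; exact: latticeN.
by apply: eq_from_tnth => i; rewrite !tnthE opprK.
Qed.
Lemma latticeMn (k : nat) z : Z z -> Z (vscale k%:R z).
Proof.
move=> Zz; elim: k => [|k IH].
  rewrite (_ : vscale _ _ = vzero R n); first exact: lattice0.
  by apply: eq_from_tnth => i; rewrite !tnthE mul0r.
rewrite (_ : vscale _ _ = vadd z (vscale k%:R z)); first exact: latticeD.
by apply: eq_from_tnth => i; rewrite !tnthE -[k.+1]add1n natrD mulrDl mul1r.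
Qed.
Lemma latticeMz (k : int) z : Z z -> Z (vscale k%:~R z).
Proof.
move=> Zz; case: k => k; first exact: latticeMn.
rewrite NegzE (_ : vscale _ _ = vopp (vscale k.+1%:R z)); first by apply/latticeN/latticeMn.
by apply: eq_from_tnth => i; rewrite !tnthE mulrNz mulNr.
Qed.

Hypothesis Zint : integral_lattice Z.
(** Integrality concerns squared norms only, so polarisation leaves a factor 2; the coefficient 2 in
    the wall equation absorbs it. *)
Lemma half_integral z w : Z z -> Z w -> exists k : int, 2 * dot z w = k%:~R.
Proof.
move=> Zz Zw; have [a ha] := Zint (latticeD Zz Zw).
have [b hb] := Zint Zz; have [c hc] := Zint Zw.
exists (a - b - c); rewrite !rmorphB/= -ha -hb -hc !dotE (dotC w z); ring.
Qed.

Definition unit_vec u := Z u /\ dot u u = 1.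

Lemma unit_vec_sq u v : Z u -> Z v -> dot (vadd u v) (vadd u v) <= 1 ->
  vadd u v = vzero R n \/ unit_vec (vadd u v).
Proof.
move=> Zu Zv le1; have Zuv := latticeD Zu Zv.
have [k hk] := Zint Zuv; have k0 := dot_ge0 (vadd u v).
move: le1 k0; rewrite hk -[1]/(1%:~R) ler_int ler0z => k1 k0.
have : k = 0 \/ k = 1 by lia.
case=> kE; [left; apply: dot_eq0; by rewrite hk kE|right; split=> //; by rewrite hk kE].
Qed.

Definition all_units (s : seq V) := forall u, u \in s -> unit_vec u.
(* In a shortest sum of unit vectors any two summands have nonnegative dot product, as
   otherwise their sum would be zero or a unit vector; hence |vsum s|^2 >= size s. *)
Definition shortest (s : seq V) :=
  forall s', all_units s' -> vsum s' = vsum s -> (size s <= size s')%N.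

Lemma dot_vsum (s : seq V) x : dot (vsum s) x = \sum_(u <- s) dot u x.
Proof. by elim: s => [|u s IH]; rewrite ?big_nil ?dot0l// big_cons /= dotDl IH. Qed.

Lemma perm_vsum (s s' : seq V) : perm_eq s s' -> vsum s = vsum s'.
Proof. by move=> p; apply: dot_ext => w; rewrite !dot_vsum; apply: perm_big. Qed.

Lemma shortest_size (s : seq V) : all_units s -> shortest s ->
  (size s)%:R <= dot (vsum s) (vsum s).
Proof.
elim: s => [|u s IH] us ss; first by rewrite /= dot0l.
have us' : all_units s by move=> v vs; apply: us; rewrite inE vs orbT.
have ss' : shortest s.
  move=> s' us'' e; have := ss (u :: s') _ _; rewrite /= ltnS; apply; last by rewrite e.
  by move=> v; rewrite inE => /orP[/eqP->|/us''//]; apply: us; rewrite inE eqxx.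
have [Zu u1] : unit_vec u by apply: us; rewrite inE eqxx.
have h : 0 <= dot (vsum s) u.
  rewrite dot_vsum big_seq; apply: sumr_ge0 => v vs.
  have [Zv v1] := us' _ vs.
  rewrite leNgt; apply/negP => neg.
  have [k hk] := half_integral Zv Zu.
  (* Twice the dot product is an integer, so if negative it is at most -1, and [v + u] has squared
     norm at most 1. *)
  have k1 : (k <= -1)%R.
    have : (k%:~R : R) < 0 by rewrite -hk; lra.
    rewrite ltrz0; lia.
  have k1' : 2 * dot v u <= -1 by rewrite hk -[X in _ <= X]/((-1)%:~R) ler_int.
  have le1 : dot (vadd v u) (vadd v u) <= 1 by rewrite !dotE (dotC u v) u1 v1; lra.
  have pe := perm_to_rem vs.
  have usr : all_units (rem v s) by move=> w /mem_rem; exact: us'.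
  have e1 : vsum (u :: s) = vadd (vadd v u) (vsum (rem v s)).
    by rewrite /= (perm_vsum pe) /= (vaddC v u) vaddA.
  (* Both cases give a shorter sum: the two summands cancel, or they merge into one unit vector. *)
  have [e0|uv] := unit_vec_sq Zv Zu le1.
    have := ss (rem v s) usr; rewrite e1 e0 v0add => /(_ erefl).
    by rewrite /= (perm_size pe) /= ltnNge leqnSn.
  have usv : all_units (vadd v u :: rem v s).
    by move=> w; rewrite inE => /orP[/eqP->|/usr].
  by have := ss _ usv (esym e1); rewrite /= (perm_size pe) /= ltnn.
have := IH us' ss'; rewrite /= !dotE (dotC u (vsum s)) u1 -natr1; lra.
Qed.

Hypothesis Zunit : unit_generated Z.

Lemma lattice_shortest z : Z z -> exists s, [/\ all_units s, shortest s & z = vsum s].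
Proof.
move=> Zz; have [s [us zs]] := Zunit Zz.
have us' : all_units s by move=> u /us [Zu /enorm1].
pose P m := `[< exists s, [/\ all_units s, z = vsum s & size s = m] >].
have exP : exists m, P m by exists (size s); apply/asboolP; exists s.
have [m /asboolP[s' [us'' zs' sm]] minm] := ex_minnP exP.
exists s'; split => // s'' u e; rewrite sm; apply: minm.
by apply/asboolP; exists s''; split => //; rewrite zs' e.
Qed.

(** Adding the unit inequalities along a shortest sum bounds the left side by its length, which is
    at most [|z|^2]. So unit vectors alone cut out the Dirichlet region. *)
Lemma unit_halfspaces_le x z : (forall u, unit_vec u -> 2 * dot x u <= 1) -> Z z ->
  2 * dot x z <= dot z z.
Proof.
move=> hx /lattice_shortest[s [us ss ->]].
apply: le_trans (shortest_size us ss).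
rewrite dotC dot_vsum mulr_sumr.
elim: s us {ss} => [|u s IH] us; first by rewrite big_nil.
rewrite big_cons /= -natr1 dotC.
have := hx u (us u (mem_head _ _)).
have := IH (fun v vs => us v (mem_behead (s:=u::s) vs)); lra.
Qed.

Lemma unit_halfspaces_lt x z : (forall u, unit_vec u -> 2 * dot x u < 1) -> Z z ->
  z <> vzero R n -> 2 * dot x z < dot z z.
Proof.
move=> hx /lattice_shortest[s [us ss ->]] z0.
apply: lt_le_trans (shortest_size us ss).
case: s z0 us {ss} => [//|v s] _ us.
rewrite dotC dot_vsum mulr_sumr big_cons /= -natr1 dotC.
have : \sum_(j <- s) (2 * dot j x) <= (size s)%:R.
  have {}us w : w \in s -> unit_vec w by move=> ws; apply: us; rewrite inE ws orbT.
  elim: s us => [|u s IH] us; first by rewrite big_nil.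
  rewrite big_cons /= -natr1 dotC.
  have := hx u (us u (mem_head _ _)).
  have := IH (fun v vs => us v (mem_behead (s:=u::s) vs)); lra.
have := hx v (us v (mem_head _ _)); lra.
Qed.

End Lattice.

(** * Walls *)

Lemma uniform_radius (R : realType) (T : eqType) (s : seq T) (P : T -> R -> Prop) :
  (forall a r r', P a r -> r' <= r -> P a r') ->
  (forall a, a \in s -> exists2 r, 0 < r & P a r) ->
  exists2 r, 0 < r & forall a, a \in s -> P a r.
Proof.
move=> mono; elim: s => [|a s IH] h; first by exists 1.
have [r r0 Pr] := h a (mem_head _ _).
have [|r' r'0 Pr'] := IH; first by move=> b bs; apply: h; rewrite inE bs orbT.
exists (Num.min r r'); first by rewrite lt_min r0.
move=> b; rewrite inE => /orP[/eqP->|/Pr' Pb].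
  by apply: (mono _ _ _ Pr); rewrite ge_min lexx.
by apply: (mono _ _ _ Pb); rewrite ge_min lexx orbT.
Qed.

Section LatticeBall.
Variables (R : realType) (n : nat) (Z : set (n.-tuple R)).
Local Notation V := (n.-tuple R).
Hypothesis Zlat : is_lattice Z.
Hypothesis Zint : integral_lattice Z.

Lemma lattice_sep z w : Z z -> Z w -> edist z w < 1 -> z = w.
Proof.
move=> Zz Zw; rewrite /edist enorm_lt// expr1n => h.
have [k hk] := Zint (latticeB Zlat Zz Zw); have k0 := dot_ge0 (vsub z w).
move: h k0; rewrite hk -[1]/(1%:~R) ltr_int ler0z => k1 k0.
have k00 : k = 0 by lia.
by apply: vsub_eq0; apply: dot_eq0; rewrite hk k00.
Qed.

(** Pigeonhole on cells of side 1/(n+1): two lattice points in one cell are at distance at most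
    n/(n+1) < 1, hence equal. The list keeps one representative per cell. *)
Lemma lattice_ball_seq (M : R) : exists s : seq V, forall z, Z z -> enorm z <= M -> z \in s.
Proof.
pose m := (Num.truncn ((M + M) * n.+1%:R)).+1.
pose cell (z : V) : {ffun 'I_n -> 'I_m.+1} :=
  [ffun i => inord (Num.truncn ((tnth z i + M) * n.+1%:R))].
exists [seq xget (vzero R n) [set z | [/\ Z z, enorm z <= M & cell z = c]] | c : {ffun 'I_n -> 'I_m.+1}].
move=> z Zz zM; apply/mapP; exists (cell z); first by rewrite mem_enum.
case: xgetP => [w _ [Zw wM e]|/(_ z)/= []//].
apply: lattice_sep => //; apply: le_lt_trans (enorm_le_sum _) _.
have n0 : (0 : R) < n.+1%:R by rewrite ltr0n.
have pos (v : V) i : enorm v <= M -> 0 <= (tnth v i + M) * n.+1%:R.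
  move=> vM; rewrite mulr_ge0// ?ler0n//.
  have := le_trans (tnth_le_enorm v i) vM; rewrite ler_norml; lra.
have low (v : V) i : enorm v <= M -> (Num.truncn ((tnth v i + M) * n.+1%:R) < m.+1)%N.
  move=> vM; rewrite /m ltnS leqW//; apply: le_truncn.
  apply: ler_wpM2r; first exact: ler0n.
  have := le_trans (tnth_le_enorm v i) vM; rewrite ler_norml; lra.
have close i : `|tnth (vsub z w) i| <= (n.+1%:R)^-1.
  have := congr1 (fun f : {ffun 'I_n -> 'I_m.+1} => nat_of_ord (f i)) e.
  rewrite /cell !ffunE !inordK; [|exact: low|exact: low] => te.
  have /andP[a1 a2] := truncn_itv (pos z i zM).
  have /andP[b1 b2] := truncn_itv (pos w i wM).
  move: b1 b2; rewrite te => b1 b2.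
  rewrite tnthE -(ler_pM2r n0) mulVf ?gt_eqF// -[X in _ * X](gtr0_norm n0) -normrM.
  rewrite ler_norml; move: a1 a2 b1 b2 {n0}; set N : R := n.+1%:R.
  rewrite -natr1; set t : R := _%:R => a1 a2 b1 b2; apply/andP; split; lra.
apply: (@le_lt_trans _ _ (\sum_(i < n) (n.+1%:R)^-1)); first by apply: ler_sum => i _; exact: close.
by rewrite sumr_const card_ord -[X in X < _]mulr_natr ltr_pdivrMl// mulr1 ltr_nat.
Qed.
End LatticeBall.

(** The arithmetic behind distant spheres in [sign_le_local], with [a], [v], [z] the sizes of A, of
    a point and of the wall vector, and [e = |A v - z|]. *)
Lemma far_bound (R : realFieldType) (a v z e : R) :
  0 <= a -> a <= 2 -> 0 <= v -> v < 1 -> 4 < z -> z <= e + a * v -> 1 < e ^+ 2.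
Proof.
move=> a0 a2 v0 v1 z4 h; have av : a * v <= 2 by nra.
have e2 : 2 < e by lra.
nra.
Qed.

Section Dynamics.
Variables (R : realType) (n : nat) (iota : n.-tuple R -> n.-tuple R).
Variables (Z K : set (n.-tuple R)).
Local Notation V := (n.-tuple R).
Hypothesis n_gt0 : (0 < n)%N.
Hypothesis iotaP : is_inversion iota.
Hypothesis Zlat : is_lattice Z.
Hypothesis Kdir : dirichlet_choice Z K.
Hypothesis Zint : integral_lattice Z.
Hypothesis Zunit : unit_generated Z.
Hypothesis Keuclid : norm_euclidean K.
Hypothesis Znice : nicely_invertible iota Z.
Implicit Types (x y z u v w b t : V) (A C N : int).
Local Notation O := (orth_part iota).
Local Notation T := (cf_map iota Z K).
Local Notation v0 := (vzero R n).

(** The open Dirichlet cell. It is the interior of [K] whatever the boundary choice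
    ([strict_einterior], [einterior_strict]). *)
Definition strict x := forall u, unit_vec Z u -> 2 * dot x u < 1.

Lemma orth_lattice z : Z z -> Z (O z).
Proof.
move=> Zz; have [->|z0] := pselect (z = v0).
  by rewrite /orth_part (iota0 iotaP) vscale0; exact: lattice0.
by rewrite /orth_part -enorm_sqr; exact: Znice.
Qed.

Lemma unit_opp u : unit_vec Z u -> unit_vec Z (vopp u).
Proof. by case=> Zu u1; split; [exact: latticeN|rewrite !dotE opprK]. Qed.

Lemma edist_le_sq x y : (enorm x <= edist x y) = (2 * dot x y <= dot y y).
Proof.
rewrite enorm_le ?edist_ge0// edist_sqr; apply/idP/idP; lra.
Qed.

Lemma dirichletP x : dirichlet Z x <-> (forall u, unit_vec Z u -> 2 * dot x u <= 1).
Proof.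
split => [h u [Zu u1]|h z Zz].
  by have := h u Zu; rewrite edist_le_sq u1.
by rewrite edist_le_sq; exact: (unit_halfspaces_le Zlat Zint Zunit).
Qed.

Lemma K_dirichlet x : K x -> dirichlet Z x. Proof. by case: Kdir => h _; exact: h. Qed.
Lemma strict_dirichlet x : strict x -> dirichlet Z x.
Proof. by move=> h; apply/dirichletP => u /h /ltW. Qed.

Lemma strict_lattice x z : strict x -> Z z -> z <> v0 -> 2 * dot x z < dot z z.
Proof. exact: (unit_halfspaces_lt Zlat Zint Zunit). Qed.

(** Some translate [x - z] lies in [K]; if z were nonzero, testing it against [-z] would reverse the
    strict inequality between x and z. *)
Lemma strict_K x : strict x -> K x.
Proof.
move=> sx; case: Kdir => _ /(_ x)[z [Zz Kz _]].
have [z0|z0] := pselect (z = v0); first by move: Kz; rewrite z0 vsub0.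
have := K_dirichlet Kz (latticeN Zlat Zz); rewrite edist_le_sq.
have := strict_lattice sx Zz z0; rewrite !dotE; lra.
Qed.

Lemma lattice_in_dirichlet x : Z x -> dirichlet Z x -> x = v0.
Proof.
move=> Zx /(_ x Zx); rewrite edistxx => h; apply: enorm_eq0; apply/eqP.
by rewrite eq_le h enorm_ge0.
Qed.

Lemma K0 : K v0.
Proof.
case: Kdir => _ /(_ v0)[z [Zz Kz _]]; move: (Kz).
rewrite (_ : vsub v0 z = v0) //.
apply: lattice_in_dirichlet; last exact: K_dirichlet.
exact: (latticeB Zlat (lattice0 Zlat)).
Qed.

(** The radius bound extends from [K] to the closed Dirichlet region, since shrinking a point of the
    region makes it [strict] and so puts it in [K]. *)
Lemma K_bound : exists r, [/\ 0 <= r, r < 1 & forall x, dirichlet Z x -> enorm x <= r].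
Proof.
have [r r1 Kr] := Keuclid.
have r0 : 0 <= r by have := Kr _ K0; rewrite enorm0.
exists r; split => // x dx; rewrite leNgt; apply/negP => rx.
have x0 : 0 < enorm x by exact: le_lt_trans rx.
(* This factor brings the norm to the midpoint of [r] and [|x|], still above [r]. *)
pose t := (r + enorm x) / (2 * enorm x).
have t0 : 0 < t by rewrite divr_gt0// ?mulr_gt0//; lra.
have t1 : t < 1 by rewrite ltr_pdivrMr ?mulr_gt0//; lra.
have : K (vscale t x).
  apply: strict_K => u uu; rewrite dotZl.
  have /dirichletP/(_ u uu) := dx; nra.
move=> /Kr; rewrite enormZ gtr0_norm// /t.
have -> : (r + enorm x) / (2 * enorm x) * enorm x = (r + enorm x) / 2.
  by field; rewrite lt0r_neq0.
lra.
Qed.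

Lemma lfloorP x : Z (lfloor Z K x) /\ K (vsub x (lfloor Z K x)).
Proof.
rewrite /lfloor; case: xgetP => [z _ //|h].
by case: Kdir => _ /(_ x)[z [Zz Kz _]]; exfalso; exact: (h z).
Qed.
Lemma lfloor_uniq x z : Z z -> K (vsub x z) -> lfloor Z K x = z.
Proof.
move=> Zz Kz; case: Kdir => _ /(_ x)[w [Zw Kw h]].
by case: (lfloorP x) => a b; rewrite (h _ a b) (h _ Zz Kz).
Qed.

Lemma cf_map_K x : K (T x).
Proof.
rewrite /cf_map; case: ifP => _; first exact: K0.
by case: (lfloorP (iota x)).
Qed.

Lemma cf_map_branch x z : K x -> Z z -> T (iota (vadd x z)) = x.
Proof.
move=> Kx Zz; rewrite /cf_map; case: eqP => [h|h].
  (* The degenerate branch ends at the origin, where [T] is set to 0; then [x = -z] is a lattice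
     point of [K], so it is 0 too. *)
  have xz : vadd x z = v0 by rewrite -(iotaK iotaP (vadd x z)) h (iota0 iotaP).
  apply/esym/lattice_in_dirichlet; last exact: K_dirichlet.
  have -> : x = vopp z; last exact: latticeN.
  by rewrite -(vaddK x z) xz; apply: eq_from_tnth => i; rewrite !tnthE sub0r.
rewrite (iotaK iotaP) (@lfloor_uniq _ z) ?vaddK//.
Qed.

Lemma cf_map_branchE x : exists2 z, Z z & x = iota (vadd (T x) z).
Proof.
rewrite /cf_map; case: eqP => [->|h].
  by exists v0; [exact: lattice0|rewrite vadd0 (iota0 iotaP)].
case: (lfloorP (iota x)) => Zf _; exists (lfloor Z K (iota x)) => //.
by rewrite vsubK (iotaK iotaP).
Qed.

(** Without unit vectors the Dirichlet region would be the whole space, against [K_bound] in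
    positive dimension. *)
Lemma unit_exists : exists u, unit_vec Z u.
Proof.
apply: contrapT => nou.
have [r [r0 r1 hr]] := K_bound.
pose e : V := [tuple 2 | i < n].
have : dirichlet Z e by apply/dirichletP => u uu; exfalso; apply: nou; exists u.
move=> /hr; have := tnth_le_enorm e (Ordinal n_gt0).
rewrite tnth_mktuple ger0_norm; lra.
Qed.

(* The zero set of [wfun A z C] is the sphere of centre z / A and radius 1 / |A|, or, if
   A = 0, the hyperplane 2 <x, z> = C with |z| = 1. *)
Definition wfun A z C x : R := A%:~R * dot x x - 2 * dot x z + C%:~R.
Definition wall (N : int) A z C :=
  [/\ Z z, dot z z = 1 + (A * C)%:~R & `|A| <= N].
(** Only strict signs are transported: a wall through [x] puts no condition on [y]. This makes the
    relation an open condition on [y] near [x]. *)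
Definition sign_le (N : int) x y := forall A z C, wall N A z C ->
  (0 < wfun A z C x -> 0 < wfun A z C y) /\ (wfun A z C x < 0 -> wfun A z C y < 0).

(* iota exchanges the coefficients A and C, so the bound on A is lost exactly for the walls
   with |C| > N; those are the ones [const_sign] excludes. *)
Lemma wfun_iota A z C x : x <> v0 ->
  dot x x * wfun A z C (iota x) = wfun C (O z) A x.
Proof.
move=> x0; have xx := dot_gt0 x0.
rewrite /wfun (iota_sq iotaP) (iota_dotr iotaP); field; by rewrite lt0r_neq0.
Qed.

(** A translation keeps A, moves z to [z - A t], and preserves [|z|^2 - AC = 1]. The new constant
    [C - 2<t,z> + A|t|^2] is an integer by [half_integral]. *)
Lemma wfun_shift N A z C t : wall N A z C -> Z t ->
  exists z' C', wall N A z' C' /\ forall x, wfun A z C (vadd x t) = wfun A z' C' x.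
Proof.
move=> [Zz zz AN] Zt.
have [k hk] := half_integral Zlat Zint Zt Zz; have [m hm] := Zint Zt.
exists (vsub z (vscale A%:~R t)), (C - k + A * m); split.
  split => //; first by apply: latticeB => //; exact: latticeMz.
  have -> : dot (vsub z (vscale A%:~R t)) (vsub z (vscale A%:~R t)) =
     dot z z - A%:~R * (2 * dot t z) + A%:~R * (A%:~R * dot t t).
    by rewrite !dotE (dotC z t); ring.
  by rewrite hk hm zz !(rmorphM, rmorphD, rmorphB)/=; ring.
have e : (C - k + A * m)%:~R = C%:~R - 2 * dot t z + A%:~R * dot t t :> R.
  by rewrite rmorphD rmorphB rmorphM /= hk hm.
by move=> x; rewrite /wfun e !dotE (dotC t x); ring.
Qed.

Lemma wfunN A z C x : wfun (- A) (vopp z) (- C) x = - wfun A z C x.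
Proof. by rewrite /wfun !rmorphN /= dotNr; ring. Qed.

Lemma wallN N A z C : wall N A z C -> wall N (- A) (vopp z) (- C).
Proof.
by move=> [Zz zz AN]; split; [exact: latticeN|rewrite !dotE mulrNN opprK|rewrite normrN].
Qed.

Lemma sign_le_shift N x y t : Z t -> sign_le N x y -> sign_le N (vadd x t) (vadd y t).
Proof.
move=> Zt xy A z C w; have [z' [C' [w' e]]] := wfun_shift w Zt.
by rewrite !e; exact: xy.
Qed.

Lemma wall_iota N A z C : wall N A z C -> `|C| <= N -> wall N C (O z) A.
Proof.
move=> [Zz zz AN] CN; split => //; first exact: orth_lattice.
by rewrite (dot_orth_part iotaP) zz mulrC.
Qed.

Lemma unit_wall N u : 1 <= N -> unit_vec Z u -> wall N 0 u 1.
Proof. by move=> N1 [Zu u1]; split; rewrite // ?normr0 ?(le_trans _ N1)// mul0r addr0. Qed.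

Lemma unit_wfun u x : wfun 0 u 1 x = 1 - 2 * dot x u.
Proof. rewrite /wfun; ring. Qed.

(** C is the value of [wfun] at the origin: the wall misses the open cell and its function has the
    sign of C there. *)
Definition const_sign N := forall A z C b, wall N A z C -> N < `|C| -> strict b ->
  0 < C%:~R * wfun A z C b.

Lemma sign_le_strict N x y : 1 <= N -> sign_le N x y -> strict x -> strict y.
Proof.
move=> N1 xy sx u uu; have [h _] := xy _ _ _ (unit_wall N1 uu).
by move: h; rewrite !unit_wfun !subr_gt0; apply; exact: sx.
Qed.

Lemma sgn_transfer (a b s t : R) : 0 < a -> 0 < b ->
  (0 < a * s -> 0 < b * t) /\ (a * s < 0 -> b * t < 0) ->
  (0 < s -> 0 < t) /\ (s < 0 -> t < 0).
Proof. by move=> a0 b0; rewrite !(pmulr_rgt0, pmulr_rlt0). Qed.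

(** Inversion carries a side (0, u, 1) of the cell to the unit sphere (1, O u, 0), a wall of every
    level [N >= 1]; so membership of [iota x] in the cell transfers without [const_sign]. *)
Lemma sign_le_iota_unit N x y u : 1 <= N -> x <> v0 -> y <> v0 -> sign_le N x y ->
  unit_vec Z u ->
  (0 < wfun 0 u 1 (iota x) -> 0 < wfun 0 u 1 (iota y)) /\
  (wfun 0 u 1 (iota x) < 0 -> wfun 0 u 1 (iota y) < 0).
Proof.
move=> N1 x0 y0 xy uu; apply: (sgn_transfer (dot_gt0 x0) (dot_gt0 y0)).
by rewrite !wfun_iota//; apply: xy; apply: wall_iota; [exact: unit_wall|rewrite normr1].
Qed.

Lemma sign_le_iota_strict N x y : 1 <= N -> x <> v0 -> y <> v0 -> sign_le N x y ->
  strict (iota x) -> strict (iota y).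
Proof.
move=> N1 x0 y0 xy sx u uu; have [h _] := sign_le_iota_unit N1 x0 y0 xy uu.
by move: h; rewrite !unit_wfun !subr_gt0; apply; exact: sx.
Qed.

(** The closed condition passes from [y] back to [x], because violating it is a strict sign, which
    passes from [x] to [y]. *)
Lemma sign_le_iota_dirichlet N x y : 1 <= N -> x <> v0 -> y <> v0 -> sign_le N x y ->
  dirichlet Z (iota y) -> dirichlet Z (iota x).
Proof.
move=> N1 x0 y0 xy /dirichletP sy; apply/dirichletP => u uu.
have [_ h] := sign_le_iota_unit N1 x0 y0 xy uu.
rewrite leNgt; apply/negP => neg; have := sy u uu; rewrite leNgt => /negP; apply.
by move: h; rewrite !unit_wfun !subr_lt0; apply.
Qed.

Lemma sign_le_iota N x y : 1 <= N -> const_sign N -> x <> v0 -> y <> v0 -> sign_le N x y ->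
  strict (iota x) -> strict (iota y) -> sign_le N (iota x) (iota y).
Proof.
move=> N1 NS x0 y0 xy sx sy A z C w.
have [CN|CN] := leP `|C| N.
  apply: (sgn_transfer (dot_gt0 x0) (dot_gt0 y0)).
  by rewrite !wfun_iota//; apply: xy; exact: wall_iota.
have := NS _ _ _ _ w CN sx; have := NS _ _ _ _ w CN sy.
case: (ltrgt0P (C%:~R : R)) => [c0|c0|->]; last by rewrite mul0r ltxx.
  by rewrite !pmulr_rgt0// => ? ?; split => // ?; lra.
by rewrite !nmulr_rgt0// => ? ?; split => // ?; lra.
Qed.

(** Local finiteness: all but finitely many walls keep one sign on the open unit ball, and each of
    the others is handled by continuity of [wfun]. *)
Lemma sign_le_local N x : 1 <= N -> N <= 2 -> enorm x < 1 ->
  exists2 d, 0 < d & forall y, edist y x < d -> sign_le N x y.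
Proof.
move=> N1 N2 x1.
(* If [|A| <= 2] and [|z| > 4], then [|A v - z| > 2] on the unit ball. If [|z| <= 4], then
   [AC <= 15], so [|C| > 20] is possible only for hyperplanes. *)
have [s hs] := lattice_ball_seq Zlat Zint 4.
pose ints := [seq k%:Z - 20 | k <- seq.iota 0 41].
have intsP (k : int) : `|k| <= 20 -> k \in ints.
  move=> k20; apply/mapP; exists (absz (k + 20)); last by lia.
  by rewrite mem_iota; lia.
pose P (a : int * V * int) (r : R) := forall y, edist y x < r ->
  (0 < wfun a.1.1 a.1.2 a.2 x -> 0 < wfun a.1.1 a.1.2 a.2 y) /\
  (wfun a.1.1 a.1.2 a.2 x < 0 -> wfun a.1.1 a.1.2 a.2 y < 0).
have := @uniform_radius R _ [seq (p, C) | p <- [seq (A, z) | A <- ints, z <- s], C <- ints] P.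
case.
- by move=> a r r' Pa rr y yr; apply: Pa; exact: lt_le_trans rr.
- move=> [[A z] C] _ /=; rewrite /P /=.
  have [->|w0] := eqVneq (wfun A z C x) 0; first by exists 1 => // y _; rewrite !ltxx.
  (* A Lipschitz constant for [wfun] at [x] on the unit ball around it; the summand 1 keeps it
     positive. *)
  pose M : R := 1 + `|A%:~R| * (2 * enorm x + 1) + 2 * enorm z.
  have M0 : 0 < M by rewrite /M -addrA ltr_pwDl// addr_ge0 ?mulr_ge0 ?addr_ge0 ?mulr_ge0 ?enorm_ge0.
  have cont y : edist y x < 1 -> `|wfun A z C y - wfun A z C x| <= M * edist y x.
    move=> yx.
    have -> : wfun A z C y - wfun A z C x =
       A%:~R * (dot (vsub y x) (vadd (vsub y x) (vscale 2 x))) - 2 * dot (vsub y x) z.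
      by rewrite /wfun !dotE (dotC x y); ring.
    apply: le_trans (ler_normB _ _) _; rewrite !normrM normr_nat.
    have h1 := dot_abs (vsub y x) z.
    have h2 := dot_abs (vsub y x) (vadd (vsub y x) (vscale 2 x)).
    have h3 : enorm (vadd (vsub y x) (vscale 2 x)) <= 1 + 2 * enorm x.
      by apply: le_trans (enormD _ _) _; rewrite enormZ normr_nat lerD2r; exact: ltW.
    rewrite -/(edist y x) in h1 h2.
    have d0 := edist_ge0 y x.
    have h4 : `|A%:~R| * `|dot (vsub y x) (vadd (vsub y x) (vscale 2 x))| <=
       `|A%:~R| * (edist y x * (1 + 2 * enorm x)) :> R.
      by apply: ler_wpM2l => //; apply: le_trans h2 _; apply: ler_wpM2l.
    rewrite /M; lra.
  exists (Num.min 1 (`|wfun A z C x| / M)); first by rewrite lt_min ltr01 divr_gt0// normr_gt0.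
  move=> y; rewrite lt_min => /andP[y1]; rewrite ltr_pdivlMr// mulrC => yM.
  have := le_lt_trans (cont y y1) yM; rewrite ltr_norml => /andP[ha hb].
  split => h; [move: ha; rewrite gtr0_norm//|move: hb; rewrite ltr0_norm//]; lra.
move=> r r0 hr.
exists (Num.min r (1 - enorm x)); first by rewrite lt_min r0; lra.
move=> y; rewrite lt_min => /andP[yr y1] A z C w.
have {y1} y1 : enorm y < 1.
  rewrite -edist0; apply: le_lt_trans (edist_tri x _ _) _; rewrite edist0; lra.
have [Zz zz AN] := w.
have A2 : `|A| <= 2 by exact: le_trans N2.
have x0 := enorm_ge0 x; have y0 := enorm_ge0 y; have z0 := enorm_ge0 z.
have [z4|z4] := leP (enorm z) 4; last first.
  (* A hyperplane has [|z| = 1], so a long z belongs to a sphere, and the whole unit ball lies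
     outside it. *)
  have A0 : A != 0.
    apply/eqP => A0; move: zz; rewrite A0 mul0r addr0 -enorm_sqr => zz.
    by move: zz; nra.
  have key v : enorm v < 1 -> 0 < A%:~R * wfun A z C v.
    move=> v1; have v00 := enorm_ge0 v.
    have -> : A%:~R * wfun A z C v =
        dot (vsub (vscale A%:~R v) z) (vsub (vscale A%:~R v) z) - 1.
      rewrite /wfun !dotE zz rmorphM /= (dotC z v); ring.
    rewrite subr_gt0 -enorm_sqr.
    have : enorm z <= enorm (vsub (vscale A%:~R v) z) + enorm (vscale A%:~R v).
      rewrite -(enormN (vsub _ _)); apply: le_trans (enormD _ _).
      by rewrite le_eqVlt; apply/orP; left; apply/eqP; congr enorm;
        apply: eq_from_tnth => i; rewrite !tnthE; ring.
    rewrite enormZ.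
    have : `|A%:~R| <= 2 :> R by rewrite -intr_norm -[2]/(2%:~R) ler_int.
    by move=> A2' h; exact: (far_bound (normr_ge0 _) A2' v00 v1 z4 h).
  have := key x x1; have := key y y1.
  case: (ltrgt0P (A%:~R : R)) => [c0|c0|->]; last by rewrite mul0r ltxx.
    by rewrite !pmulr_rgt0// => ? ?; split => // ?; lra.
  by rewrite !nmulr_rgt0// => ? ?; split => // ?; lra.
have [C20|C20] := leP `|C| 20.
  have := hr (A, z, C) _ y yr; apply.
  apply: (@allpairs_f _ _ _ (fun p C => (p, C))); last exact: intsP.
  apply: (@allpairs_f _ _ _ (fun A z => (A, z))); last exact: hs.
  by apply: intsP; exact: le_trans A2 _.
(* [AC = |z|^2 - 1] lies between -1 and 15, so [|C| > 20] leaves no nonzero A; the remaining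
   hyperplane misses the unit ball. *)
have A0 : A = 0.
  have : (A * C)%:~R <= (15%:Z)%:~R :> R.
    move: zz; rewrite -enorm_sqr => zz.
    have -> : (A * C)%:~R = enorm z ^+ 2 - 1 :> R by rewrite zz; ring.
    rewrite -[15%:Z%:~R]/(15%:R); nra.
  have : (-1)%:~R <= (A * C)%:~R :> R.
    have := dot_ge0 z; rewrite zz; rewrite -[(-1)%:~R]/(-1%R); lra.
  by rewrite !ler_int => h1 h2; clear -C20 h1 h2; nia.
have key v : enorm v < 1 -> 0 < C%:~R * wfun A z C v.
  move=> v1; have v00 := enorm_ge0 v.
  have z1 : enorm z = 1 by apply/enorm1; rewrite zz A0 mul0r addr0.
  have := dot_abs v z; rewrite z1 mulr1 A0 /wfun mul0r sub0r ler_norml => /andP[h1 h2].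
  have : C%:~R <= (-20%:Z)%:~R :> R \/ (20%:Z)%:~R <= C%:~R :> R.
    by rewrite !ler_int; clear -C20; lia.
  rewrite -[20%:Z%:~R]/(20%:R : R) -[(-20%:Z)%:~R]/(-20%:R : R).
  by case=> ?; nra.
have := key x x1; have := key y y1.
case: (ltrgt0P (C%:~R : R)) => [c0|c0|->]; last by rewrite mul0r ltxx.
  by rewrite !pmulr_rgt0// => ? ?; split => // ?; lra.
by rewrite !nmulr_rgt0// => ? ?; split => // ?; lra.
Qed.

Lemma strict_einterior x : strict x -> einterior K x.
Proof.
move=> sx; have [r [r0 r1 hr]] := K_bound.
have x1 : enorm x < 1 by apply: le_lt_trans r1; apply: hr; exact: strict_dirichlet.
have [d d0 hd] := @sign_le_local 1 x isT isT x1.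
exists d => // y yx; apply: strict_K; apply: (@sign_le_strict 1 _ _ isT _ sx); exact: hd.
Qed.

Lemma einterior_strict x : einterior K x -> strict x.
Proof.
move=> [d d0 hd] u uu.
have u1 : enorm u = 1 by apply/enorm1; case: uu.
have : K (vadd x (vscale (d / 2) u)).
  apply: hd; rewrite /eball /= /edist.
  have -> : vsub (vadd x (vscale (d / 2) u)) x = vscale (d / 2) u.
    by apply: eq_from_tnth => i; rewrite !tnthE; ring.
  rewrite enormZ u1 gtr0_norm; lra.
move=> /K_dirichlet /dirichletP /(_ u uu); rewrite !dotE -(enorm_sqr u) u1; lra.
Qed.

Lemma eboundary_dirichlet x : eboundary K x -> dirichlet Z x.
Proof.
move=> [cx _]; apply/dirichletP => u uu.
have u1 : enorm u = 1 by apply/enorm1; case: uu.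
rewrite leNgt; apply/negP => neg.
have [|y [Ky yx]] := cx (dot x u - 1 / 2); first by lra.
have /dirichletP/(_ u uu) := K_dirichlet Ky.
have := dot_CS (vsub x y) u; rewrite u1 mulr1 -/(edist x y) edistC dotBl; lra.
Qed.

Lemma eboundary_strict x : eboundary K x -> strict x -> False.
Proof. by move=> [_ ni] sx; apply: ni; exact: strict_einterior sx. Qed.

(** Shrinking towards the origin enters the open cell, so the closure of [K] contains every point of
    the closed region, independently of the boundary choice. *)
Lemma dirichlet_eboundary x : dirichlet Z x -> ~ strict x -> eboundary K x.
Proof.
move=> dx nsx; split; last by move=> /einterior_strict.
move=> d d0; have x0 := enorm_ge0 x.
pose t := d / (d + enorm x + 1).
have e0 : 0 < d + enorm x + 1 by lra.
have t0 : 0 < t by rewrite divr_gt0.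
have t1 : t < 1 by rewrite ltr_pdivrMr; lra.
exists (vscale (1 - t) x); split.
  by apply: strict_K => u uu; rewrite dotZl; have /dirichletP/(_ u uu) := dx; nra.
rewrite /edist (_ : vsub _ _ = vscale (- t) x); last first.
  by apply: eq_from_tnth => i; rewrite !tnthE; ring.
rewrite enormZ normrN gtr0_norm// /t mulrAC ltr_pdivrMr//; nra.
Qed.

(** Remoteness is a weak inequality on [K]; at an interior point it is strict, since a small step
    towards [w] stays in [K] and would come closer than [p]. *)
Lemma strict_remote w b (p : R) : 0 < p -> (forall x, K x -> p <= edist w x) -> strict b ->
  p < edist w b.
Proof.
move=> p0 far sb; rewrite ltNge; apply/negP => wb.
have [d d0 hd] : einterior K b by exact: strict_einterior.
have {wb} wb : edist w b = p.
  by apply/eqP; rewrite eq_le wb far//; exact: strict_K.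
have dp : 0 < d + p by rewrite addr_gt0.
(* The step has length [s p < d], so it stays in the ball contained in [K]. *)
pose s := d / (d + p).
have s0 : 0 < s by rewrite divr_gt0.
have s1 : s < 1 by rewrite ltr_pdivrMr// mul1r ltrDl.
have : K (vadd b (vscale s (vsub w b))).
  apply: hd; rewrite /eball /= /edist.
  have -> : vsub (vadd b (vscale s (vsub w b))) b = vscale s (vsub w b).
    by apply: eq_from_tnth => i; rewrite !tnthE; ring.
  rewrite enormZ gtr0_norm// -/(edist w b) wb /s mulrAC ltr_pdivrMr//; nra.
move=> /far; rewrite /edist.
have -> : vsub w (vadd b (vscale s (vsub w b))) = vscale (1 - s) (vsub w b).
  by apply: eq_from_tnth => i; rewrite !tnthE; ring.
rewrite enormZ gtr0_norm ?subr_gt0// -/(edist w b) wb; nra.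
Qed.

Lemma wfun_center A z C b : dot z z = 1 + (A * C)%:~R ->
  A%:~R * wfun A z C b = enorm (vsub (vscale A%:~R b) z) ^+ 2 - 1.
Proof.
by move=> zz; rewrite enorm_sqr /wfun !dotE zz rmorphM /= (dotC z b); ring.
Qed.

Lemma far_center A z b : 0 < A -> strict b -> A%:~R + 1 <= enorm z ->
  1 < enorm (vsub (vscale A%:~R b) z).
Proof.
move=> A0 sb h; have [r [r0 r1 hr]] := K_bound.
have b1 : enorm b < 1 by apply: le_lt_trans r1; apply: hr; exact: strict_dirichlet.
have A0' : 0 < A%:~R :> R by rewrite ltr0z.
have : enorm z <= enorm (vsub (vscale A%:~R b) z) + enorm (vscale A%:~R b).
  rewrite -(enormN (vsub _ _)); apply: le_trans (enormD _ _).
  by rewrite le_eqVlt; apply/orP; left; apply/eqP; congr enorm;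
    apply: eq_from_tnth => i; rewrite !tnthE; ring.
rewrite enormZ (gtr0_norm A0'); nra.
Qed.

(** Negating (A, z, C) reduces to [A >= 0]. For [A > 0] the bound [AC >= -1] forces [C > 0], and the
    claim says that b lies outside the sphere. For [A = 0] the vector z is a unit and
    [|2<b,z>| < 1 < |C|]. *)
Lemma const_sign_pos N : (forall A z C b, wall N A z C -> 0 < A -> N < `|C| -> strict b ->
    1 < enorm (vsub (vscale A%:~R b) z)) -> 1 <= N -> const_sign N.
Proof.
move=> h N1.
have pos A z C b : wall N A z C -> 0 < A -> N < `|C| -> strict b -> 0 < C%:~R * wfun A z C b.
  move=> w A0 CN sb; have [_ zz _] := w.
  have A0' : 0 < A%:~R :> R by rewrite ltr0z.
  have C0 : 0 < C%:~R :> R.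
    have : (-1)%:~R <= (A * C)%:~R :> R.
      by have := dot_ge0 z; rewrite zz -[(-1)%:~R]/(-1 : R); lra.
    by rewrite ler_int ltr0z => AC; clear -A0 CN N1 AC; nia.
  rewrite pmulr_rgt0// -(pmulr_rgt0 _ A0') (wfun_center _ zz) subr_gt0.
  by have := h A z C b w A0 CN sb; nra.
move=> A z C b w CN sb; case: (ltrgt0P A) => A0; first exact: pos.
  have := pos _ _ _ _ (wallN w) _ _ sb; rewrite oppr_gt0 normrN => /(_ A0 CN).
  by rewrite wfunN rmorphN mulrNN.
have [Zz zz _] := w.
have uu : unit_vec Z z by split => //; rewrite zz A0 mul0r addr0.
have := sb _ uu; have := sb _ (unit_opp uu); rewrite dotNr A0 /wfun mul0r sub0r => h1 h2.
have : C%:~R <= (-1)%:~R :> R \/ 1%:~R <= C%:~R :> R.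
  by rewrite !ler_int; clear -CN N1; lia.
rewrite -[1%:~R]/(1 : R) -[(-1)%:~R]/(-1 : R).
by case=> ?; nra.
Qed.

(** With N = 1 the only doubtful sphere has A = 1, C = 2: centre z with [|z|^2 = 3], radius 1, which
    is 3-remoteness. With N = 2 it has A = 2, C = 3: centre z/2 with [|z|^2 = 7], radius 1/2, which
    is 7-remoteness. All others satisfy [|z| >= A + 1] and fall under [far_center]. *)
Lemma remote_const_sign : remote3 Z K \/ remote7 Z K ->
  exists N, [/\ 1 <= N, N <= 2 & const_sign N].
Proof.
have int_ge (k : int) (m : nat) z : dot z z = 1 + k%:~R -> (m%:Z ^+ 2 - 1 <= k) -> m%:R <= enorm z.
  move=> zz; rewrite -(ler_int R) rmorphB rmorphXn /= => h.
  by rewrite enorm_ge ?ler0n// zz -lerBlDl.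
have AC_ge A C z : dot z z = 1 + (A * C)%:~R -> -1 <= A * C.
  move=> zz; rewrite -(ler_int R) -[(-1)%:~R]/(-1 : R).
  by have := dot_ge0 z; rewrite zz; lra.
case=> rem.
  exists 1; split => //; apply: const_sign_pos => // A z C b [Zz zz AN] A0 CN sb.
  have A1 : A = 1 by clear -AN A0; lia.
  have AC := AC_ge _ _ _ zz; rewrite A1 mul1r in AC zz *.
  have [C2|C2] := eqVneq C 2.
    rewrite vscale1 -/(edist b z) edistC; apply: strict_remote => // x Kx; apply: rem => //.
    by rewrite /enorm zz C2 -[2%:~R]/(2 : R) (_ : 1 + 2 = 3 :> R)//; ring.
  apply: (@far_center 1) => //; apply: (int_ge _ 2%N _ zz).
  by clear -AC C2 CN; lia.
exists 2; split => //; apply: const_sign_pos => // A z C b [Zz zz AN] A0 CN sb.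
have AC := AC_ge _ _ _ zz.
have [A1|A2] : A = 1 \/ A = 2 by clear -AN A0; lia.
  rewrite A1 mul1r in AC zz *.
  apply: (@far_center 1) => //; apply: (int_ge _ 2%N _ zz).
  by clear -AC CN; lia.
rewrite A2 in AC zz *.
have [C3|C3] := eqVneq C 3.
  have : 2^-1 < edist (vscale 2^-1 z) b.
    apply: strict_remote => // x Kx; apply: rem => //.
    by rewrite /enorm zz C3 -[(2 * 3)%:~R]/(6 : R) (_ : 1 + 6 = 7 :> R)//; ring.
  have -> : vsub (vscale 2%:~R b) z = vscale (- 2) (vsub (vscale 2^-1 z) b).
    by apply: eq_from_tnth => i; rewrite !tnthE -[2%:~R]/(2 : R); field.
  rewrite enormZ normrN normr_nat -/(edist _ b); lra.
apply: (@far_center 2) => //; rewrite (_ : _ + 1 = 3%:R)//; last by rewrite -[2%:~R]/(2 : R); ring.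
apply: (int_ge _ 3%N _ zz).
by clear -AC C3 CN; lia.
Qed.

(* The set on whose components the theorem asserts analyticity. *)
Definition good : set V :=
  K `\` \bigcup_(k in [set: nat]) (iter k T @` eboundary K).

Lemma good_K x : good x -> K x. Proof. by case. Qed.

Lemma good_avoid x k b : good x -> eboundary K b -> iter k T b = x -> False.
Proof. by move=> [_ h] bb e; apply: h; exists k => //; exists b. Qed.

Lemma good_strict x : good x -> strict x.
Proof.
move=> gx; apply: contrapT => ns.
apply: (@good_avoid x 0%N x gx) => //.
apply: dirichlet_eboundary => //; exact/K_dirichlet/good_K.
Qed.

Lemma half_unit_eboundary u : unit_vec Z u -> eboundary K (vscale (1 / 2) u).
Proof.
move=> uu; apply: dirichlet_eboundary; last first.
  by move=> /(_ u uu); rewrite dotZl; case: uu => _ ->; lra.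
have u1 : enorm u = 1 by apply/enorm1; case: uu.
apply/dirichletP => w ww; have w1 : enorm w = 1 by apply/enorm1; case: ww.
by have := dot_CS u w; rewrite dotZl u1 w1; lra.
Qed.

(** The origin is in the forward orbit of the boundary: the midpoint [u/2] of a side inverts to the
    lattice point [2 O u], so [T (u/2) = 0]. *)
Lemma good_neq0 x : good x -> x <> v0.
Proof.
move=> gx x0; have [u uu] := unit_exists.
apply: (good_avoid (k := 1) gx (half_unit_eboundary uu)) => /=.
have -> : vscale (1 / 2) u = iota (vadd v0 (vscale 2%:R (O u))).
  apply: dot_ext => w; rewrite v0add (iota_dotr iotaP).
  move: (dot_orth_part iotaP u w) (dot_orth_part iotaP u u).
  case: uu => _ ->; move: (O u) (O w) => p q; rewrite !dotE => -> ->; by field.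
rewrite x0; apply: cf_map_branch; first exact: K0.
by apply: (@latticeMn _ _ Z Zlat 2); apply: orth_lattice; case: uu.
Qed.

Lemma strict_shift_neq0 x t : strict x -> x <> v0 -> Z t -> vadd x t <> v0.
Proof.
move=> sx x0 Zt xt; apply: x0.
apply: lattice_in_dirichlet; last exact: strict_dirichlet.
have -> : x = vopp t; last exact: latticeN.
by rewrite -(vaddK x t) xt; apply: eq_from_tnth => i; rewrite !tnthE sub0r.
Qed.

(** Goodness is required of [x] only; for [y] it is a consequence ([linked_good]), which makes the
    good set open. *)
Definition linked N x y := good x /\ sign_le N x y.

(** * Transfer of inverse branches between linked points *)

Section Level.
Variable N : int.
Hypothesis N1 : 1 <= N.
Hypothesis N2 : N <= 2.
Hypothesis NS : const_sign N.

Lemma linked_strict x y : linked N x y -> strict y.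
Proof. by move=> [/good_strict sx xy]; exact: (sign_le_strict N1 xy). Qed.

(* The origin lies on every wall (0, u, 0) with u a unit vector, but x does not. *)
Lemma linked_neq0 x y : linked N x y -> y <> v0.
Proof.
move=> [gx xy] y0; apply: (good_neq0 gx); have x1 := good_strict gx.
have zero u : unit_vec Z u -> dot x u = 0.
  move=> uu; have [] : (0 < wfun 0 u 0 x -> 0 < wfun 0 u 0 y) /\
     (wfun 0 u 0 x < 0 -> wfun 0 u 0 y < 0).
    apply: xy; case: uu => Zu u1; split => //; first by rewrite mul0r addr0.
    by rewrite normr0 (le_trans _ N1).
  have e v : wfun 0 u 0 v = - (2 * dot v u) by rewrite /wfun; ring.
  rewrite !e y0 dot0l mulr0 oppr0 ltxx oppr_gt0 oppr_lt0 => h1 h2.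
  have [h|h|] := ltrgtP (dot x u) 0; last by [].
    by have : false by apply: h1; lra.
  by have : false by apply: h2; lra.
(* Now x is orthogonal to all unit vectors, so its whole line lies in the Dirichlet region; its
   point of norm 2 contradicts the radius bound. *)
have [r [r0 r1 hr]] := K_bound.
apply: contrapT => /enorm_gt0 x0.
have : dirichlet Z (vscale (2 / enorm x) x).
  by apply/dirichletP => u uu; rewrite dotZl zero// !mulr0.
have e0 : enorm x != 0 by rewrite gt_eqF.
move=> /hr; rewrite enormZ gtr0_norm; last by rewrite divr_gt0.
by rewrite divfK //; lra.
Qed.

(** If [iota (x + t)] were on the boundary, [T] would bring that boundary point to the good point x.
    Hence closed membership at either point puts both images in the open cell. Goodness passes to
    the preimage for the same reason. *)
Lemma linked_branch x y t : linked N x y -> Z t ->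
  dirichlet Z (iota (vadd x t)) \/ dirichlet Z (iota (vadd y t)) ->
  linked N (iota (vadd x t)) (iota (vadd y t)).
Proof.
move=> l Zt dd; have [gx xy] := l.
have xt0 := strict_shift_neq0 (good_strict gx) (good_neq0 gx) Zt.
have yt0 := strict_shift_neq0 (linked_strict l) (linked_neq0 l) Zt.
have xyt := sign_le_shift Zt xy.
have dx : dirichlet Z (iota (vadd x t)).
  by case: dd => //; exact: (sign_le_iota_dirichlet N1 xt0 yt0 xyt).
have Tx := cf_map_branch (good_K gx) Zt.
have sx : strict (iota (vadd x t)).
  by apply: contrapT => /(dirichlet_eboundary dx) h; exact: (good_avoid (k := 1) gx h).
split; last first.
  by apply: (sign_le_iota N1) => //; exact: (sign_le_iota_strict N1 xt0 yt0 xyt).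
split; first exact: strict_K.
by move=> [k _ [b bb e]]; apply: (good_avoid (k := k.+1) gx bb); rewrite iterS e.
Qed.

(** If [y = T^k b] with b on the boundary, undo [T] step by step, pulling x back by the same digits.
    The pair stays linked until y becomes b itself, which is not [strict]. *)
Lemma linked_good x y : linked N x y -> good y.
Proof.
move=> l; split; first by apply: strict_K; exact: linked_strict l.
move=> [k _ [b bb]]; elim: k x y l => [|k IH] x y l /= e.
  by apply: (eboundary_strict bb); rewrite e; exact: linked_strict l.
have db : dirichlet Z (iter k T b).
  case: k {IH e} => [|k]; first exact: eboundary_dirichlet.
  by rewrite iterS; apply: K_dirichlet; exact: cf_map_K.
have [t Zt bE] := cf_map_branchE (iter k T b).
rewrite e in bE.
apply: (IH (iota (vadd x t)) (iota (vadd y t))) => //.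
by apply: linked_branch => //; right; rewrite -bE.
Qed.

Lemma linked_branch_K x y t : linked N x y -> Z t ->
  K (iota (vadd x t)) <-> K (iota (vadd y t)).
Proof.
move=> l Zt; split => h.
  apply: strict_K; apply: (@linked_strict (iota (vadd x t))).
  by apply: linked_branch => //; left; exact: K_dirichlet.
have [gx _] : linked N (iota (vadd x t)) (iota (vadd y t)).
  by apply: linked_branch => //; right; exact: K_dirichlet.
exact: good_K.
Qed.

Lemma good_linked x : good x -> exists2 d, 0 < d & forall y, edist y x < d -> linked N x y.
Proof.
move=> gx; have [r [r0 r1 hr]] := K_bound.
have x1 : enorm x < 1.
  by apply: le_lt_trans r1; apply: hr; exact/strict_dirichlet/good_strict.
have [d d0 hd] := sign_le_local N1 N2 x1.
by exists d => // y yx; split => //; exact: hd.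
Qed.

End Level.

End Dynamics.

(** * Branches *)

(* [|1 + q v|^2], expanded so that no product of vectors is needed. *)
Definition qf (R : realType) (n : nat) (q v : n.-tuple R) : R :=
  1 + 2 * dot q v + dot q q * dot v v.

Section Branches.
Variables (R : realType) (n : nat) (iota : n.-tuple R -> n.-tuple R).
Variables (Z K : set (n.-tuple R)).
Local Notation V := (n.-tuple R).
Hypothesis n_gt0 : (0 < n)%N.
Hypothesis iotaP : is_inversion iota.
Hypothesis Zlat : is_lattice Z.
Hypothesis Kdir : dirichlet_choice Z K.
Hypothesis Zint : integral_lattice Z.
Hypothesis Zunit : unit_generated Z.
Hypothesis Keuclid : norm_euclidean K.
Hypothesis Znice : nicely_invertible iota Z.
Variable N : int.
Hypothesis N1 : 1 <= N.
Hypothesis NS : const_sign Z N.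
Implicit Types (x y z u v w b : V) (a : seq V) (t : R).
Local Notation O := (orth_part iota).
Local Notation T := (cf_map iota Z K).
Local Notation v0 := (vzero R n).
Local Notation linked := (linked iota Z K N).

Let lbK := @linked_branch_K R n iota Z K n_gt0 iotaP Zlat Kdir Zint Zunit Keuclid Znice N N1 NS.

(** An inverse branch of [T^k] with k the length of the word. The head is the digit that [T]
    subtracts last, so one more iterate conses a letter. *)
Fixpoint branch a y := if a is z :: a' then branch a' (iota (vadd y z)) else y.
Fixpoint admissible a y : Prop :=
  if a is z :: a' then
    [/\ Z z, K (iota (vadd y z)) & admissible a' (iota (vadd y z))]
  else True.

Lemma linked_next x y z : linked x y -> Z z -> K (iota (vadd x z)) ->
  linked (iota (vadd x z)) (iota (vadd y z)).
Proof.
move=> l Zz Kx; apply: linked_branch => //; left.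
exact: K_dirichlet Kx.
Qed.

Lemma linked_admissible a x y : linked x y -> admissible a x <-> admissible a y.
Proof.
elim: a x y => [//|z a IH] x y l /=; split.
  move=> [Zz Kx ax]; have l' := linked_next l Zz Kx.
  split => //; last by apply/(IH _ _ l').
  by apply/(lbK l Zz).
move=> [Zz Ky ay].
have Kx : K (iota (vadd x z)) by apply/(lbK l Zz).
by split => //; apply/(IH _ _ (linked_next l Zz Kx)).
Qed.

Lemma iter_branch a y : K y -> admissible a y ->
  iter (size a) T (branch a y) = y /\ K (branch a y).
Proof.
elim: a y => [//|z a IH] y Ky [Zz Kb ab] /=.
by have [-> Kb'] := IH _ Kb ab; rewrite cf_map_branch.
Qed.

Lemma iter_cf_map_K k w : K w -> K (iter k T w).
Proof. by case: k => [//|k] _; exact: cf_map_K. Qed.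

Lemma branch_exists k w : K w -> exists a,
  [/\ size a = k, admissible a (iter k T w) & branch a (iter k T w) = w].
Proof.
move=> Kw; elim: k => [|k [a [ak aa ab]]]; first by exists [::].
have [z Zz e] := cf_map_branchE iotaP Zlat Kdir (iter k T w).
exists (z :: a); split; rewrite /= ?ak// -e//.
by split => //; exact: iter_cf_map_K.
Qed.

Lemma branch_inj a a' y y' : K y -> K y' -> admissible a y -> admissible a' y' ->
  size a = size a' -> branch a y = branch a' y' -> a = a' /\ y = y'.
Proof.
elim: a a' y y' => [|z a IH] [|z' a'] y y' // Ky Ky' [Zz Kb ab] [Zz' Kb' ab'] [sz] e.
have [-> eb] := IH _ _ _ Kb Kb' ab ab' sz e.
have yy' : y = y'.
  by rewrite -(cf_map_branch iotaP Zlat Kdir Ky Zz) eb cf_map_branch.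
split => //; congr (_ :: _).
have : vadd y z = vadd y' z' by rewrite -(iotaK iotaP (vadd y z)) eb iotaK.
by rewrite -yy' !(vaddC y) => /(congr1 (fun v => vsub v y)); rewrite !vaddK.
Qed.

Lemma linked_shift_neq0 x y z : linked x y -> Z z -> vadd y z <> v0.
Proof.
move=> l; apply: strict_shift_neq0 => //.
  exact: linked_strict l.
exact: linked_neq0 l.
Qed.

Lemma linkedK x y : linked x y -> K y.
Proof. by move=> l; apply: (strict_K Zlat Kdir Zint Zunit); exact: linked_strict l. Qed.

(** Each inversion multiplies the distance by the norms of its two image points, both in [K], hence
    by at most [r^2]. *)
Lemma branch_contract r a x y y' : 0 <= r -> (forall w, K w -> enorm w <= r) ->
  linked x y -> linked x y' -> admissible a x ->
  edist (branch a y) (branch a y') <= (r ^+ 2) ^+ size a * edist y y'.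
Proof.
move=> r0 hr; elim: a x y y' => [|z a IH] x y y' l l' /=; first by rewrite expr0 mul1r.
move=> [Zz Kx ax].
have lz := linked_next l Zz Kx; have lz' := linked_next l' Zz Kx.
apply: le_trans (IH _ _ _ lz lz' ax) _.
rewrite [X in _ <= X * _]exprSr -[X in _ <= X]mulrA; apply: ler_wpM2l; first by rewrite !exprn_ge0.
rewrite iota_dist//; [|exact: linked_shift_neq0 l Zz|exact: linked_shift_neq0 l' Zz].
rewrite edistDr -[X in X <= _]mulrA mulrC expr2 ler_wpM2r ?edist_ge0//.
by rewrite ler_pM ?enorm_ge0// hr//; [exact: linkedK lz|exact: linkedK lz'].
Qed.

Definition mob_eval (m : R * V * R) y := m.1.1 * dot y y + 2 * dot m.1.2 y + m.2.
(* [mob_eval (mob a)] is the product of the |w|^2 over the points w inverted along the branch a: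
   the reciprocal of the conformal factor of [branch a] ([mob_evalS]). *)
Fixpoint mob a : R * V * R :=
  if a is z :: a' then
    let: (A, b, c) := mob a' in
    (c, vadd (O b) (vscale c z), c * dot z z + 2 * dot (O b) z + A)
  else (0, v0, 1).

(** Zero discriminant: the quadratic is constant or a multiple of the squared distance to the pole
    of the branch. This is what gives it the shape of [qf] in [branch_ball_normal]. *)
Lemma mob_disc a : [/\ 0 <= (mob a).1.1, 0 <= (mob a).2 &
  dot (mob a).1.2 (mob a).1.2 = (mob a).1.1 * (mob a).2].
Proof.
elim: a => [|z a] /=; first by split=> //; rewrite dot0l mul0r.
case: (mob a) => [[A b] c] /= [A0 c0 d].
have dO : dot (O b) (O b) = A * c by rewrite dot_orth_part.
move: (O b) dO => q dO.
have e : dot (vadd q (vscale c z)) (vadd q (vscale c z)) = c * (c * dot z z + 2 * dot q z + A).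
  by rewrite !dotE (dotC z q) dO; ring.
split => //.
have [cp|] := ltP 0 c; first by rewrite -(pmulr_rge0 _ cp) -e dot_ge0.
move=> c0'; have cz : c = 0 by apply/eqP; rewrite eq_le c0 c0'.
by move: dO; rewrite cz mulr0 => /dot_eq0 ->; rewrite dot0l mul0r mulr0 !add0r.
Qed.

Lemma mob_evalS z a y : vadd y z <> v0 ->
  mob_eval (mob (z :: a)) y = dot (vadd y z) (vadd y z) * mob_eval (mob a) (iota (vadd y z)).
Proof.
move=> yz /=; case: (mob a) => [[A b] c]; rewrite /mob_eval /=.
have yz0 := dot_gt0 yz.
rewrite (iota_sq iotaP) (dotC b) (iota_dotr iotaP).
move: (O b) => q; have -> : forall p s : R, p * (A / p + 2 * (s / p) + c) = A * (p / p) + 2 * s * (p / p) + c * p.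
  by move=> p s; ring.
rewrite divff ?gt_eqF// !dotE (dotC z y) (dotC y q) (dotC z q); ring.
Qed.

(** D is the power of the origin with respect to the sphere. The defining inequalities of the two
    balls differ by the positive factor [|w|^2 D]. *)
Lemma iota_ball u t : 0 < t -> t < enorm u ->
  let D := dot u u - t ^+ 2 in
  iota @` eball u t = eball (vscale D^-1 (O u)) (t / D).
Proof.
move=> t0 tu D.
have D0 : 0 < D by rewrite /D subr_gt0 -enorm_sqr ltr_pXn2r// ?nnegrE ?enorm_ge0// ltW.
have key w : w <> v0 -> eball (vscale D^-1 (O u)) (t / D) (iota w) <-> eball u t w.
  move=> w0; have ww := dot_gt0 w0.
  rewrite /eball /= (edist_lt _ _ (ltW (divr_gt0 t0 D0))) (edist_lt _ _ (ltW t0)).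
  rewrite (iota_sq iotaP) dotZr (iota_dotr iotaP) (orth_partK iotaP).
  rewrite dotZl dotZr (dot_orth_part iotaP).
  rewrite -subr_lt0 -[X in _ <-> is_true X]subr_lt0.
  set L := (X in is_true (X < 0) <-> _); set L' := (X in _ <-> is_true (X < 0)).
  have -> : L = L' / (dot w w * D).
    have -> : L' = D - 2 * dot w u + dot w w by rewrite /L' /D; ring.
    rewrite /L; have -> : dot u u = D + t ^+ 2 by rewrite /D; ring.
    by field; rewrite !lt0r_neq0.
  by rewrite pmulr_llt0// invr_gt0 mulr_gt0.
apply/seteqP; split => [v [w wb <-]|v vb].
  apply/key => // w0; move: wb; rewrite w0 /eball /= edistC edist0 => h.
  by have := lt_trans h tu; rewrite ltxx.
exists (iota v); last exact: iotaK.
apply/key; last by rewrite iotaK.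
apply: iota_neq0 => // v00; move: vb; rewrite v00 /eball /= edistC edist0 enormZ.
rewrite gtr0_norm ?invr_gt0// mulrC ltr_pM2r ?invr_gt0// => h.
have : enorm (O u) = enorm u by rewrite /enorm dot_orth_part.
by move=> e; have := lt_trans h; rewrite e => /(_ _ tu); rewrite ltxx.
Qed.

Lemma branch_ball a x y t : 0 < t -> (forall y', edist y' y < t -> linked x y') ->
  admissible a x ->
  0 < mob_eval (mob a) y - (mob a).1.1 * t ^+ 2 /\
  exists y1, branch a @` eball y t =
    eball y1 (t / (mob_eval (mob a) y - (mob a).1.1 * t ^+ 2)).
Proof.
elim: a x y t => [|z a IH] x y t t0 lk.
  rewrite /= /mob_eval /= dot0l !mul0r mulr0 !add0r subr0 => _; split => //.
  by exists y; rewrite divr1 image_id.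
move=> /= [Zz Kx ax].
have ly : linked x y by apply: lk; rewrite edistxx.
have [r [r0 r1 hr]] := K_bound Zlat Kdir Zint Zunit Keuclid.
set u := vadd y z.
have u0 : u <> v0 := linked_shift_neq0 ly Zz.
(* Otherwise the shifted ball would contain the point of norm 1/2 on the ray through u; its inverse
   has norm 2, yet linkedness places it in [K]. *)
have tu : t < enorm u.
  rewrite ltNge; apply/negP => ut.
  have un := enorm_gt0 u0.
  pose s := (2 * enorm u)^-1.
  have s0 : 0 < s by rewrite invr_gt0 mulr_gt0.
  have u1 : 1 <= enorm u.
    have := hr _ (K_dirichlet Kdir (linkedK (linked_next ly Zz Kx))).
    rewrite iota_norm// => h; rewrite leNgt; apply/negP => h'.
    have : 1 < (enorm u)^-1 by rewrite invf_gt1.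
    lra.
  have lw : linked x (vsub (vscale s u) z).
    apply: lk; rewrite /edist.
    have -> : vsub (vsub (vscale s u) z) y = vscale (- (1 - s)) u.
      by apply: eq_from_tnth => i; rewrite /u !tnthE; ring.
    have s1 : s < 1 by rewrite invf_lt1 ?mulr_gt0//; lra.
    rewrite enormZ normrN gtr0_norm ?subr_gt0//; apply: lt_le_trans ut; nra.
  have := hr _ (K_dirichlet Kdir (linkedK (linked_next lw Zz Kx))).
  rewrite iota_norm// vsubK enormZ gtr0_norm//.
  have -> : s * enorm u = 2^-1 by rewrite /s; field; rewrite lt0r_neq0.
  rewrite invrK; lra.
have D0 : 0 < dot u u - t ^+ 2.
  by rewrite subr_gt0 -enorm_sqr ltr_pXn2r// ?nnegrE ?enorm_ge0// ltW.
have := iota_ball t0 tu; rewrite /=; set D := _ - _; set y1 := vscale _ _ => ib.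
have t10 : 0 < t / D by rewrite divr_gt0.
have shift : eball u t = (fun w => vadd w z) @` eball y t.
  apply/seteqP; split => [w wb|_ [w wb <-]].
    by exists (vsub w z); rewrite ?vsubK// /eball /= -(edistDr _ _ z) vsubK.
  by rewrite /eball /= edistDr.
have lk1 y' : edist y' y1 < t / D -> linked (iota (vadd x z)) y'.
  move=> yy; have : eball y1 (t / D) y' by [].
  rewrite -ib => -[w wb <-]; move: wb; rewrite shift => -[w' wb' <-].
  by apply: linked_next => //; exact: lk.
have [pos [y2 e]] := IH _ _ _ t10 lk1 ax.
have ya := mob_evalS a u0.
(* Radius denominators multiply along a word: D for the first inversion, the inductive one for the
   rest. *)
have main : mob_eval (mob (z :: a)) y - (mob (z :: a)).1.1 * t ^+ 2 =
    D * (mob_eval (mob a) y1 - (mob a).1.1 * (t / D) ^+ 2).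
  have e1 : dot y1 y1 = D^-1 * (D^-1 * dot u u).
    by rewrite /y1 (dotZl D^-1) (dotZr D^-1) dot_orth_part.
  have e2 b : dot b y1 = D^-1 * dot u (O b).
    by rewrite /y1 (dotZr D^-1) -(orth_part_sym iotaP) dotC.
  rewrite ya -/u; move: pos ya e => /=.
  case: (mob a) => [[A b] c]; rewrite /mob_eval /= e1 e2 => _ _ _.
  rewrite (iota_sq iotaP) (dotC b) (iota_dotr iotaP).
  have uu := dot_gt0 u0.
  have -> : t ^+ 2 = dot u u - D by rewrite /D; ring.
  rewrite expr_div_n (_ : t ^+ 2 = dot u u - D); last by rewrite /D; ring.
  move: (dot u (O b)) (dot u u) uu => p q uu.
  by field; rewrite !lt0r_neq0.
have mp : 0 < mob_eval (mob (z :: a)) y - (mob (z :: a)).1.1 * t ^+ 2.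
  by rewrite main mulr_gt0.
split; first exact: mp.
exists y2.
have -> : t / (mob_eval (mob (z :: a)) y - (mob (z :: a)).1.1 * t ^+ 2) =
   (t / D) / (mob_eval (mob a) y1 - (mob a).1.1 * (t / D) ^+ 2).
  by rewrite main invfM mulrA.
by rewrite -e -ib shift !image_comp.
Qed.

Lemma branch_ball_normal a x d : 0 < d -> (forall y, edist y x < d -> linked x y) ->
  admissible a x ->
  exists k q, [/\ 0 < k, enorm q * d <= 1 & forall y t, 0 < t -> edist y x + t <= d ->
    0 < qf q (vsub y x) - dot q q * t ^+ 2 /\
    exists y1, branch a @` eball y t =
      eball y1 (k * (t / (qf q (vsub y x) - dot q q * t ^+ 2)))].
Proof.
move=> d0 lk ax; have [A0 c0 disc] := mob_disc a.
have [p0 _] := branch_ball d0 lk ax.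
have sub y t : 0 < t -> edist y x + t <= d -> forall y', edist y' y < t -> linked x y'.
  move=> t0 yt y' yy; apply: lk; apply: le_lt_trans (edist_tri y _ _) _; lra.
have bb y t (t0 : 0 < t) (yt : edist y x + t <= d) := branch_ball t0 (sub y t t0 yt) ax.
move: bb p0 A0 disc; case: (mob a) => [[A b] c]; rewrite /= => bb p0 A0 disc.
set Q := mob_eval (A, b, c) x in p0.
have Q0 : 0 < Q by apply: lt_le_trans p0 _; rewrite gerBl mulr_ge0// sqr_ge0.
(* Half the gradient of the quadratic at x over its value Q there; with zero discriminant,
   [|q|^2 = A / Q], so the Taylor expansion at x is [Q * qf q]. *)
pose q := vscale Q^-1 (vadd (vscale A x) b).
have qq : dot q q = A / Q.
  have -> : A = A * Q / Q by rewrite mulfK ?gt_eqF.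
  rewrite /q !dotE disc /Q /mob_eval /= (dotC x b); field.
  by rewrite -/(mob_eval (A, b, c) x) lt0r_neq0.
have Qq y : mob_eval (A, b, c) y = Q * qf q (vsub y x).
  rewrite /qf qq /q dotZl; set w := vadd _ _.
  have -> : Q * (1 + 2 * (Q^-1 * dot w (vsub y x)) + A / Q * dot (vsub y x) (vsub y x)) =
    Q + 2 * dot w (vsub y x) + A * dot (vsub y x) (vsub y x).
    by field; rewrite lt0r_neq0.
  rewrite /w /Q /mob_eval /= !dotE (dotC x y); ring.
exists Q^-1, q; split; first by rewrite invr_gt0.
  (* This restates that the radius denominator is positive for the full ball of radius d about x. *)
  have h : (enorm q * d) ^+ 2 <= 1.
    by rewrite exprMn enorm_sqr qq mulrAC ler_pdivrMr// mul1r -subr_ge0 ltW.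
  by rewrite -(@expr_le1 _ 2)// mulr_ge0 ?enorm_ge0 ?ltW.
move=> y t t0 yt; have [pos [y1 e]] := bb y t t0 yt.
have main : mob_eval (A, b, c) y - A * t ^+ 2 = Q * (qf q (vsub y x) - dot q q * t ^+ 2).
  by rewrite Qq qq; field; rewrite lt0r_neq0.
move: pos e; rewrite main => pos e; split; first by move: pos; rewrite pmulr_rgt0.
by exists y1; rewrite e; congr eball; rewrite invfM mulrCA.
Qed.

End Branches.

(** * Power series in several variables *)

Section Words.
Variables (R : realType) (n : nat).
Local Notation V := (n.-tuple R).
Implicit Types (v : V) (w : seq 'I_n) (c p : seq 'I_n -> R).

(* Power series are written as sums over ordered words of variables, with coefficients on
   words; [multi_coef] collects them into coefficients on multi-indices. *)
Fixpoint words k : seq (seq 'I_n) :=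
  if k is k'.+1 then [seq i :: w | i <- enum 'I_n, w <- words k'] else [:: [::]].

Lemma size_words k w : w \in words k -> size w = k.
Proof.
elim: k w => [|k IH] w /=; first by rewrite inE => /eqP ->.
by move=> /allpairsP[[i w'] /= [_ /IH <- ->]].
Qed.

Lemma sum_words k (F : seq 'I_n -> R) :
  \sum_(w <- words k.+1) F w = \sum_(i < n) \sum_(w <- words k) F (i :: w).
Proof. by rewrite /= big_allpairs_dep /= big_enum. Qed.

Definition monom v w := \prod_(i <- w) tnth v i.
Definition hsum c v k := \sum_(w <- words k) c w * monom v w.
Definition hsum_abs c v k := \sum_(w <- words k) `|c w| * `|monom v w|.

Lemma monom_cons v i w : monom v (i :: w) = tnth v i * monom v w.
Proof. by rewrite /monom big_cons. Qed.

Lemma sum_monom v k : \sum_(w <- words k) `|monom v w| = (\sum_(i < n) `|tnth v i|) ^+ k.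
Proof.
elim: k => [|k IH]; first by rewrite /= big_seq1 /monom big_nil normr1 expr0.
rewrite sum_words exprS mulr_suml; apply: eq_bigr => i _.
by rewrite -IH mulr_sumr; apply: eq_bigr => w _; rewrite monom_cons normrM.
Qed.

Lemma hsum_abs_bound c v (M C : R) k : 0 <= M -> 0 <= C ->
  (forall w, `|c w| <= M * C ^+ size w) ->
  hsum_abs c v k <= M * (C * \sum_(i < n) `|tnth v i|) ^+ k.
Proof.
move=> M0 C0 hc; rewrite exprMn mulrA -sum_monom mulr_sumr.
rewrite /hsum_abs big_seq [X in _ <= X]big_seq; apply: ler_sum => w /size_words sw.
by rewrite ler_wpM2r// -sw.
Qed.

Lemma hsum_le_abs c v k : `|hsum c v k| <= hsum_abs c v k.
Proof.
by apply: le_trans (ler_norm_sum _ _ _) _; apply: ler_sum => w _; rewrite normrM.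
Qed.

Definition multi_coef c (a : 'I_n -> nat) : R :=
  \sum_(w <- words (\sum_i a i)%N | [forall i, count_mem i w == a i]) c w.

Lemma sum_count_mem w : (\sum_(i < n) count_mem i w)%N = size w.
Proof.
elim: w => [|j w IH] /=; first by rewrite big1.
rewrite big_split /= IH (bigD1 j)//= eqxx big1 ?addn0//.
by move=> i /negbTE; rewrite eq_sym => ->.
Qed.

Lemma monom_count v w : monom v w = \prod_(i < n) tnth v i ^+ count_mem i w.
Proof.
elim: w => [|j w IH]; first by rewrite /monom big_nil big1.
rewrite monom_cons IH [RHS](bigD1 j)//= [in LHS](bigD1 j)//= mulrA eqxx exprS.
congr (_ * _); apply: eq_bigr => i /negbTE; rewrite eq_sym => ->.
by rewrite add0n.
Qed.

(** A word of length k has exactly one vector of letter counts, so after exchanging the sums a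
    single multi-index survives for each word. *)
Lemma sum_multi_coef (F : seq 'I_n -> R) (G : ('I_n -> nat) -> R) k :
  \sum_(a : {ffun 'I_n -> 'I_k.+1} | (\sum_(i < n) (a i : nat))%N == k)
    (\sum_(w <- words (\sum_i (a i : nat))%N | [forall i, count_mem i w == a i]) F w) * G (fun i => a i)
  = \sum_(w <- words k) F w * G (fun i => count_mem i w).
Proof.
have -> : \sum_(a : {ffun 'I_n -> 'I_k.+1} | (\sum_(i < n) (a i : nat))%N == k)
    (\sum_(w <- words (\sum_i (a i : nat))%N | [forall i, count_mem i w == a i]) F w) * G (fun i => a i)
  = \sum_(a : {ffun 'I_n -> 'I_k.+1} | (\sum_(i < n) (a i : nat))%N == k)
    \sum_(w <- words k | [forall i, count_mem i w == a i]) F w * G (fun i => count_mem i w).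
  apply: eq_bigr => a /eqP ak; rewrite ak mulr_suml; apply: eq_bigr => w /forallP aw.
  by congr (_ * G _); apply/funext => i; rewrite (eqP (aw i)).
rewrite (exchange_big_dep predT)//= big_seq [RHS]big_seq; apply: eq_bigr => w /size_words wk.
pose a0 : {ffun 'I_n -> 'I_k.+1} := [ffun i => inord (count_mem i w)].
have a0E i : (a0 i : nat) = count_mem i w.
  by rewrite ffunE inordK// ltnS -wk count_size.
rewrite (bigD1 a0)/=; last first.
  apply/andP; split; last by apply/forallP => i; rewrite a0E.
  by apply/eqP; rewrite -[RHS]wk -sum_count_mem; apply: eq_bigr => i _; rewrite a0E.
rewrite big1 ?addr0// => a /andP[/andP[_ /forallP aw]] /eqP; case.
by apply/ffunP => i; apply/val_inj; rewrite /= a0E (eqP (aw i)).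
Qed.

Lemma hom_part_multi_coef c v k : hom_part (multi_coef c) v k = hsum c v k.
Proof.
rewrite /hom_part /multi_coef (sum_multi_coef c (fun a => \prod_(i < n) tnth v i ^+ a i)).
by apply: eq_bigr => w _; rewrite monom_count.
Qed.

Lemma hom_part_abs_multi_coef c v k : hom_part_abs (multi_coef c) v k <= hsum_abs c v k.
Proof.
have -> : hsum_abs c v k =
    \sum_(w <- words k) `|c w| * \prod_(i < n) `|tnth v i| ^+ count_mem i w.
  apply: eq_bigr => w _; rewrite monom_count normr_prod; congr (_ * _).
  by apply: eq_bigr => i _; rewrite normrX.
rewrite -(sum_multi_coef (fun w => `|c w|) (fun a => \prod_(i < n) `|tnth v i| ^+ a i)).
apply: ler_sum => a _; rewrite ler_wpM2r ?ler_norm_sum//.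
by apply: prodr_ge0 => i _; rewrite exprn_ge0.
Qed.

Variables (q : V) (D : R).
Hypothesis D_gt0 : 0 < D.
Hypothesis qD : enorm q <= D.

(* The coefficients of p / qf q, solving s = p - 2 <q, v> s - |q|^2 |v|^2 s; the product |v|^2
   is spread over the words that start with a repeated letter. *)
Fixpoint div_qf p w : R :=
  match w with
  | [::] => p [::]
  | i :: w' => p w - 2 * tnth q i * div_qf p w' -
      match w' with
      | [::] => 0
      | j :: w'' => if j == i then dot q q * div_qf p w'' else 0
      end
  end.

(** Coefficients of [qf q] to the power -m: the constant series 1 divided m times. *)
Fixpoint qf_coef m : seq 'I_n -> R :=
  if m is m'.+1 then div_qf (qf_coef m') else fun w => (w == [::])%:R.

(** The rate 8D closes the recursion: at length k the two correction terms are at most 1/2 and 1/4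
    of [M (8D)^k], so the total stays below twice that quantity. *)
Lemma div_qf_bound p (M : R) : 0 <= M -> (forall w, `|p w| <= M * (8 * D) ^+ size w) ->
  forall w, `|div_qf p w| <= 2 * M * (8 * D) ^+ size w.
Proof.
move=> M0 hp; have D8 : 0 <= 8 * D by rewrite mulr_ge0// ltW.
have qi i : `|tnth q i| <= D by apply: le_trans qD; exact: tnth_le_enorm.
have qq : `|dot q q| <= D ^+ 2 by rewrite ger0_norm ?dot_ge0// -enorm_le // ltW.
suff H m w : (size w < m)%N -> `|div_qf p w| <= 2 * M * (8 * D) ^+ size w.
  by move=> w; apply: (H (size w).+1).
elim: m w => [//|m IH] [|i w] /= wm.
  have := hp [::]; rewrite /= expr0 !mulr1 => h; apply: le_trans h _; lra.
have h1 := hp (i :: w); rewrite /= in h1.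
have h2 := IH w wm.
have h3 : `|2 * tnth q i * div_qf p w| <= 2 * D * (2 * M * (8 * D) ^+ size w).
  rewrite normrM normrM normr_nat; apply: ler_pM => //.
  by rewrite ler_wpM2l.
have h4 : `|match w with [::] => 0 | j :: w'' => if j == i then dot q q * div_qf p w'' else 0 end|
    <= D * (2 * M * (8 * D) ^+ size w).
  have P0 : 0 <= D * (2 * M * (8 * D) ^+ size w).
    by do ?[apply: mulr_ge0 | apply: exprn_ge0 | exact: ltW].
  case: w wm h2 P0 {h1 h3} => [|j w] /= wm _ P0; first by rewrite normr0.
  case: eqP => _; last by rewrite normr0.
  have h5 := IH w (ltnW wm).
  rewrite normrM; apply: le_trans (_ : D ^+ 2 * (2 * M * (8 * D) ^+ size w) <= _).
    by apply: ler_pM.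
  have P1 : 0 <= D ^+ 2 * (2 * M * (8 * D) ^+ size w).
    by do ?[apply: mulr_ge0 | apply: exprn_ge0 | exact: ltW].
  rewrite [X in _ <= D * (_ * X)]exprS; move: P1; lra.
apply: le_trans (ler_normB _ _) _; apply: le_trans (lerD (ler_normB _ _) h4) _.
apply: le_trans (lerD (lerD h1 h3) (lexx _)) _.
have P0 : 0 <= D * (M * (8 * D) ^+ size w).
  by do ?[apply: mulr_ge0 | apply: exprn_ge0 | exact: ltW].
rewrite exprS; move: P0; lra.
Qed.

Lemma qf_coef_bound m w : `|qf_coef m w| <= 2 ^+ m * (8 * D) ^+ size w.
Proof.
elim: m w => [|m IH] w /=; last first.
  by rewrite exprS; apply: div_qf_bound => //; exact: exprn_ge0.
case: w => [|i w] /=; first by rewrite normr1 mulr1.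
by rewrite normr0 mul1r exprn_ge0// mulr_ge0 ?ltW.
Qed.

Lemma hsum0 c v : hsum c v 0 = c [::].
Proof. by rewrite /hsum /= big_seq1 /monom big_nil mulr1. Qed.

Lemma hsum1 p v : hsum (div_qf p) v 1 = hsum p v 1 - 2 * dot q v * hsum (div_qf p) v 0.
Proof.
rewrite hsum0 /hsum !sum_words /= /dot mulr_sumr mulr_suml -sumrB.
by apply: eq_bigr => i _; rewrite !big_seq1 monom_cons /monom big_nil /=; ring.
Qed.

(** The division recursion at the level of homogeneous parts. Words starting with a repeated letter
    contribute the squares that add up to [|v|^2]. *)
Lemma hsumSS p v k : hsum (div_qf p) v k.+2 =
  hsum p v k.+2 - 2 * dot q v * hsum (div_qf p) v k.+1
    - dot q q * dot v v * hsum (div_qf p) v k.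
Proof.
have -> : hsum (div_qf p) v k.+2 = hsum p v k.+2
   - \sum_(i < n) 2 * (tnth q i * tnth v i) * hsum (div_qf p) v k.+1
   - \sum_(i < n) dot q q * (tnth v i * tnth v i) * hsum (div_qf p) v k.
  rewrite /hsum [in LHS]sum_words [X in _ = X - _ - _]sum_words -!sumrB.
  apply: eq_bigr => i _.
  rewrite [X in _ = _ - X]mulr_sumr mulr_sumr.
  have -> : \sum_(w <- words k) dot q q * (tnth v i * tnth v i) * (div_qf p w * monom v w) =
    \sum_(w <- words k.+1) match w with
      | [::] => 0
      | j :: w'' => if j == i then dot q q * div_qf p w'' else 0 end * monom v (i :: w).
    rewrite sum_words (bigD1 i)//= [X in _ = _ + X]big1 ?addr0.
      by apply: eq_bigr => w _; rewrite eqxx !monom_cons; ring.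
    by move=> j /negbTE ->; rewrite big1// => w _; rewrite mul0r.
  rewrite -!sumrB; apply: eq_bigr => w _; rewrite monom_cons /=.
  by rewrite !mulrBl; congr (_ - _ - _); ring.
by rewrite -!mulr_suml -!mulr_sumr.
Qed.

End Words.

(** * Geometric tails and limits along ultrafilters *)

Section Limits.
Variable R : realType.

Lemma geometric_tail (u : nat -> R) (M : R) : (forall k, `|u k| <= M * 2^-1 ^+ k) ->
  cvgn (series u) /\ forall K, `|limn (series u) - series u K| <= 2 * M * 2^-1 ^+ K.
Proof.
move=> hu; have M0 : 0 <= M by have := le_trans (normr_ge0 _) (hu 0%N); rewrite expr0 mulr1.
have cu : cvgn (series u).
  apply: normed_cvg; apply: (@series_le_cvg _ _ (geometric M 2^-1)) => //.
  - by move=> k /=.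
  - move=> k; apply: mulr_ge0 => //; apply: exprn_ge0; by rewrite invr_ge0.
  - by apply: is_cvg_geometric_series; rewrite ger0_norm ?invr_ge0// invf_lt1// ltr1n.
split => // K.
(* The bound is kept as a difference of tails, so that the induction telescopes. *)
have tail m : `|series u (K + m)%N - series u K| <= 2 * M * 2^-1 ^+ K - 2 * M * 2^-1 ^+ (K + m).
  elim: m => [|m IH]; first by rewrite addn0 !subrr normr0.
  rewrite addnS seriesSr; set a := series u (K + m)%N.
  have -> : a + u (K + m)%N - series u K = (a - series u K) + u (K + m)%N by ring.
  apply: le_trans (ler_normD _ _) _; apply: le_trans (lerD IH (hu _)) _.
  by rewrite exprS; lra.
rewrite leNgt; apply/negP; rewrite -subr_gt0; set gap := _ - _ => gap0.
have [N0 _ hN] := (@cvgrPdist_lt _ _ _ _ _ (series u) (limn (series u))).1 cu _ gap0.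
have /= h1 := hN (K + N0)%N (leq_addl _ _).
have h2 := tail N0.
have e0 : 0 <= 2 * M * 2^-1 ^+ (K + N0) by rewrite mulr_ge0 ?mulr_ge0 ?exprn_ge0 ?invr_ge0.
have : `|limn (series u) - series u K| <=
   `|limn (series u) - series u (K + N0)%N| + `|series u (K + N0)%N - series u K|.
  by apply: le_trans (ler_normD _ _); rewrite addrA subrK.
by move: h1 h2 e0; rewrite /gap; lra.
Qed.

(** A bounded sequence lives in a compact segment, and a cluster point of an ultrafilter is a
    limit. *)
Lemma ultra_cvg (G : set_system nat) (u : nat -> R) (M : R) : UltraFilter G ->
  (forall k, `|u k| <= M) -> exists l : R, u k @[k --> G] --> l.
Proof.
move=> GU hu; have GP : ProperFilter G := @ultra_proper _ _ GU.
have mem : (u k @[k --> G]) `[- M, M]%classic.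
  rewrite /fmap /=; apply: (@filterE _ G) => k /=; rewrite in_itv /= -ler_norml; exact: hu.
have [l [_ cl]] := segment_compact (fmap_proper_filter u GP) mem.
exists l => B Bl.
have [//|nB] := in_ultra_setVsetC (u @^-1` B) GU.
have nB' : (u k @[k --> G]) (~` B) by [].
by have [y [ny yB]] := cl _ _ nB' Bl.
Qed.

Lemma cvg_sum_seq (T I : Type) (F : set_system T) (FF : Filter F) (s : seq I)
    (f : I -> T -> R) (l : I -> R) :
  (forall i, f i x @[x --> F] --> l i) ->
  \sum_(i <- s) f i x @[x --> F] --> \sum_(i <- s) l i.
Proof.
move=> h; elim: s => [|i s IH].
  rewrite big_nil; under eq_fun do rewrite big_nil; exact: cvg_cst.
rewrite big_cons; under eq_fun do rewrite big_cons; exact: (cvgD (h i) IH).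
Qed.

End Limits.

Section WordSeries.
Variables (R : realType) (n : nat).
Local Notation V := (n.-tuple R).
Implicit Types (v : V) (c : seq 'I_n -> R).

Definition bounded_coef c (M C : R) := forall w, `|c w| <= M * C ^+ size w.
(** With coefficients growing like [C^k], this makes the degree k parts decay like [2^-k], uniformly
    over the family. *)
Definition small_arg v (C : R) := C * \sum_(i < n) `|tnth v i| <= 2^-1.
Definition wsum c v := limn (series (hsum c v)).

Lemma hsum_small c v (M C : R) : 0 <= M -> 0 <= C -> bounded_coef c M C -> small_arg v C ->
  forall k, `|hsum c v k| <= M * 2^-1 ^+ k.
Proof.
move=> M0 C0 bc sv k; apply: le_trans (hsum_le_abs _ _ _) _.
apply: le_trans (hsum_abs_bound v k M0 C0 bc) _; rewrite ler_wpM2l//.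
by rewrite lerXn2r// ?nnegrE ?invr_ge0// mulr_ge0// sumr_ge0.
Qed.

Lemma cvg_wsum c v (M C : R) : 0 <= M -> 0 <= C -> bounded_coef c M C -> small_arg v C ->
  series (hsum c v) @ \oo --> wsum c v.
Proof. by move=> M0 C0 bc sv; have [] := geometric_tail (hsum_small M0 C0 bc sv). Qed.

Lemma cvg_hom_part_abs c v (M C : R) : 0 <= M -> 0 <= C -> bounded_coef c M C -> small_arg v C ->
  cvgn (series (hom_part_abs (multi_coef c) v)).
Proof.
move=> M0 C0 bc sv; apply: (@series_le_cvg _ _ (geometric M 2^-1)).
- move=> k; apply: sumr_ge0 => a _; rewrite mulr_ge0//.
  by apply: prodr_ge0 => i _; rewrite exprn_ge0.
- move=> k; apply: mulr_ge0 => //; apply: exprn_ge0; by rewrite invr_ge0.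
- move=> k; rewrite /geometric /=; apply: le_trans (hom_part_abs_multi_coef _ _ _) _.
  apply: le_trans (hsum_abs_bound v k M0 C0 bc) _; rewrite ler_wpM2l//.
  by rewrite lerXn2r// ?nnegrE ?invr_ge0// mulr_ge0// sumr_ge0.
- by apply: is_cvg_geometric_series; rewrite ger0_norm ?invr_ge0// invf_lt1// ltr1n.
Qed.

(** Each division step gives [qf q v * wsum (m+1) = wsum m] in the limit, and [qf q v] is invertible
    by the lower bound 1/2. *)
Lemma wsum_qf q v (D : R) m : 0 < D -> enorm q <= D -> small_arg v (8 * D) ->
  2^-1 <= qf q v -> wsum (qf_coef q m) v = (qf q v)^-1 ^+ m.
Proof.
move=> D0 qD sv qv; have D8 : 0 <= 8 * D by rewrite mulr_ge0// ltW.
have q0 : qf q v != 0 by rewrite gt_eqF// (lt_le_trans _ qv)// invr_gt0.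
have cv k : series (hsum (qf_coef q k) v) @ \oo --> wsum (qf_coef q k) v.
  apply: (cvg_wsum (M := 2 ^+ k) (C := 8 * D)) => //; exact: qf_coef_bound.
elim: m => [|m IH].
  rewrite expr0; apply: cvg_lim => //; rewrite -cvg_shiftS.
  have -> : [sequence series (hsum (qf_coef q 0) v) k.+1]_k = (fun=> 1 : R).
    apply/funext => k /=; rewrite /series /= big_nat_recl// hsum0 /= big1 ?addr0//.
    move=> j _; rewrite /hsum big_seq big1// => w /size_words.
    by case: w => // i w _; rewrite mul0r.
  exact: cvg_cst.
rewrite exprS -IH; apply: (mulfI q0); rewrite mulrA divff// mul1r.
set S := series (hsum (qf_coef q m.+1) v); set P := series (hsum (qf_coef q m) v).
(* The recursion, summed up to a degree, holds exactly for partial sums once the indices are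
   staggered; all of them have the same limits. *)
have rec K : S K.+2 = P K.+2 - 2 * dot q v * S K.+1 - dot q q * dot v v * S K.
  elim: K => [|K IHK].
    by rewrite /S /P !seriesSr /series /= !big_geq// hsum1 !hsum0 /= !add0r mulr0 subr0 addrA.
  have S1 k : S k.+1 = S k + hsum (qf_coef q m.+1) v k by rewrite /S seriesSr.
  have P1 k : P k.+1 = P k + hsum (qf_coef q m) v k by rewrite /P seriesSr.
  rewrite (S1 K.+2) {1}IHK (P1 K.+2) (@hsumSS R n q) (S1 K.+1) (S1 K) -/(qf_coef q m.+1).
  move: (S K) (P K.+2) (hsum _ _ _) (hsum _ _ _) (hsum _ _ _) => a b c d e; ring.
have c1 := cv m.+1; have c0 := cv m.
have c2 : [sequence S K.+2]_K @ \oo --> wsum (qf_coef q m.+1) v.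
  by rewrite (cvg_shiftS (fun K => S K.+1)) cvg_shiftS.
have c3 : [sequence S K.+2]_K @ \oo -->
   wsum (qf_coef q m) v - 2 * dot q v * wsum (qf_coef q m.+1) v
    - dot q q * dot v v * wsum (qf_coef q m.+1) v.
  have -> : [sequence S K.+2]_K =
      (fun K => P K.+2 - 2 * dot q v * S K.+1 - dot q q * dot v v * S K).
    by apply/funext => K /=; rewrite rec.
  apply: cvgB; last exact: cvgMl_tmp.
  apply: cvgB; last by apply: cvgMl_tmp; rewrite (cvg_shiftS S).
  by rewrite (cvg_shiftS (fun K => P K.+1)) cvg_shiftS.
have := cvg_unique _ c2 c3; rewrite /qf => h.
move: (h (@Rhausdorff R)) => {}h.
have e (A B s t : R) : A = B - s * A - t * A -> (1 + s + t) * A = B by lra.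
exact: e (h _).
Qed.

(** The tails are uniformly small, so only finitely many coefficients have to converge. *)
Lemma ultra_wsum (G : set_system nat) (c_ : nat -> seq 'I_n -> R) c v (M C : R) :
  UltraFilter G -> 0 <= M -> 0 <= C -> (forall k, bounded_coef (c_ k) M C) ->
  bounded_coef c M C -> small_arg v C ->
  (forall w, c_ k w @[k --> G] --> c w) ->
  wsum (c_ k) v @[k --> G] --> wsum c v.
Proof.
move=> GU M0 C0 bk bc sv cw; have GP : ProperFilter G := @ultra_proper _ _ GU.
apply/cvgrPdist_lt => e e0.
have [K hK] : exists K, 2 * M * 2^-1 ^+ K < e / 3.
  have : (geometric (2 * M) 2^-1 : nat -> R) @ \oo --> 0.
    by apply: cvg_geometric; rewrite ger0_norm ?invr_ge0// invf_lt1// ltr1n.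
  move=> /cvgrPdist_lt /(_ (e / 3)) [|K _ /(_ K (leqnn _))]; first by rewrite divr_gt0.
  by rewrite /geometric /= sub0r normrN => h; exists K; apply: le_lt_trans h; exact: ler_norm.
have cS : series (hsum (c_ k) v) K @[k --> G] --> series (hsum c v) K.
  rewrite /series /=; apply: cvg_sum_seq => j; rewrite /hsum.
  by apply: cvg_sum_seq => w; apply: cvgMr_tmp; exact: cw.
have e3 : 0 < e / 3 by rewrite divr_gt0.
near=> k.
have h1 : `|series (hsum c v) K - series (hsum (c_ k) v) K| < e / 3.
  by near: k; exact: (@cvgrPdist_lt _ _ _ _ _ _ _).1 cS _ e3.
have [_ /(_ K) h2] := geometric_tail (hsum_small M0 C0 bc sv).
have [_ /(_ K) h3] := geometric_tail (hsum_small M0 C0 (bk k) sv).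
rewrite -/(wsum c v) in h2; rewrite -/(wsum (c_ k) v) in h3.
have -> : wsum c v - wsum (c_ k) v = (wsum c v - series (hsum c v) K) +
   (series (hsum c v) K - series (hsum (c_ k) v) K) - (wsum (c_ k) v - series (hsum (c_ k) v) K) by ring.
apply: le_lt_trans (ler_normB _ _) _.
apply: le_lt_trans (lerD (ler_normD _ _) (lexx _)) _; lra.
Unshelve. all: by end_near. Qed.

End WordSeries.

(** * Finite kernel sums and their analytic limits *)

Section MeanDensity.
Variables (R : realType) (n : nat).
Local Notation V := (n.-tuple R).
Implicit Types (x y v q : V) (L : seq (R * V)).

Definition weighted_coef L (w : seq 'I_n) : R := \sum_(p <- L) p.1 * qf_coef p.2 n w.
Definition kernel_sum L (v : V) (t : R) : R :=
  \sum_(p <- L) p.1 * (qf p.2 v - dot p.2 p.2 * t ^+ 2)^-1 ^+ n.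

Lemma small_arg_enorm v (D : R) : 0 < D -> small_arg v (8 * D) -> D * enorm v <= 16^-1.
Proof.
move=> D0; rewrite /small_arg => sv.
have := ler_wpM2l (ltW D0) (enorm_le_sum v); lra.
Qed.

Lemma qf_half q v (D : R) : 0 < D -> enorm q <= D -> small_arg v (8 * D) -> 2^-1 <= qf q v.
Proof.
move=> D0 qD sv; have h := small_arg_enorm D0 sv.
have := dot_abs q v; rewrite ler_norml => /andP[h1 _].
have h2 := ler_wpM2r (enorm_ge0 v) qD.
have h3 : 0 <= dot q q * dot v v by rewrite mulr_ge0 ?dot_ge0.
rewrite /qf; lra.
Qed.

Lemma wsum_weighted L v (D : R) : 0 < D -> (forall p, p \in L -> enorm p.2 <= D) ->
  small_arg v (8 * D) -> wsum (weighted_coef L) v = kernel_sum L v 0.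
Proof.
move=> D0 hL sv; apply: cvg_lim => //.
have D8 : 0 <= 8 * D by rewrite mulr_ge0// ltW.
have -> : series (hsum (weighted_coef L) v) =
    (fun K => \sum_(p <- L) p.1 * series (hsum (qf_coef p.2 n) v) K).
  apply/funext => K; rewrite /series /=.
  under [RHS]eq_bigr do rewrite mulr_sumr.
  rewrite exchange_big /=; apply: eq_bigr => k _; rewrite /hsum.
  under [RHS]eq_bigr do rewrite mulr_sumr.
  rewrite exchange_big /=; apply: eq_bigr => w _; rewrite /weighted_coef mulr_suml.
  by apply: eq_bigr => p _; rewrite mulrA.
rewrite /kernel_sum big_seq.
have -> : (fun K => \sum_(p <- L) p.1 * series (hsum (qf_coef p.2 n) v) K) =
   (fun K => \sum_(p <- L) if p \in L then p.1 * series (hsum (qf_coef p.2 n) v) K else 0).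
  by apply/funext => K; rewrite big_seq [RHS]big_seq; apply: eq_bigr => p ->.
rewrite big_mkcond; apply: cvg_sum_seq => p; case: ifP => pL; last exact: cvg_cst.
rewrite expr0n /= mulr0 subr0 -(wsum_qf n D0 (hL p pL) sv (qf_half D0 (hL p pL) sv)).
apply: cvgMl_tmp; apply: (cvg_wsum (M := 2 ^+ n) (C := 8 * D)) => //.
by apply: qf_coef_bound => //; exact: hL.
Qed.

Lemma weighted_coef_bound L (D M : R) : 0 < D -> (forall p, p \in L -> enorm p.2 <= D) ->
  (forall p, p \in L -> 0 <= p.1) -> \sum_(p <- L) p.1 <= M ->
  bounded_coef (weighted_coef L) (M * 2 ^+ n) (8 * D).
Proof.
move=> D0 hL pL LM w; apply: le_trans (ler_norm_sum _ _ _) _.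
have E0 : 0 <= 2 ^+ n * (8 * D) ^+ size w :> R.
  by rewrite mulr_ge0 ?exprn_ge0 ?mulr_ge0// ltW.
rewrite -mulrA; apply: le_trans (ler_wpM2r E0 LM); rewrite mulr_suml.
rewrite big_seq [X in _ <= X]big_seq; apply: ler_sum => p pp.
rewrite normrM ger0_norm ?pL// ler_wpM2l ?pL//.
by apply: qf_coef_bound => //; exact: hL.
Qed.

(** As [qf >= 1/2], subtracting [|q|^2 t^2 <= (D t)^2] costs at most the fraction [2 (D t)^2] of
    each denominator. The factor depends neither on the length of L nor on its weights. *)
Lemma kernel_sum_sandwich L v (D t : R) : 0 < D -> (forall p, p \in L -> enorm p.2 <= D) ->
  (forall p, p \in L -> 0 <= p.1) -> small_arg v (8 * D) -> 0 <= t -> 2 * (D * t) ^+ 2 < 1 ->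
  kernel_sum L v 0 <= kernel_sum L v t <= (1 - 2 * (D * t) ^+ 2)^-1 ^+ n * kernel_sum L v 0.
Proof.
move=> D0 hL pL sv t0 t1.
have term p : p \in L ->
    (qf p.2 v)^-1 <= (qf p.2 v - dot p.2 p.2 * t ^+ 2)^-1 /\
    (qf p.2 v - dot p.2 p.2 * t ^+ 2)^-1 <= (1 - 2 * (D * t) ^+ 2)^-1 * (qf p.2 v)^-1.
  move=> pp; have qh := qf_half D0 (hL p pp) sv.
  have q2 : dot p.2 p.2 <= D ^+ 2 by rewrite -enorm_le ?hL// ltW.
  have q20 := dot_ge0 p.2.
  have t20 := sqr_ge0 t.
  have h1 : dot p.2 p.2 * t ^+ 2 <= (D * t) ^+ 2 by rewrite exprMn ler_wpM2r.
  have h0 : 0 <= dot p.2 p.2 * t ^+ 2 by rewrite mulr_ge0.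
  have s0 : 0 < 1 - 2 * (D * t) ^+ 2 by rewrite subr_gt0.
  have qp : 0 < qf p.2 v by apply: lt_le_trans qh; rewrite invr_gt0.
  have h2 : (1 - 2 * (D * t) ^+ 2) * qf p.2 v <= qf p.2 v - dot p.2 p.2 * t ^+ 2.
    have := ler_wpM2l (sqr_ge0 (D * t)) qh; lra.
  have rp : 0 < qf p.2 v - dot p.2 p.2 * t ^+ 2 by apply: lt_le_trans h2; rewrite mulr_gt0.
  split; first by rewrite lef_pV2 ?posrE// gerBl.
  by rewrite -invfM lef_pV2 ?posrE ?mulr_gt0.
rewrite /kernel_sum expr0n /=; apply/andP; split.
  rewrite big_seq [X in _ <= X]big_seq; apply: ler_sum => p pp.
  have [h _] := term p pp; rewrite mulr0 subr0 ler_wpM2l ?pL// lerXn2r// nnegrE.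
    by rewrite invr_ge0; apply: le_trans (qf_half D0 (hL p pp) sv); rewrite invr_ge0.
  apply: le_trans h; rewrite invr_ge0.
  by apply: le_trans (qf_half D0 (hL p pp) sv); rewrite invr_ge0.
rewrite mulr_sumr big_seq [X in _ <= X]big_seq; apply: ler_sum => p pp.
have [h h'] := term p pp.
have q0 : 0 <= (qf p.2 v)^-1.
  by rewrite invr_ge0; apply: le_trans (qf_half D0 (hL p pp) sv); rewrite invr_ge0.
rewrite mulr0 subr0 [X in _ <= X]mulrCA ler_wpM2l ?pL// -exprMn lerXn2r// nnegrE.
  exact: le_trans h.
by apply: le_trans h'; exact: le_trans h.
Qed.

(** At fixed t the errors tend to 0 along an ultrafilter, leaving [F y t / t^n] between [wsum c v]
    and a factor tending to 1 times it; a squeeze in t finishes. *)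
Lemma mean_density_analytic (F : V -> R -> R) x (D : R) : 0 < D ->
  (forall e : R, 0 < e -> exists L : seq (R * V),
     (forall p, p \in L -> 0 <= p.1 /\ enorm p.2 <= D) /\
     forall y (t : R), 0 < t -> edist y x + t <= D^-1 ->
       `|F y t - t ^+ n * kernel_sum L (vsub y x) t| <= e) ->
  exists c, exists2 M, 0 <= M & bounded_coef c M (8 * D) /\
    forall y, small_arg (vsub y x) (8 * D) ->
      F y (k.+1%:R^-1) / k.+1%:R^-1 ^+ n @[k --> \oo] --> wsum c (vsub y x).
Proof.
move=> D0 app.
have D8 : 0 <= 8 * D by rewrite mulr_ge0// ltW.
have [L hL] : exists L : nat -> seq (R * V), forall k,
     (forall p, p \in L k -> 0 <= p.1 /\ enorm p.2 <= D) /\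
     forall y (t : R), 0 < t -> edist y x + t <= D^-1 ->
       `|F y t - t ^+ n * kernel_sum (L k) (vsub y x) t| <= k.+1%:R^-1.
  have e0 k : 0 < k.+1%:R^-1 :> R by rewrite invr_gt0.
  have [L hL] := choice (fun k => app _ (e0 k)).
  by exists L.
have L0 k p : p \in L k -> 0 <= p.1 by move=> /(hL k).1[].
have LD k p : p \in L k -> enorm p.2 <= D by move=> /(hL k).1[].
(* At the centre x every term of the kernel sum is at least its weight, so comparison with [F x t0]
   bounds the total weight. The summand 1 in M covers the errors [1/(k+1)]. *)
pose t0 := (2 * D)^-1.
have t00 : 0 < t0 by rewrite invr_gt0 mulr_gt0.
pose M := (`|F x t0| + 1) / t0 ^+ n.
have M0 : 0 <= M by apply: divr_ge0; [rewrite addr_ge0|apply: exprn_ge0; exact: ltW].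
have zz : small_arg (vsub x x) (8 * D).
  rewrite /small_arg big1 ?mulr0 ?invr_ge0// => i _; by rewrite !tnthE subrr normr0.
have qf0 q : qf q (vsub x x) = 1 by rewrite /qf vsubxx !dot0r !mulr0 !addr0.
have LM k : \sum_(p <- L k) p.1 <= M.
  rewrite /M ler_pdivlMr ?exprn_gt0//.
  have t0D : 2 * (D * t0) ^+ 2 < 1.
    have -> : D * t0 = 2^-1 by rewrite /t0; field; rewrite lt0r_neq0.
    by rewrite expr2; lra.
  have /andP[s1 _] := kernel_sum_sandwich D0 (@LD k) (@L0 k) zz (ltW t00) t0D.
  have s2 : \sum_(p <- L k) p.1 <= kernel_sum (L k) (vsub x x) t0.
    apply: le_trans s1; rewrite /kernel_sum; apply: ler_sum => p _.
    by rewrite qf0 expr0n /= mulr0 subr0 invr1 expr1n mulr1.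
  have t0le : t0 <= D^-1 by rewrite /t0 lef_pV2 ?posrE ?mulr_gt0//; lra.
  have [_ /(_ x t0 t00)] := hL k; rewrite edistxx add0r => /(_ t0le).
  rewrite ler_norml => /andP[h _].
  have k1 : k.+1%:R^-1 <= 1 :> R by rewrite invf_le1// ler1n.
  have tn : 0 <= t0 ^+ n by rewrite exprn_ge0 ?ltW.
  have fin (S K t a b i : R) : S * t <= K * t -> - i <= a - t * K -> i <= 1 -> a <= b ->
    S * t <= b + 1 by lra.
  exact: fin (ler_wpM2r tn s2) h k1 (ler_norm _).
have Fin : ProperFilter (\oo : set_system nat) by exact: eventually_filter.
(* One ultrafilter gives limits to the coefficients of all words at once. *)
have [G [GU sG]] := ultraFilterLemma Fin.
have GP : ProperFilter G := @ultra_proper _ _ GU.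
have bk k : bounded_coef (weighted_coef (L k)) (M * 2 ^+ n) (8 * D).
  exact: (weighted_coef_bound D0 (@LD k) (@L0 k)).
have lim w : exists l : R, weighted_coef (L k) w @[k --> G] --> l.
  by apply: ultra_cvg => k; exact: bk.
have [c hc] := choice lim.
have M20 : 0 <= M * 2 ^+ n by rewrite mulr_ge0// exprn_ge0.
have bc : bounded_coef c (M * 2 ^+ n) (8 * D).
  move=> w; rewrite ler_norml; apply/andP; split.
    apply: (cvgr_to_ge (hc w)); apply: filterE => k.
    by have := bk k w; rewrite ler_norml => /andP[].
  apply: (cvgr_to_le (hc w)); apply: filterE => k.
  by have := bk k w; rewrite ler_norml => /andP[].
exists c, (M * 2 ^+ n) => //; split => // y sv.
set v := vsub y x in sv *.
have wG : kernel_sum (L k) v 0 @[k --> G] --> wsum c v.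
  have := ultra_wsum GU M20 D8 bk bc sv hc.
  by under eq_fun do rewrite (wsum_weighted D0 (@LD _) sv).
have harmG : harmonic k @[k --> G] --> (0 : R).
  by move=> B B0; apply: sG; exact: (@cvg_harmonic R B B0).
have D_inv : 0 < D^-1 by rewrite invr_gt0.
have yx : edist y x <= (16 * D)^-1.
  rewrite invfM mulrC ler_pdivlMl//; exact: small_arg_enorm.
have bound (t : R) : 0 < t -> t <= (2 * D)^-1 ->
   wsum c v <= F y t / t ^+ n <= (1 - 2 * (D * t) ^+ 2)^-1 ^+ n * wsum c v.
  move=> tp tD.
  have tn : 0 < t ^+ n by rewrite exprn_gt0.
  have tD' : D * t <= 2^-1.
    by have := ler_wpM2l (ltW D0) tD; rewrite invfM mulrCA divff ?mulr1// gt_eqF.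
  have Dt0 : 0 <= D * t by rewrite mulr_ge0 ?ltW.
  have t1 : 2 * (D * t) ^+ 2 < 1 by nra.
  have ytD : edist y x + t <= D^-1.
    apply: le_trans (lerD yx tD) _; rewrite !invfM; lra.
  have sw k := kernel_sum_sandwich D0 (@LD k) (@L0 k) sv (ltW tp) t1.
  have ap k : `|F y t / t ^+ n - kernel_sum (L k) v t| <= harmonic k / t ^+ n.
    have -> : F y t / t ^+ n - kernel_sum (L k) v t = (F y t - t ^+ n * kernel_sum (L k) v t) / t ^+ n.
      by rewrite mulrBl mulrAC divff ?mul1r// gt_eqF.
    rewrite normrM [`|_^-1|]gtr0_norm ?invr_gt0//; apply: ler_wpM2r; first by rewrite invr_ge0 ltW.
    exact: (hL k).2.
  have harm0 : harmonic k / t ^+ n @[k --> G] --> (0 : R).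
    by rewrite -(mul0r (t ^+ n)^-1); apply: cvgMr_tmp.
  apply/andP; split.
    have c1 : kernel_sum (L k) v 0 - harmonic k / t ^+ n @[k --> G] --> wsum c v.
      by rewrite -[wsum c v]subr0; exact: cvgB.
    apply: (cvgr_to_le c1); apply: filterE => k.
    have /andP[a _] := sw k; have := ap k; rewrite ler_norml => /andP[b _]; lra.
  have c1 : (1 - 2 * (D * t) ^+ 2)^-1 ^+ n * kernel_sum (L k) v 0 + harmonic k / t ^+ n
     @[k --> G] --> (1 - 2 * (D * t) ^+ 2)^-1 ^+ n * wsum c v.
    by rewrite -[X in _ --> X]addr0; apply: cvgD => //; exact: cvgMl_tmp.
  apply: (cvgr_to_ge c1); apply: filterE => k.
  have /andP[_ a] := sw k; have := ap k; rewrite ler_norml => /andP[_ b]; lra.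
apply: (@squeeze_cvgr _ _ _ _ (fun=> wsum c v)
   (fun k => (1 - 2 * (D * k.+1%:R^-1) ^+ 2)^-1 ^+ n * wsum c v)).
- have : \forall k \near \oo, (harmonic k : R) < (2 * D)^-1.
    apply: (@cvgr_lt _ _ _ _ _ _ (@cvg_harmonic R)); by rewrite invr_gt0 mulr_gt0.
  by apply: filterS => k /= kD; apply: bound; [rewrite invr_gt0|exact: ltW].
- exact: cvg_cst.
- rewrite -[X in _ --> X]mul1r; apply: cvgMr_tmp.
  have e1 : (1 - 2 * (D * 0) ^+ 2)^-1 ^+ n = 1 :> R.
    by rewrite mulr0 expr0n mulr0 subr0 invr1 expr1n.
  have c2 : D * k.+1%:R^-1 @[k --> \oo] --> D * 0.
    by apply: cvgMl_tmp; exact: cvg_harmonic.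
  have c3 := cvg_comp _ _ c2 (@exprn_continuous R 2 (D * 0)).
  have c4 : (1 - 2 * (D * k.+1%:R^-1) ^+ 2)^-1 @[k --> \oo] --> (1 - 2 * (D * 0) ^+ 2)^-1.
    apply: cvgV; first by rewrite mulr0 expr0n mulr0 subr0 oner_eq0.
    by apply: cvgB; [exact: cvg_cst|exact: cvgMl_tmp].
  by rewrite -[X in _ --> X]e1; exact: (cvg_comp _ _ c4 (@exprn_continuous R n _)).
Qed.

End MeanDensity.

(** * Lebesgue measure on tuples *)

Section BorelSets.
Variables (R : realType) (n : nat).
Local Notation V := (n.-tuple R).

Section measurable_vector_functions.
Context d (T : measurableType d).
Implicit Types f g : T -> V.

Lemma measurable_fun_tnth f i : measurable_fun setT f ->
  measurable_fun setT (fun x => tnth (f x) i).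
Proof. by move=> /measurable_fun_tnthP/(_ i). Qed.

Lemma measurable_fun_dot f g : measurable_fun setT f -> measurable_fun setT g ->
  measurable_fun setT (fun x => dot (f x) (g x)).
Proof.
by move=> mf mg; apply: measurable_sum => i; apply: measurable_funM; exact: measurable_fun_tnth.
Qed.

Lemma measurable_fun_vadd f g : measurable_fun setT f -> measurable_fun setT g ->
  measurable_fun setT (fun x => vadd (f x) (g x)).
Proof.
move=> mf mg; apply/measurable_fun_tnthP => i.
rewrite (_ : _ \o _ = (fun x => tnth (f x) i + tnth (g x) i)); last first.
  by apply/funext => x /=; rewrite tnthE.
by apply: measurable_funD; exact: measurable_fun_tnth.
Qed.

Lemma measurable_fun_vscale (h : T -> R) f : measurable_fun setT h -> measurable_fun setT f ->
  measurable_fun setT (fun x => vscale (h x) (f x)).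
Proof.
move=> mh mf; apply/measurable_fun_tnthP => i.
rewrite (_ : _ \o _ = (fun x => h x * tnth (f x) i)); last first.
  by apply/funext => x /=; rewrite tnthE.
by apply: measurable_funM => //; exact: measurable_fun_tnth.
Qed.

Lemma measurable_fun_vsub f g : measurable_fun setT f -> measurable_fun setT g ->
  measurable_fun setT (fun x => vsub (f x) (g x)).
Proof.
move=> mf mg.
have -> : (fun x => vsub (f x) (g x)) = (fun x => vadd (f x) (vscale (-1) (g x))).
  by apply/funext => x; apply: eq_from_tnth => i; rewrite !tnthE mulN1r.
apply: measurable_fun_vadd; first exact: mf.
by apply: measurable_fun_vscale; [exact: measurable_cst|exact: mg].
Qed.

Lemma measurable_fun_edist f g : measurable_fun setT f -> measurable_fun setT g ->
  measurable_fun setT (fun x => edist (f x) (g x)).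
Proof.
move=> mf mg; apply: (@measurableT_comp _ _ _ _ _ _ (@Num.sqrt R)).
  apply: continuous_measurable_fun; exact: sqrt_continuous.
by apply: measurable_fun_dot; apply: measurable_fun_vsub.
Qed.

End measurable_vector_functions.

Lemma measurable_eball (x : V) r : measurable (eball x r).
Proof.
have m : measurable_fun [set: V] (fun y => edist y x).
  by apply: measurable_fun_edist => //; exact: measurable_id.
have := measurable_fun_ltr m (measurable_cst r).
have mt : measurable [set true] by [].
move=> /(_ measurableT _ mt); rewrite setTI.
by congr (measurable _); apply/seteqP; split => y /=.
Qed.

Lemma measurable_ebox (a b : V) : measurable (ebox a b).
Proof.
rewrite (_ : ebox a b = \bigcap_(i in [set: 'I_n]) ((fun x : V => tnth x i) @^-1` `[tnth a i, tnth b i])).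
  apply: fin_bigcap_measurable => // i _.
  by rewrite -[X in measurable X]setTI; apply: measurable_tnth.
apply/seteqP; split => x /= h; first by move=> i _ /=; rewrite in_itv /=; exact: h.
by move=> i; have := h i I; rewrite /= in_itv.
Qed.

Definition boxes : set (set V) := [set A | exists a b : V, A = ebox a b].

Lemma boxesI : setI_closed boxes.
Proof.
move=> _ _ [a [b ->]] [a' [b' ->]].
exists [tuple Num.max (tnth a i) (tnth a' i) | i < n], [tuple Num.min (tnth b i) (tnth b' i) | i < n].
apply/seteqP; split => x /=.
  move=> [h h'] i; rewrite !tnth_mktuple ge_max le_min.
  by have /andP[-> ->] := h i; have /andP[-> ->] := h' i.
move=> h; split => i; have := h i; rewrite !tnth_mktuple ge_max le_min.
  by move=> /andP[/andP[-> _] /andP[-> _]].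
by move=> /andP[/andP[_ ->] /andP[_ ->]].
Qed.

Definition cube (M : R) : set V := ebox [tuple - M | i < n] [tuple M | i < n].

Lemma cubeP (M : R) x : cube M x <-> forall i, `|tnth x i| <= M.
Proof. by split => h i; have := h i; rewrite !tnth_mktuple ler_norml. Qed.

Lemma bigcup_cube : \bigcup_(k in [set: nat]) cube k%:R = [set: V].
Proof.
apply/seteqP; split => // x _; exists (Num.truncn (\sum_(i < n) `|tnth x i|)).+1 => //.
apply/cubeP => i; have h0 : 0 <= \sum_(i < n) `|tnth x i| by apply: sumr_ge0.
have /andP[_ /ltW] := truncn_itv h0; apply: le_trans.
by rewrite (bigD1 i)//= lerDl sumr_ge0.
Qed.

Lemma measurable_boxes : @measurable _ V = <<s boxes >>.
Proof.
apply/seteqP; split; last first.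
  by apply: smallest_sub; [exact: sigma_algebra_measurable|move=> _ [a [b ->]]; exact: measurable_ebox].
pose T := g_sigma_algebraType boxes.
suff : measurable_fun [set: T] (fun x : T => x : V).
  by move=> m A mA; have := m measurableT A mA; rewrite setTI.
apply/measurable_fun_tnthP => i.
apply: (measurability _ (RGenCInfty.measurableE R)).
move=> _ [_ [a ->] <-].
(* A coordinate half-space is exhausted by boxes whose remaining sides are clipped at k. *)
rewrite (_ : _ `&` _ = \bigcup_(k in [set: nat])
   ebox [tuple if j == i then a else - k%:R | j < n] [tuple k%:R | j < n]).
  by apply: bigcup_measurable => k _; apply: sub_sigma_algebra; eexists; eexists.
apply/seteqP; split => x /=.
  rewrite in_itv /= andbT => -[_ ax].
  have : [set: V] x by []; rewrite -bigcup_cube => -[k _ xk].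
  exists k => // j; have := xk j; rewrite !tnth_mktuple => /andP[h1 ->].
  by case: eqP => [->|_]; rewrite ?ax ?h1.
move=> [k _ /(_ i)]; rewrite !tnth_mktuple eqxx => /andP[h _]; split => //.
by rewrite in_itv /= h.
Qed.

(** The sigma-algebra is the product one, so an open set is exhibited as a countable union of boxes
    with rational corners. *)
Lemma eopen_measurable (A : set V) : eopen A -> measurable A.
Proof.
move=> oA.
pose B (p : n.-tuple rat * n.-tuple rat) : set V :=
  ebox [tuple ratr (tnth p.1 i) | i < n] [tuple ratr (tnth p.2 i) | i < n].
rewrite (_ : A = \bigcup_(p in [set: n.-tuple rat * n.-tuple rat])
    if `[< B p `<=` A >] then B p else set0).
  apply: countable_bigcupT_measurable => // p; case: ifP => _ //.
  exact: measurable_ebox.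
apply/seteqP; split => [x Ax|x [p _]]; last by case: asboolP => // BA; exact: BA.
have [r r0 rA] := oA x Ax.
have e0 : 0 < r / n.+1%:R by rewrite divr_gt0.
have lo i : exists q : rat, ratr q \in `]tnth x i - r / n.+1%:R / 2, tnth x i[.
  by apply: rat_in_itvoo; rewrite ltrBlDr ltrDl divr_gt0.
have hi i : exists q : rat, ratr q \in `]tnth x i, tnth x i + r / n.+1%:R / 2[.
  by apply: rat_in_itvoo; rewrite ltrDl divr_gt0.
have [a ha] := choice lo; have [b hb] := choice hi.
exists ([tuple a i | i < n], [tuple b i | i < n]) => //.
have xB : B ([tuple a i | i < n], [tuple b i | i < n]) x.
  move=> i; rewrite !tnth_mktuple; have := ha i; have := hb i.
  by rewrite !in_itv /= => /andP[/ltW -> _] /andP[_ /ltW ->].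
rewrite asboolT// => y yB; apply: rA; rewrite /eball /= /edist.
apply: le_lt_trans (enorm_le_sum _) _.
have yi i : `|tnth (vsub y x) i| <= r / n.+1%:R.
  rewrite tnthE; have := yB i; rewrite !tnth_mktuple; have := ha i; have := hb i.
  rewrite !in_itv /= ler_norml => /andP[h1 h2] /andP[h3 h4] /andP[h5 h6].
  move: (r / _) (tnth x i) (tnth y i) h1 h2 h3 h4 h5 h6 e0 => e s t h1 h2 h3 h4 h5 h6 e0.
  by apply/andP; split; lra.
apply: (@le_lt_trans _ _ (\sum_(i < n) r / n.+1%:R)); first by apply: ler_sum => i _; exact: yi.
rewrite sumr_const card_ord -[X in X < _]mulr_natr mulrAC ltr_pdivrMr//.
by rewrite ltr_pM2l// ltr_nat.
Qed.

End BorelSets.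

(** * Scaling of Lebesgue measure and volumes of balls *)

Section LebesgueBalls.
Variables (R : realType) (n : nat).
Local Notation V := (n.-tuple R).
Variable lam : {measure set V -> \bar R}.
Hypothesis lamP : is_lebesgue lam.
Implicit Types (a b u x y : V).

Lemma ebox_empty a b i : tnth b i < tnth a i -> ebox a b = set0.
Proof.
move=> ba; apply/seteqP; split => // x /(_ i) /andP[h1 h2].
by have := lt_le_trans ba (le_trans h1 h2); rewrite ltxx.
Qed.

Lemma lebesgue_cube_lty (M : R) : (lam (cube M) < +oo)%E.
Proof.
have [M0|M0] := leP 0 M; last first.
  case: (posnP n) => [n0|n0].
    rewrite /cube lamP ?ltry// => i; by move: (ltn_ord i); rewrite {2}n0.
  rewrite /cube (@ebox_empty _ _ (Ordinal n0)) ?measure0//.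
  by rewrite !tnth_mktuple; lra.
rewrite /cube lamP ?ltry// => i; rewrite !tnth_mktuple; lra.
Qed.

Lemma lebesgue_sigma_finite : sigma_finite setT lam.
Proof.
exists (fun k => cube k%:R); first by rewrite bigcup_cube.
by move=> k; split; [exact: measurable_ebox|exact: lebesgue_cube_lty].
Qed.

(** Only box volumes are given, so the pushforward and the multiple [s^n lam] are compared on boxes,
    an intersection-stable generator exhausted by cubes of finite measure. *)
Lemma lebesgue_affine u (s : R) (A : set V) : 0 < s -> measurable A ->
  lam ((fun w => vscale s^-1 (vsub w u)) @^-1` A) = ((s ^+ n)%:E * lam A)%E.
Proof.
move=> s0 mA; set f := fun w => _.
have mf : measurable_fun setT f.
  apply: measurable_fun_vscale; first exact: measurable_cst.
  by apply: measurable_fun_vsub; [exact: measurable_id|exact: measurable_cst].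
pose m1 : {measure set V -> \bar R} :=
  measure_function_pushforward__canonical__measure_function_Measure lam mf.
pose m2 : {measure set V -> \bar R} := mscale (NngNum (exprn_ge0 n (ltW s0))) lam.
rewrite -[LHS]/(m1 A) -[RHS]/(m2 A).
apply: (measure_unique (@boxes R n) (fun k => cube k%:R)) => //.
- exact: measurable_boxes.
- exact: boxesI.
- by move=> k; eexists; eexists.
- exact: bigcup_cube.
- move=> _ [a [b ->]]; rewrite /m1 /m2 /= /pushforward /mscale /=.
  pose g (w : V) := vadd u (vscale s w).
  have fg : f @^-1` ebox a b = ebox (g a) (g b).
    apply/seteqP; split => x /= h i; have := h i; rewrite /f /g !tnthE.
      by rewrite ler_pdivlMl// ler_pdivrMl// => /andP[h1 h2]; apply/andP; split; lra.
    by move=> /andP[h1 h2]; rewrite ler_pdivlMl// ler_pdivrMl//; apply/andP; split; lra.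
  rewrite fg; have [ab|] := pselect (forall i, tnth a i <= tnth b i).
    rewrite !lamP// => [|i]; last by rewrite /g !tnthE lerD2l ler_pM2l.
    rewrite -EFinM; congr EFin.
    rewrite -[X in _ ^+ X](card_ord n) -prodr_const -big_split /=.
    by apply: eq_bigr => i _; rewrite /g !tnthE; ring.
  move=> /existsNP[i /negP]; rewrite -ltNge => ba.
  rewrite (ebox_empty ba) (@ebox_empty _ _ i) ?measure0 ?mule0//.
  by rewrite /g !tnthE ltrD2l ltr_pM2l.
- move=> k; rewrite /m1 /= /pushforward.
  apply: le_lt_trans (lebesgue_cube_lty (s * k%:R + \sum_(i < n) `|tnth u i|)).
  apply: le_measure; rewrite ?inE.
  + by have := mf measurableT _ (@measurable_ebox R n [tuple - k%:R | i < n] [tuple k%:R | i < n]); rewrite setTI.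
  + exact: measurable_ebox.
  move=> x /cubeP h; apply/cubeP => i; have := h i; rewrite /f !tnthE normrM.
  rewrite gtr0_norm ?invr_gt0// ler_pdivrMl// => hx.
  have -> : tnth x i = (tnth x i - tnth u i) + tnth u i by rewrite subrK.
  apply: le_trans (ler_normD _ _) (lerD hx _).
  by rewrite (bigD1 i)//= lerDl sumr_ge0.
Qed.

Definition ball_volume : R := fine (lam (eball (vzero R n) 1)).

Lemma unit_ball_lty : (lam (eball (vzero R n) 1) < +oo)%E.
Proof.
apply: le_lt_trans (lebesgue_cube_lty 1); apply: le_measure; rewrite ?inE.
- exact: measurable_eball.
- exact: measurable_ebox.
move=> x; rewrite /eball /= edist0 => /ltW h; apply/cubeP => i.
exact: le_trans (tnth_le_enorm _ _) h.
Qed.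

Lemma lebesgue_eball y (t : R) : 0 < t -> lam (eball y t) = (t ^+ n * ball_volume)%:E.
Proof.
move=> t0; rewrite EFinM /ball_volume fineK; last first.
  by rewrite ge0_fin_numE ?unit_ball_lty.
rewrite -(@lebesgue_affine y)//; last exact: measurable_eball.
congr (lam _); apply/seteqP; split => x; rewrite /eball /= edist0 enormZ -/(edist x y).
  by rewrite gtr0_norm ?invr_gt0// ltr_pdivrMl// mulr1.
by rewrite gtr0_norm ?invr_gt0// ltr_pdivrMl// mulr1.
Qed.

Lemma ball_volume_gt0 : 0 < ball_volume.
Proof.
rewrite -lte_fin /ball_volume fineK; last by rewrite ge0_fin_numE ?unit_ball_lty.
pose e : R := n.+1%:R^-1.
have e0 : 0 < e by rewrite invr_gt0.
apply: (@lt_le_trans _ _ (lam (ebox (vzero R n) [tuple e | i < n]))).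
  rewrite lamP; last by move=> i; rewrite tnthE tnth_mktuple ltW.
  by rewrite lte_fin; apply: prodr_gt0 => i _; rewrite tnthE tnth_mktuple subr0.
apply: le_measure; rewrite ?inE; [exact: measurable_ebox|exact: measurable_eball|].
move=> x h; rewrite /eball /= edist0; apply: le_lt_trans (enorm_le_sum _) _.
apply: (@le_lt_trans _ _ (\sum_(i < n) e)).
  by apply: ler_sum => i _; have := h i; rewrite tnthE tnth_mktuple => /andP[h1 h2]; rewrite ger0_norm.
by rewrite sumr_const card_ord -[X in X < _]mulr_natr ltr_pdivrMl// mulr1 ltr_nat.
Qed.

End LebesgueBalls.

(** * Approximation of integrable functions by Lipschitz functions in L^1 *)

Section LipschitzApproximation.
Variables (R : realType) (n : nat).
Local Notation V := (n.-tuple R).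
Variable lam : {measure set V -> \bar R}.
Variable D : set V.
Hypothesis mD : measurable D.
Hypothesis D_fin : (lam D < +oo)%E.
Implicit Types (f g h : V -> R) (x y : V).

Definition bounded_lipschitz g := measurable_fun setT g /\
  exists2 C, 0 <= C & (forall x, `|g x| <= C) /\ forall x y, `|g x - g y| <= C * edist x y.

Definition approximable f := measurable_fun setT f /\
  forall e, 0 < e -> exists2 g, bounded_lipschitz g &
    (\int[lam]_(x in D) `|f x - g x|%:E <= e%:E)%E.

Lemma measurable_absB f g : measurable_fun setT f -> measurable_fun setT g ->
  measurable_fun D (fun x => `|f x - g x|%:E).
Proof.
move=> mf mg; apply: measurable_funTS; apply/measurable_EFinP.
by apply: measurableT_comp => //; exact: measurable_funB.
Qed.

Lemma integral_tri g f h : measurable_fun setT f -> measurable_fun setT g ->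
  measurable_fun setT h ->
  (\int[lam]_(x in D) `|f x - h x|%:E <=
   \int[lam]_(x in D) `|f x - g x|%:E + \int[lam]_(x in D) `|g x - h x|%:E)%E.
Proof.
move=> mf mg mh.
rewrite -ge0_integralD//; [|exact: measurable_absB|exact: measurable_absB].
apply: ge0_le_integral => //; [exact: measurable_absB| |].
  by apply: emeasurable_funD; exact: measurable_absB.
move=> x _; rewrite -EFinD lee_fin.
by apply: le_trans (ler_normD _ _); rewrite addrA subrK.
Qed.

Lemma bounded_lipschitz_cst (r : R) : bounded_lipschitz (cst r).
Proof.
split; first exact: measurable_cst.
exists `|r| => //; split => // x y.
by rewrite subrr normr0 mulr_ge0// edist_ge0.
Qed.

Lemma bounded_lipschitzD f g : bounded_lipschitz f -> bounded_lipschitz g ->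
  bounded_lipschitz (fun x => f x + g x).
Proof.
move=> [mf [C C0 [bf lf]]] [mg [C' C'0 [bg lg]]]; split; first exact: measurable_funD.
exists (C + C'); first exact: addr_ge0.
split => [x|x y]; first by apply: le_trans (ler_normD _ _) (lerD (bf _) (bg _)).
rewrite mulrDl opprD addrACA.
by apply: le_trans (ler_normD _ _) (lerD (lf _ _) (lg _ _)).
Qed.

Lemma bounded_lipschitzZ (r : R) f : bounded_lipschitz f ->
  bounded_lipschitz (fun x => r * f x).
Proof.
move=> [mf [C C0 [bf lf]]]; split.
  by apply: measurable_funM => //; exact: measurable_cst.
exists (`|r| * C); first exact: mulr_ge0.
split => [x|x y]; first by rewrite normrM ler_wpM2l.
by rewrite -mulrBr normrM -mulrA ler_wpM2l.
Qed.

Lemma max0_lip (a b : R) : `|Num.max 0 a - Num.max 0 b| <= `|a - b|.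
Proof.
have h := ler_norm (a - b); have h' := ler_norm (b - a); rewrite (distrC b) in h'.
have h0 := normr_ge0 (a - b).
by rewrite ler_norml; case: (leP 0 a) => ha; case: (leP 0 b) => hb; apply/andP; split; lra.
Qed.

Lemma bounded_lipschitz_max f : bounded_lipschitz f ->
  bounded_lipschitz (fun x => Num.max 0 (f x)).
Proof.
move=> [mf [C C0 [bf lf]]]; split.
  by apply: measurable_maxr => //; exact: measurable_cst.
exists C => //; split => [x|x y]; last exact: le_trans (max0_lip _ _) (lf x y).
by apply: le_trans (bf x); have := max0_lip (f x) 0; rewrite maxxx !subr0.
Qed.

Lemma approximable_lipschitz f : bounded_lipschitz f -> approximable f.
Proof.
move=> lf; split; first by case: lf.
move=> e e0; exists f => //.
rewrite integral0_eq ?lee_fin ?ltW// => x _.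
by rewrite subrr normr0.
Qed.

Lemma approximableD f g : approximable f -> approximable g ->
  approximable (fun x => f x + g x).
Proof.
move=> [mf af] [mg ag]; split; first exact: measurable_funD.
move=> e e0; have e2 : 0 < e / 2 by rewrite divr_gt0.
have [f' lf' ef] := af _ e2; have [g' lg' eg] := ag _ e2.
exists (fun x => f' x + g' x); first exact: bounded_lipschitzD.
have [mf' _] := lf'; have [mg' _] := lg'.
rewrite [e]splitr EFinD; apply: le_trans (leeD ef eg).
rewrite -ge0_integralD//; [|exact: measurable_absB|exact: measurable_absB].
apply: ge0_le_integral => //.
- by apply: measurable_absB; exact: measurable_funD.
- by apply: emeasurable_funD; exact: measurable_absB.
- by move=> x _; rewrite -EFinD lee_fin opprD addrACA ler_normD.
Qed.

Lemma approximableZ (r : R) f : approximable f -> approximable (fun x => r * f x).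
Proof.
move=> [mf af]; split; first by apply: measurable_funM => //; exact: measurable_cst.
move=> e e0; have er : 0 < e / (`|r| + 1) by rewrite divr_gt0// ltr_wpDl.
have [g lg eg] := af _ er; exists (fun x => r * g x); first exact: bounded_lipschitzZ.
have [mg _] := lg.
under eq_integral do rewrite -mulrBr normrM EFinM.
rewrite ge0_integralZl//; last exact: measurable_absB.
apply: le_trans (lee_wpmul2l _ eg) _ => //.
by rewrite -EFinM lee_fin mulrCA ger_pMr// ler_pdivrMr ?mul1r ?lerDl//.
Qed.

Lemma approximable_sum (I : Type) (s : seq I) (F : I -> V -> R) :
  (forall i, approximable (F i)) -> approximable (fun x => \sum_(i <- s) F i x).
Proof.
move=> aF; elim: s => [|i s IH].
  under eq_fun do rewrite big_nil; apply: approximable_lipschitz; exact: bounded_lipschitz_cst.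
under eq_fun do rewrite big_cons; exact: approximableD.
Qed.

(** Closure under dominated limits, used three times: from ramps to boxes, along increasing unions,
    and from simple functions to integrable ones. *)
Lemma approximable_lim (F : nat -> V -> R) f h : (forall k, approximable (F k)) ->
  measurable_fun setT f -> (forall x, D x -> F k x @[k --> \oo] --> f x) ->
  lam.-integrable D (EFin \o h) -> (forall k x, D x -> `|F k x| <= h x) ->
  approximable f.
Proof.
move=> aF mf cF ih Fh; split => // e e0; have e2 : 0 < e / 2 by rewrite divr_gt0.
have mF k : measurable_fun setT (F k) by case: (aF k).
have [|||||_ cv _] := @dominated_convergence _ _ _ lam D mD (fun k => EFin \o F k) (EFin \o f) (EFin \o h).
- by move=> k; apply: measurable_funTS; apply/measurable_EFinP.
- by apply: measurable_funTS; apply/measurable_EFinP.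
- by apply: aeW => x Dx; apply/cvg_EFin; [apply: filterE|exact: cF].
- exact: ih.
- by apply: aeW => x k Dx; rewrite /= lee_fin; exact: Fh.
have : \forall k \near \oo, (\int[lam]_(x in D) `|(F k x)%:E - (f x)%:E| < (e / 2)%:E)%E.
  apply: (cv [set z | (z < (e / 2)%:E)%E]); apply: open_nbhs_nbhs.
  by split; [exact: open_ereal_lt_ereal|rewrite /= lte_fin].
move=> [k _ /(_ k (leqnn k)) /= ik].
have [g lg eg] := (aF k).2 _ e2; exists g => //; have [mg _] := lg.
apply: le_trans (integral_tri mf (mF k) mg) _.
rewrite [e]splitr EFinD; apply: leeD => //.
apply: le_trans (ltW ik); rewrite le_eqVlt; apply/orP; left; apply/eqP.
by apply: eq_integral => x _; rewrite /= distrC.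
Qed.

Lemma integrable_one : lam.-integrable D (EFin \o cst 1).
Proof.
apply/integrableP; split; first exact/measurable_EFinP.
under eq_integral do rewrite /= normr1.
by rewrite integral_cst// mul1e.
Qed.

Lemma indic_le1 (A : set V) x : `|\1_A x| <= (1 : R).
Proof. by rewrite indicE; case: (_ \in _); rewrite ?normr1 ?normr0. Qed.

(** For a nonempty box, the distance to it in the l^1 norm. *)
Definition box_gap (a b : V) x : R :=
  \sum_(i < n) (Num.max 0 (tnth a i - tnth x i) + Num.max 0 (tnth x i - tnth b i)).

Lemma box_gap_ge0 a b x : 0 <= box_gap a b x.
Proof. by apply: sumr_ge0 => i _; rewrite addr_ge0// le_max lexx. Qed.

Lemma box_gap0 a b x : box_gap a b x = 0 <-> ebox a b x.
Proof.
split => [/eqP|h].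
  rewrite psumr_eq0; last by move=> i _; rewrite addr_ge0// le_max lexx.
  move=> /allP h i; have := h i (mem_index_enum _); rewrite /=.
  rewrite paddr_eq0 ?le_max ?lexx// => /andP[/eqP h1 /eqP h2].
  apply/andP; split.
    by rewrite -subr_le0 -h1 le_max lexx orbT.
  by rewrite -subr_le0 -h2 le_max lexx orbT.
apply: big1 => i _; have /andP[h1 h2] := h i.
by rewrite !max_l ?addr0// subr_le0.
Qed.

Lemma box_gap_lip a b x y : `|box_gap a b x - box_gap a b y| <= 2 * n%:R * edist x y.
Proof.
rewrite /box_gap -sumrB; apply: le_trans (ler_norm_sum _ _ _) _.
apply: (@le_trans _ _ (\sum_(i < n) 2 * edist x y)); last first.
  by rewrite sumr_const card_ord -[X in X <= _]mulr_natr mulrAC.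
apply: ler_sum => i _; rewrite opprD addrACA.
have xy : `|tnth x i - tnth y i| <= edist x y.
  by have := tnth_le_enorm (vsub x y) i; rewrite tnthE.
apply: le_trans (ler_normD _ _) _.
apply: le_trans (lerD (max0_lip _ _) (max0_lip _ _)) _.
have -> : tnth a i - tnth x i - (tnth a i - tnth y i) = - (tnth x i - tnth y i) by ring.
have -> : tnth x i - tnth b i - (tnth y i - tnth b i) = tnth x i - tnth y i by ring.
rewrite normrN; lra.
Qed.

Lemma measurable_box_gap a b : measurable_fun setT (box_gap a b).
Proof.
apply: measurable_sum => i; apply: measurable_funD; apply: measurable_maxr;
  do ?exact: measurable_cst; apply: measurable_funB; do ?exact: measurable_cst;
  exact: measurable_tnth.
Qed.

Lemma approximable_box a b : approximable (\1_(ebox a b) : V -> R).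
Proof.
(* Lipschitz ramps that equal 1 on the box and are eventually 0 at each point off it. *)
pose F (k : nat) x : R := Num.max 0 (1 - k%:R * box_gap a b x).
have F01 k x : 0 <= F k x <= 1.
  rewrite /F le_max lexx /= ge_max ler01 /= lerBlDr lerDl mulr_ge0//.
  exact: box_gap_ge0.
apply: (@approximable_lim F _ (cst 1)).
- move=> k; apply: approximable_lipschitz; split.
    apply: measurable_maxr; first exact: measurable_cst.
    apply: measurable_funB; first exact: measurable_cst.
    by apply: measurable_funM; [exact: measurable_cst|exact: measurable_box_gap].
  exists (1 + k%:R * (2 * n%:R)); first by rewrite addr_ge0// mulr_ge0// mulr_ge0.
  split => [x|x y].
    have /andP[h0 h1] := F01 k x; rewrite ger0_norm//.
    by apply: le_trans h1 _; rewrite lerDl mulr_ge0// mulr_ge0.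
  apply: le_trans (max0_lip _ _) _.
  have -> : 1 - k%:R * box_gap a b x - (1 - k%:R * box_gap a b y) =
    - (k%:R * (box_gap a b x - box_gap a b y)) by ring.
  rewrite normrN normrM normr_nat mulrDl mul1r -mulrA.
  by apply: le_trans (ler_wpM2l _ (box_gap_lip _ _ _ _)) _ => //; rewrite lerDr edist_ge0.
- exact: measurable_indic (measurable_ebox _ _).
- move=> x _; rewrite indicE; have [xb|xb] := boolP (x \in _).
    have -> : (fun k => F k x) = (fun=> 1).
      apply/funext => k; move: xb; rewrite inE => /box_gap0 xb.
      by rewrite /F xb mulr0 subr0 max_r.
    exact: cvg_cst.
  have d0 : 0 < box_gap a b x.
    rewrite lt_neqAle box_gap_ge0 andbT eq_sym; apply/eqP => /box_gap0 h.
    by move/negP: xb; apply; rewrite inE.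
  rewrite /=; apply: cvg_near_cst.
  exists (Num.truncn (box_gap a b x)^-1).+1 => // k /= hk.
  apply/eqP; rewrite /F max_l// subr_le0 -ler_pdivrMr// div1r.
  have di : 0 <= (box_gap a b x)^-1 by rewrite invr_ge0 ltW.
  have /andP[_ /ltW h] := truncn_itv di.
  by apply: le_trans h _; rewrite ler_nat.
- exact: integrable_one.
- by move=> k x _ /=; have /andP[h0 h1] := F01 k x; rewrite ger0_norm.
Qed.

(** Sets with approximable indicators form a lambda-system containing the intersection-stable
    generator of boxes. *)
Lemma approximable_indic (E : set V) : measurable E -> approximable (\1_E : V -> R).
Proof.
pose H := [set A : set V | measurable A /\ approximable (\1_A : V -> R)].
suff HS : <<s @boxes R n >> `<=` H by rewrite measurable_boxes => /HS[].
apply: lambda_system_subset => //; first exact: boxesI.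
  split => //.
  - split; first exact: measurableT.
    have -> : \1_setT = cst 1 :> (V -> R) by apply/funext => x; rewrite indicT.
    exact/approximable_lipschitz/bounded_lipschitz_cst.
  - move=> A B BA [mA aA] [mB aB]; split; first exact: measurableD.
    have -> : \1_(A `\` B) = (fun x => \1_A x + (-1) * \1_B x) :> (V -> R).
      apply/funext => x; rewrite mulN1r !indicE in_setD.
      have [xB|xB] := boolP (x \in B); last by rewrite andbT subr0.
      by rewrite andbF (_ : x \in A) ?subrr//; move: xB; rewrite !inE; exact: BA.
    by apply: approximableD => //; exact: approximableZ.
  - move=> F ndF HF; split; first by apply: bigcup_measurable => k _; case: (HF k).
    apply: (@approximable_lim (fun k => \1_(F k)) _ (cst 1)).
    + by move=> k; case: (HF k).
    + by apply: measurable_indic; apply: bigcup_measurable => k _; case: (HF k).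
    + move=> x _; apply: cvg_near_cst; rewrite indicE.
      have [|xF] := boolP (x \in _).
        rewrite inE => -[k _ Fkx]; exists k => // m /= km.
        rewrite indicE mem_set//; have /subsetPset := ndF _ _ km; exact.
      apply: nearW => k /=; rewrite indicE memNset// => Fkx.
      by move/negP: xF; apply; rewrite inE; exists k.
    + exact: integrable_one.
    + by move=> k x _; exact: indic_le1.
move=> _ [a [b ->]]; split; first exact: measurable_ebox.
exact: approximable_box.
Qed.

Import HBNNSimple.

Lemma approximable_integrable f : measurable_fun setT f -> (forall x, 0 <= f x) ->
  lam.-integrable D (EFin \o f) -> approximable f.
Proof.
move=> mf f0 intf.
have mf' : measurable_fun setT (EFin \o f) by exact/measurable_EFinP.
pose F := nnsfun_approx measurableT mf'.
have cF x : F k x @[k --> \oo] --> f x.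
  have := @cvg_nnsfun_approx _ _ _ _ measurableT _ mf' (fun y _ => f0 y) x I.
  by move=> /fine_cvgP[].
apply: (@approximable_lim (fun k => F k) f f) => //.
- move=> k.
  have -> : (F k : V -> R) = (fun x => \sum_(y <- finmap.enum_fset (fset_set (range (F k))))
      y * \1_(F k @^-1` [set y]) x).
    by apply/funext => x; rewrite fimfunE fsbig_finite.
  apply: approximable_sum => y; apply: approximableZ; apply: approximable_indic.
  by rewrite -[X in measurable X]setTI; apply: measurable_funP.
- move=> k x _; rewrite ger0_norm//.
  have nd : nondecreasing_seq (fun k => F k x).
    by move=> a b ab; have /lefP := nd_nnsfun_approx measurableT mf' ab; exact.
  have cv : cvgn (fun k => F k x) by apply/cvg_ex; exists (f x); exact: cF.
  by have := nondecreasing_cvgn_le nd cv k; rewrite (cvg_lim _ (cF x)).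
Qed.

(** Truncation at 0 only brings the approximant closer to f and makes the future branch weights
    nonnegative. *)
Lemma lipschitz_density f (e : R) : measurable_fun setT f -> (forall x, 0 <= f x) ->
  lam.-integrable D (EFin \o f) -> 0 < e ->
  exists g C, [/\ measurable_fun setT g, forall x, 0 <= g x, 0 <= C,
    forall x y, `|g x - g y| <= C * edist x y &
    (\int[lam]_(x in D) `|f x - g x|%:E <= e%:E)%E].
Proof.
move=> mf f0 intf e0; have [_ /(_ e e0)[g lg ge]] := approximable_integrable mf f0 intf.
have [mg [C C0 [_ lC]]] := bounded_lipschitz_max lg.
exists (fun x => Num.max 0 (g x)), C; split => //.
  by move=> x; rewrite le_max lexx.
apply: le_trans ge; apply: ge0_le_integral => //; [exact: measurable_absB| |].
  by apply: measurable_absB => //; case: lg.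
move=> x _; rewrite lee_fin; apply: le_trans (max0_lip _ _).
by rewrite (max_r (f0 x)).
Qed.

End LipschitzApproximation.

(** * Branch sums for the invariant measure *)

Section DisjointComparison.
Local Open Scope ereal_scope.
Context d (T : measurableType d) (R : realType).
Variables mu lam : {measure set T -> \bar R}.
Variables f g : T -> R.
Hypothesis mf : measurable_fun setT f.
Hypothesis mg : measurable_fun setT g.
Hypothesis f0 : forall x, (0 <= f x)%R.
Hypothesis muE : forall A, measurable A -> mu A = \int[lam]_(x in A) (f x)%:E.
Variables (I : eqType) (E : I -> set T) (c : I -> R) (z : R).
Hypothesis z0 : (0 <= z)%R.

(* Bounds the error made on A when f is replaced by a constant within z of g. *)
Definition l1_error (A : set T) := \int[lam]_(x in A) `|f x - g x|%:E + z%:E * lam A.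

Lemma measurable_abs_sub (A : set T) : measurable_fun A (fun x => `|f x - g x|%:E).
Proof.
apply: measurable_funTS; apply/measurable_EFinP.
by apply: measurableT_comp => //; exact: measurable_funB.
Qed.

Lemma l1_errorE (A : set T) (r : R) : measurable A -> (0 <= r)%R ->
  \int[lam]_(x in A) (r + (`|f x - g x| + z))%:E = r%:E * lam A + l1_error A.
Proof.
move=> mA r0; under eq_integral do rewrite !EFinD.
rewrite ge0_integralD//.
- rewrite integral_cst// ge0_integralD//; last exact: measurable_abs_sub.
  by rewrite integral_cst.
- by move=> x _; rewrite -EFinD lee_fin addr_ge0.
- by apply: emeasurable_funD; [exact: measurable_abs_sub|exact: measurable_cst].
Qed.

Lemma l1_error_piece (A : set T) (r : R) : measurable A -> (0 <= r)%R ->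
  (forall x, A x -> (`|g x - r| <= z)%R) ->
  mu A <= r%:E * lam A + l1_error A /\ r%:E * lam A <= mu A + l1_error A.
Proof.
move=> mA r0 gr; have mfA : measurable_fun A (EFin \o f).
  by apply: measurable_funTS; exact/measurable_EFinP.
have mr (s : R) : measurable_fun A (fun x => (s + (`|f x - g x| + z))%:E).
  apply/measurable_EFinP/measurable_funTS; apply: measurable_funD; first exact: measurable_cst.
  apply: measurable_funD; last exact: measurable_cst.
  by apply: measurableT_comp => //; exact: measurable_funB.
have pw x : A x -> (f x <= r + (`|f x - g x| + z))%R /\ (r <= f x + (`|f x - g x| + z))%R.
  move=> /gr; rewrite ler_norml => /andP[h1 h2].
  have := ler_norm (f x - g x); have := ler_norm (g x - f x); rewrite (distrC (g x)).
  by move=> h3 h4; split; lra.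
split.
  rewrite -l1_errorE// muE//; apply: ge0_le_integral => //.
  - by move=> x _; rewrite lee_fin.
  - by move=> x /pw[h _]; rewrite lee_fin.
rewrite muE// -integral_cst// /l1_error.
have -> : \int[lam]_(x in A) (f x)%:E + (\int[lam]_(x in A) `|f x - g x|%:E + z%:E * lam A) =
  \int[lam]_(x in A) (f x + (`|f x - g x| + z))%:E.
  under [RHS]eq_integral do rewrite !EFinD.
  rewrite [RHS]ge0_integralD//.
  - congr (_ + _); rewrite ge0_integralD//; last exact: measurable_abs_sub.
    by rewrite integral_cst.
  - by move=> x _; rewrite lee_fin.
  - by move=> x _; rewrite -EFinD lee_fin addr_ge0.
  - by apply: emeasurable_funD; [exact: measurable_abs_sub|exact: measurable_cst].
apply: ge0_le_integral => //.
- apply/measurable_EFinP/measurable_funTS; apply: measurable_funD => //.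
  apply: measurable_funD; last exact: measurable_cst.
  by apply: measurableT_comp => //; exact: measurable_funB.
- by move=> x /pw[_ h]; rewrite lee_fin.
Qed.

Lemma l1_errorU (A B : set T) : measurable A -> measurable B -> [disjoint A & B] ->
  l1_error (A `|` B) = l1_error A + l1_error B.
Proof.
move=> mA mB AB; rewrite /l1_error ge0_integral_setU//; last exact: measurable_abs_sub.
rewrite measureU//; last exact/disj_set2P.
by rewrite muleDr ?ge0_adde_def ?inE// addeACA.
Qed.

(** [l1_error] is additive over disjoint pieces, so the total error is that of the union and does
    not grow with the number of branches. *)
Lemma disjoint_comparison (W : seq I) : uniq W ->
  (forall a, a \in W -> measurable (E a)) ->
  (forall a, a \in W -> (0 <= c a)%R) ->
  (forall a b, a \in W -> b \in W -> a != b -> E a `&` E b = set0) ->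
  (forall a x, a \in W -> E a x -> (`|g x - c a| <= z)%R) ->
  let U := \big[setU/set0]_(a <- W) E a in
  mu U <= \sum_(a <- W) (c a)%:E * lam (E a) + l1_error U /\
  \sum_(a <- W) (c a)%:E * lam (E a) <= mu U + l1_error U.
Proof.
elim: W => [|a W IH] /= uW mE c0 dE gE.
  by rewrite !big_nil measure0 /l1_error integral_set0 measure0 mule0 !adde0.
have /andP[aW uW'] := uW; rewrite !big_cons.
have aa : a \in a :: W by rewrite inE eqxx.
have sub b : b \in W -> b \in a :: W by rewrite inE => ->; rewrite orbT.
have [h1 h2] := IH uW' (fun b bW => mE b (sub b bW)) (fun b bW => c0 b (sub b bW))
  (fun b b' bW b'W => dE b b' (sub b bW) (sub b' b'W)) (fun b x bW => gE b x (sub b bW)).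
set U := \big[setU/set0]_(b <- W) E b in h1 h2 *.
have mU : measurable U by rewrite /U big_seq; apply: bigsetU_measurable => b bW; exact: mE (sub b bW).
have aU : [disjoint E a & U].
  apply/disj_set2P; rewrite /U big_seq big_distrr /=; apply: big1 => b bW.
  by apply: dE => //; [exact: sub|apply: contraNneq aW => ->].
have mEa := mE a aa.
have [p1 p2] := l1_error_piece mEa (c0 a aa) (fun x => gE a x aa).
rewrite l1_errorU// measureU//; last exact/disj_set2P.
split; first by rewrite addeACA; exact: leeD.
by rewrite addeACA; exact: leeD.
Qed.

End DisjointComparison.

Section AllWords.
Variable T : eqType.
Implicit Types (s a : seq T) (k : nat).

Fixpoint all_words s k : seq (seq T) :=
  if k is k'.+1 then [seq z :: a | z <- s, a <- all_words s k'] else [:: [::]].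

Lemma mem_all_words s k a : (a \in all_words s k) = (size a == k) && all (mem s) a.
Proof.
elim: k a => [|k IH] [|z a] //=; first by apply/negbTE/negP => /allpairsP[[z a] [_ _]].
apply/allpairsP/idP => [[[z' a'] /= [zs]]|/andP[sz /andP[zs aa]]].
  by rewrite IH => /andP[sa aa] [-> ->]; rewrite eqSS sa zs.
by exists (z, a); rewrite /= IH; split => //; rewrite -eqSS sz aa.
Qed.

Lemma all_words_uniq s k : uniq s -> uniq (all_words s k).
Proof.
move=> us; elim: k => [//|k IH] /=.
by apply: allpairs_uniq us IH _ => -[z a] [z' a'] _ _ /= [-> ->].
Qed.

End AllWords.

Lemma measurable_invr (R : realType) : measurable_fun [set: R] (@GRing.inv R).
Proof.
rewrite -(setUv [set (0 : R)]); apply/measurable_funU; [exact: measurable_set1| |split].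
- by apply: measurableC; exact: measurable_set1.
- exact: measurable_fun_set1.
apply: open_continuous_measurable_fun.
  by apply: closed_openC; apply: accessible_closed_set1; exact/hausdorff_accessible/Rhausdorff.
by move=> r; rewrite inE /= => /eqP r0; exact: inv_continuous.
Qed.

(** * Measurability of the continued fraction map and its iterated invariance *)

Section InvariantMeasure.
Variables (R : realType) (n : nat) (iota : n.-tuple R -> n.-tuple R).
Variables (Z K : set (n.-tuple R)).
Local Notation V := (n.-tuple R).
Hypothesis n_gt0 : (0 < n)%N.
Hypothesis iotaP : is_inversion iota.
Hypothesis Zlat : is_lattice Z.
Hypothesis Kdir : dirichlet_choice Z K.
Hypothesis mK : measurable K.
Hypothesis Zint : integral_lattice Z.
Hypothesis Zunit : unit_generated Z.
Hypothesis Keuclid : norm_euclidean K.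
Hypothesis Znice : nicely_invertible iota Z.
Hypothesis rem : remote3 Z K \/ remote7 Z K.
Local Notation T := (cf_map iota Z K).
Local Notation v0 := (vzero R n).
Local Notation O := (orth_part iota).
Implicit Types (x y z u v w : V) (t : R).

(** An inversion is given by metric properties only; [iota_dotr] makes its coordinates explicit
    rational functions. *)
Lemma measurable_iota : measurable_fun setT iota.
Proof.
pose e (i : 'I_n) : V := [tuple (j == i)%:R | j < n].
have de x i : dot x (e i) = tnth x i.
  rewrite /dot (bigD1 i)//= tnth_mktuple eqxx mulr1 big1 ?addr0// => j /negbTE ji.
  by rewrite tnth_mktuple ji mulr0.
have -> : iota = (fun x => vscale (dot x x)^-1 [tuple dot x (O (e i)) | i < n]).
  apply/funext => x; apply: eq_from_tnth => i.
  by rewrite tnthE tnth_mktuple -de (iota_dotr iotaP) mulrC.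
apply: measurable_fun_vscale.
  apply: (measurableT_comp (@measurable_invr R)).
  by apply: measurable_fun_dot; exact: measurable_id.
apply/measurable_fun_tnthP => i.
have -> : (fun x : V => tnth x i) \o (fun x => [tuple dot x (O (e i)) | i < n]) = (fun x => dot x (O (e i))).
  by apply/funext => x /=; rewrite tnth_mktuple.
by apply: measurable_fun_dot; [exact: measurable_id|exact: measurable_cst].
Qed.

Lemma measurable_neq0 : measurable [set x : V | x <> v0].
Proof.
apply: eopen_measurable => x x0; exists (enorm x); first exact: enorm_gt0.
move=> y yx y0; move: yx; rewrite y0 /eball /= edistC edist0; by rewrite ltxx.
Qed.

Definition lattice_ball (M : nat) : seq V :=
  let s := projT1 (cid (lattice_ball_seq Zlat Zint M%:R)) in
  undup [seq z <- s | `[< Z z >] && (enorm z <= M%:R)].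

Lemma mem_lattice_ball M z : z \in lattice_ball M <-> Z z /\ enorm z <= M%:R.
Proof.
rewrite /lattice_ball; case: cid => s hs /=; rewrite mem_undup mem_filter.
split => [/andP[/andP[/asboolP Zz zM] _]//|[Zz zM]].
by rewrite zM asboolT//= hs.
Qed.

Lemma lattice_in_ball z : exists M : nat, enorm z <= M%:R.
Proof.
exists (Num.truncn (enorm z)).+1.
by have /andP[_ /ltW] := truncn_itv (enorm_ge0 z).
Qed.

(** The preimage is split by the digit subtracted, over a lattice exhausted by finite balls; the
    origin is treated apart because [T] is defined separately there. *)
Lemma measurable_cf_preimage (A : set V) : measurable A -> measurable (T @^-1` A).
Proof.
move=> mA.
pose B z := [set x | x <> v0] `&` ((fun x => vsub (iota x) z) @^-1` (A `&` K)).
have mB z : measurable (B z).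
  apply: measurableI; first exact: measurable_neq0.
  have m : measurable_fun setT (fun x => vsub (iota x) z).
    by apply: measurable_fun_vsub; [exact: measurable_iota|exact: measurable_cst].
  by have := m measurableT _ (measurableI _ _ mA mK); rewrite setTI.
have -> : T @^-1` A = (if `[< A v0 >] then ~` [set x | x <> v0] else set0) `|`
   \bigcup_(M in [set: nat]) \bigcup_(z in [set` lattice_ball M]) B z.
  apply/seteqP; split => x /=.
    have [x0|x0] := pselect (x = v0).
      rewrite x0 /cf_map eqxx => Av; left; rewrite asboolT//=.
    rewrite /cf_map; case: eqP => // _ Ax; right.
    have [Zf Kf] := lfloorP Kdir (iota x).
    have [M hM] := lattice_in_ball (lfloor Z K (iota x)).
    exists M => //; exists (lfloor Z K (iota x)); first exact/mem_lattice_ball.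
    by split.
  move=> [|[M _ [z /mem_lattice_ball[Zz _] [/= x0 [Ax Kx]]]]].
    case: asboolP => // Av /= /contrapT ->; by rewrite /cf_map eqxx.
  by rewrite /cf_map; case: eqP => // _; rewrite (lfloor_uniq Kdir Zz Kx).
apply: measurableU.
  by case: ifP => _ //; apply: measurableC; exact: measurable_neq0.
apply: bigcup_measurable => M _; apply: fin_bigcup_measurable => //.
Qed.

Variable mu : probability V R.
Hypothesis mu_inv : forall A, measurable A -> mu (T @^-1` A) = mu A.

Lemma mu_iter k A : measurable A ->
  measurable (iter k T @^-1` A) /\ mu (iter k T @^-1` A) = mu A.
Proof.
elim: k A => [//|k IH] A mA.
have [m e] := IH _ (measurable_cf_preimage mA).
by split; [exact: m|rewrite -(mu_inv mA) -e].
Qed.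

End InvariantMeasure.

(** * Masses of balls as sums over inverse branches *)

Section BranchSums.
Variables (R : realType) (n : nat) (iota : n.-tuple R -> n.-tuple R).
Variables (Z K : set (n.-tuple R)).
Local Notation V := (n.-tuple R).
Hypothesis n_gt0 : (0 < n)%N.
Hypothesis iotaP : is_inversion iota.
Hypothesis Zlat : is_lattice Z.
Hypothesis Kdir : dirichlet_choice Z K.
Hypothesis mK : measurable K.
Hypothesis Zint : integral_lattice Z.
Hypothesis Zunit : unit_generated Z.
Hypothesis Keuclid : norm_euclidean K.
Hypothesis Znice : nicely_invertible iota Z.
Hypothesis rem : remote3 Z K \/ remote7 Z K.
Local Notation T := (cf_map iota Z K).
Local Notation v0 := (vzero R n).
Local Notation h := (branch iota).
Local Notation adm := (admissible iota Z K).
Implicit Types (x y z u v w : V) (t : R) (a : seq V).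

(** Everything that the measure theory uses about a good point: walls do not appear beyond this
    interface. *)
Definition branch_control x (d r : R) :=
  [/\ 0 < d, 0 <= r, r < 1,
  forall y, edist y x < d -> good iota Z K y /\ (forall a, adm a x <-> adm a y) &
  forall a, adm a x ->
    (forall y, edist y x < d -> edist (h a y) (h a x) <= (r ^+ 2) ^+ size a * d) /\
    exists k q, [/\ 0 < k, enorm q <= d^-1 & forall y t, 0 < t -> edist y x + t <= d ->
      0 < qf q (vsub y x) - dot q q * t ^+ 2 /\
      exists y1, h a @` eball y t = eball y1 (k * (t / (qf q (vsub y x) - dot q q * t ^+ 2)))]].

Lemma good_branch_control x : good iota Z K x -> exists d r, branch_control x d r.
Proof.
move=> gx; have [N [N1 N2 NS]] := remote_const_sign n_gt0 Zlat Kdir Zint Zunit Keuclid rem.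
have [d d0 hd] := good_linked n_gt0 Zlat Kdir Zint Zunit Keuclid N1 N2 gx.
have [r [r0 r1 hr]] := K_bound Zlat Kdir Zint Zunit Keuclid.
exists d, r; split => // [y yx|a aa].
  split; first exact: (linked_good n_gt0 iotaP Zlat Kdir Zint Zunit Keuclid Znice N1 NS (hd y yx)).
  move=> a.
  exact: (linked_admissible n_gt0 iotaP Zlat Kdir Zint Zunit Keuclid Znice N1 NS a (hd y yx)).
split => [y yx|].
  have xx : edist x x < d by rewrite edistxx.
  have hK w : K w -> enorm w <= r by move=> Kw; apply: hr; exact: K_dirichlet Kw.
  apply: le_trans (branch_contract n_gt0 iotaP Zlat Kdir Zint Zunit Keuclid Znice N1 NS r0 hK
    (hd y yx) (hd x xx) aa) _.
  by rewrite ler_wpM2l ?exprn_ge0// ltW.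
have [k [q [k0 qd hq]]] := branch_ball_normal n_gt0 iotaP Zlat Kdir Zint Zunit Keuclid Znice N1 NS
  d0 hd aa.
exists k, q; split => //.
by rewrite -[d^-1]mul1r ler_pdivlMr.
Qed.

(** Bounding the digits by M leaves a finite list; words with larger digits are later absorbed as a
    small mass. *)
Definition branch_words (M k : nat) x : seq (seq V) :=
  [seq a <- all_words (lattice_ball Zlat Zint M) k | `[< adm a x >]].

Lemma branch_words_uniq M k x : uniq (branch_words M k x).
Proof. by apply: filter_uniq; apply: all_words_uniq; exact: undup_uniq. Qed.

Lemma mem_branch_words M k x a : a \in branch_words M k x <->
  [/\ adm a x, size a = k & forall z, z \in a -> Z z /\ enorm z <= M%:R].
Proof.
rewrite mem_filter mem_all_words; split.
  move=> /andP[/asboolP aa /andP[/eqP sa /allP al]]; split => // z za.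
  by apply/(mem_lattice_ball Zlat Zint M z); exact: al.
move=> [aa sa al]; rewrite asboolT//= sa eqxx /=; apply/allP => z za.
by apply/(mem_lattice_ball Zlat Zint M z); exact: al.
Qed.

Lemma admissible_lattice a x z : adm a x -> z \in a -> Z z.
Proof.
elim: a x => [//|z' a IH] x /= [Zz' _ aa]; rewrite inE => /orP[/eqP->//|].
exact: IH aa.
Qed.

Lemma word_bound a : exists M : nat, forall z, z \in a -> enorm z <= M%:R.
Proof.
elim: a => [|z a [M hM]]; first by exists 0%N.
have [M' hM'] := lattice_in_ball z; exists (maxn M M') => w.
rewrite inE => /orP[/eqP->|/hM wM].
  by apply: le_trans hM' _; rewrite ler_nat leq_maxr.
by apply: le_trans wM _; rewrite ler_nat leq_maxl.
Qed.

Definition branch_union (M k : nat) x (B : set V) : set V :=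
  \bigcup_(a in [set` branch_words M k x]) (h a @` B).

Section AroundGoodPoint.
Variables (x : V) (d r : R).
Hypothesis ctl : branch_control x d r.

Let gd y : edist y x < d -> good iota Z K y.
Proof. by case: ctl => _ _ _ c _ /c[]. Qed.

Let ad a y : edist y x < d -> adm a x <-> adm a y.
Proof. by case: ctl => _ _ _ c _ /c[_]. Qed.

Definition preimage_in_K k (B : set V) : set V := (iter k T @^-1` B) `&` K.

Lemma preimage_in_KP k (B : set V) w : B `<=` eball x d ->
  preimage_in_K k B w <-> exists a y, [/\ adm a x, size a = k, B y & w = h a y].
Proof.
move=> Bd; split.
  move=> [/= Bw Kw].
  have [a [sa aa ae]] := branch_exists iotaP Zlat Kdir k Kw.
  by exists a, (iter k T w); split => //; apply/(ad a (Bd _ Bw)).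
move=> [a [y [aa sa By ->]]]; have yd := Bd _ By.
have [e Kh] := iter_branch iotaP Zlat Kdir (good_K (gd yd)) ((ad a yd).1 aa).
by split => //=; rewrite -sa e.
Qed.

Lemma branch_unionP M k (B : set V) w : B `<=` eball x d ->
  branch_union M k x B w <-> exists a y, [/\ a \in branch_words M k x, B y & w = h a y].
Proof.
move=> Bd; split => [[a aW [y By <-]]|[a [y [aW By ->]]]]; first by exists a, y.
by exists a => //; exists y.
Qed.

Lemma branch_union_sub M k (B : set V) : B `<=` eball x d ->
  branch_union M k x B `<=` preimage_in_K k B.
Proof.
move=> Bd w /(branch_unionP _ _ _ Bd)[a [y [/mem_branch_words[aa sa _] By ->]]].
by apply/(preimage_in_KP _ _ Bd); exists a, y.
Qed.

Lemma branch_union_cover k (B : set V) : B `<=` eball x d ->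
  \bigcup_(M in [set: nat]) branch_union M k x B = preimage_in_K k B.
Proof.
move=> Bd; apply/seteqP; split => [w [M _]|w]; first exact: branch_union_sub.
move=> /(preimage_in_KP _ _ Bd)[a [y [aa sa By ->]]].
have [M hM] := word_bound a; exists M => //; apply/(branch_unionP _ _ _ Bd); exists a, y.
split => //; apply/mem_branch_words; split => // z za.
by split; [exact: admissible_lattice aa za|exact: hM].
Qed.

Lemma branch_union_mono k (B : set V) M M' : (M <= M')%N ->
  branch_union M k x B `<=` branch_union M' k x B.
Proof.
move=> MM' w [a /mem_branch_words[aa sa al] hw]; exists a => //.
apply/mem_branch_words; split => // z za; have [Zz zM] := al z za.
by split => //; apply: le_trans zM _; rewrite ler_nat.
Qed.

Lemma branch_eq a a' y y' : adm a x -> adm a' x -> size a = size a' ->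
  edist y x < d -> edist y' x < d -> h a y = h a' y' -> a = a' /\ y = y'.
Proof.
move=> aa aa' ss yd yd'; apply: (branch_inj iotaP Zlat Kdir) => //.
- exact: good_K (gd yd).
- exact: good_K (gd yd').
- exact: (ad a yd).1.
- exact: (ad a' yd').1.
Qed.

(* The words neglected for the large ball bound those neglected for every smaller one, which
   makes the choice of M in [ball_mass_kernel] independent of y and t. *)
Lemma branch_tail M k (B B' : set V) : B `<=` B' -> B' `<=` eball x d ->
  preimage_in_K k B `\` branch_union M k x B `<=`
  preimage_in_K k B' `\` branch_union M k x B'.
Proof.
move=> BB Bd; have Bd' := subset_trans BB Bd.
move=> w [/(preimage_in_KP _ _ Bd')[a [y [aa sa By ->]]] nw]; split.
  by apply/(preimage_in_KP _ _ Bd); exists a, y; split => //; exact: BB.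
move=> /(branch_unionP _ _ _ Bd)[a' [y' [aW' By' e]]]; apply: nw.
have [aa' sa' _] := (mem_branch_words _ _ _ _).1 aW'.
have [ea ey] := branch_eq aa aa' (etrans sa (esym sa')) (Bd' _ By) (Bd _ By') e.
by apply/(branch_unionP _ _ _ Bd'); exists a', y; split; rewrite -?ea// ea.
Qed.

Lemma branch_disjoint M k (B : set V) a a' : B `<=` eball x d ->
  a \in branch_words M k x -> a' \in branch_words M k x -> a != a' ->
  (h a @` B) `&` (h a' @` B) = set0.
Proof.
move=> Bd /mem_branch_words[aa sa _] /mem_branch_words[aa' sa' _] /eqP ne.
apply/seteqP; split => // w [[y By <-] [y' By' e]]; apply: ne.
by have [] := branch_eq aa aa' (etrans sa (esym sa')) (Bd _ By) (Bd _ By') (esym e).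
Qed.

Lemma sub_eball y t : edist y x + t <= d -> eball y t `<=` eball x d.
Proof.
move=> yt w; rewrite /eball /= => wy; apply: le_lt_trans (edist_tri y _ _) _; lra.
Qed.

Lemma measurable_branch_eball a y t : adm a x -> 0 < t -> edist y x + t <= d ->
  measurable (h a @` eball y t).
Proof.
move=> aa t0 yt; case: ctl => _ _ _ _ /(_ a aa)[_ [k [q [_ _ hq]]]].
by have [_ [y1 ->]] := hq y t t0 yt; exact: measurable_eball.
Qed.

Lemma measurable_branch_union M k y t : 0 < t -> edist y x + t <= d ->
  measurable (branch_union M k x (eball y t)).
Proof.
move=> t0 yt; apply: fin_bigcup_measurable; first exact: finite_seq.
move=> a /mem_branch_words[aa _ _]; exact: measurable_branch_eball.
Qed.

End AroundGoodPoint.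

Section Density.
Variable lam : {measure set V -> \bar R}.
Hypothesis lamP : is_lebesgue lam.
Variable mu : probability V R.
Hypothesis mu_inv : forall A, measurable A -> mu (T @^-1` A) = mu A.
Hypothesis mu_K : mu (~` K) = 0%E.
Variable f : V -> R.
Hypothesis mf : measurable_fun setT f.
Hypothesis f_ge0 : forall x, 0 <= f x.
Hypothesis intf : lam.-integrable (@cube R n 1) (EFin \o f).
Hypothesis muE : forall A, measurable A -> mu A = (\int[lam]_(x in A) (f x)%:E)%E.

Lemma K_cube : K `<=` @cube R n 1.
Proof.
move=> y Ky; have [r [r0 r1 hr]] := K_bound Zlat Kdir Zint Zunit Keuclid.
apply/cubeP => i; apply: le_trans (tnth_le_enorm y i) _.
by apply: le_trans (ltW r1); apply: hr; exact: K_dirichlet Ky.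
Qed.

Lemma mu_preimage_in_K k (B : set V) : measurable B ->
  measurable (preimage_in_K k B) /\ mu (preimage_in_K k B) = mu B.
Proof.
move=> mB; have [m e] := mu_iter iotaP Zlat Kdir mK Zint mu_inv k mB.
have mI : measurable (preimage_in_K k B) by exact: measurableI.
split => //; rewrite -e.
have -> : iter k T @^-1` B = preimage_in_K k B `|` (iter k T @^-1` B) `&` ~` K.
  by rewrite /preimage_in_K -setIUr setUv setIT.
have mC : measurable (~` K) by exact: measurableC.
have N0 : mu ((iter k T @^-1` B) `&` ~` K) = 0%E.
  apply/eqP; rewrite eq_le measure_ge0 andbT -mu_K; apply: le_measure; rewrite ?inE//.
  exact: measurableI.
rewrite measureU//; [by rewrite -[LHS]adde0 -N0|exact: measurableI|].
by rewrite /preimage_in_K setIACA setICr setI0.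
Qed.

(** By invariance the ball has the mass of its k-fold preimage in [K], a disjoint union of image
    balls, on each of which the density is replaced by a constant. The choices of g, k and M are
    made on the large ball, before y and t. *)
Lemma ball_mass_kernel x : good iota Z K x -> exists2 D, 0 < D &
  (forall y, edist y x < D^-1 -> good iota Z K y) /\
  forall e : R, 0 < e -> exists L : seq (R * V),
    (forall p, p \in L -> 0 <= p.1 /\ enorm p.2 <= D) /\
    forall y (t : R), 0 < t -> edist y x + t <= D^-1 ->
      `|fine (mu (eball y t)) / ball_volume lam - t ^+ n * kernel_sum L (vsub y x) t| <= e.
Proof.
move=> gx; have [d [r ctl]] := good_branch_control gx.
have [d0 r0 r1 gd ad] := ctl.
exists d^-1; first by rewrite invr_gt0.
rewrite invrK; split => [y /gd[]//|e e0].
have c0 := ball_volume_gt0 lamP.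
set c := ball_volume lam in c0 *.
(* One share each for replacing f by g, for the oscillation of g on image balls, and for the words
   with large digits. *)
pose e1 := e * c / 3.
have e10 : 0 < e1 by rewrite divr_gt0// mulr_gt0.
have mD : measurable (@cube R n 1) by exact: measurable_ebox.
have [g [C [mg g0 C0 lg eg]]] := lipschitz_density mD (lebesgue_cube_lty lamP 1) mf f_ge0 intf e10.
pose l := fine (lam (@cube R n 1)).
have l0 : 0 <= l by apply: fine_ge0.
have lE : lam (@cube R n 1) = l%:E by rewrite fineK// ge0_fin_numE ?lebesgue_cube_lty.
(* After k contractions each image ball is so small that g is nearly constant on it, even when
   integrated over the whole cube. *)
have [k hk] : exists k, C * ((r ^+ 2) ^+ k * d) * l <= e1.
  have r2 : `|r ^+ 2| < 1 by rewrite ger0_norm ?sqr_ge0// expr_lt1.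
  have := @cvg_geometric R (C * d * l) (r ^+ 2) r2.
  move=> /cvgrPdist_le /(_ _ e10) [k _ /(_ k (leqnn k))].
  rewrite /geometric /= sub0r normrN => hk; exists k; apply: le_trans hk.
  by apply: le_trans (ler_norm _); rewrite le_eqVlt; apply/orP; left; apply/eqP; ring.
pose z := C * ((r ^+ 2) ^+ k * d).
have z0 : 0 <= z by rewrite mulr_ge0// mulr_ge0 ?exprn_ge0// ltW.
have Bd : eball x d `<=` eball x d by [].
have xd : edist x x + d <= d by rewrite edistxx add0r.
have mB0 : measurable (eball x d) by exact: measurable_eball.
have [mP0 eP0] := mu_preimage_in_K k mB0.
(* Continuity of [mu] from below along growing digit bounds. *)
have [M hM] : exists M, (mu (preimage_in_K k (eball x d) `\` branch_union M k x (eball x d)) <= e1%:E)%E.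
  have mU M : measurable (branch_union M k x (eball x d)) := measurable_branch_union ctl M k d0 xd.
  have cv : mu (branch_union M k x (eball x d)) @[M --> \oo] --> mu (preimage_in_K k (eball x d)).
    rewrite -(branch_union_cover ctl k Bd); apply: nondecreasing_cvg_mu => //.
      by apply: bigcup_measurable => M _.
    by move=> M M' MM'; apply/subsetPset; exact: branch_union_mono.
  have fin A : measurable A -> mu A \is a fin_num by move=> mA; exact: fin_num_measure.
  have lt : (mu (preimage_in_K k (eball x d)) - e1%:E < mu (preimage_in_K k (eball x d)))%E.
    by rewrite lteBlDr// lteDl// ?lte_fin// fin.
  have [M _ /(_ M (leqnn M)) /= hM] :
      \forall M \near \oo, (mu (preimage_in_K k (eball x d)) - e1%:E < mu (branch_union M k x (eball x d)))%E.
    apply: (cv [set w | (_ < w)%E]); apply: open_nbhs_nbhs; split => //.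
    exact: open_ereal_gt_ereal.
  exists M; rewrite measureD//; last by rewrite ltey_eq fin.
  rewrite (setIidr (branch_union_sub ctl Bd)).
  rewrite leeBlDr ?fin// addeC -leeBlDr//; exact: ltW.
set W := branch_words M k x.
have [kq hkq] : exists kq : seq V -> R * V, forall a, adm a x ->
   [/\ 0 < (kq a).1, enorm (kq a).2 <= d^-1 & forall y t, 0 < t -> edist y x + t <= d ->
      0 < qf (kq a).2 (vsub y x) - dot (kq a).2 (kq a).2 * t ^+ 2 /\
      exists y1, h a @` eball y t =
        eball y1 ((kq a).1 * (t / (qf (kq a).2 (vsub y x) - dot (kq a).2 (kq a).2 * t ^+ 2)))].
  have ex a : exists p : R * V, adm a x ->
   [/\ 0 < p.1, enorm p.2 <= d^-1 & forall y t, 0 < t -> edist y x + t <= d ->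
      0 < qf p.2 (vsub y x) - dot p.2 p.2 * t ^+ 2 /\
      exists y1, h a @` eball y t =
        eball y1 (p.1 * (t / (qf p.2 (vsub y x) - dot p.2 p.2 * t ^+ 2)))].
    have [aa|na] := pselect (adm a x); last by exists (0, v0).
    by have [_ [s [q hsq]]] := ad a aa; exists (s, q).
  by have [kq hkq] := choice ex; exists kq.
(* The image ball has radius [k t / (qf - |q|^2 t^2)]; the n-th power of k joins the value of g in
   the weight. *)
pose L := [seq (g (h a x) * (kq a).1 ^+ n, (kq a).2) | a <- W].
have Wadm a : a \in W -> adm a x by move=> /mem_branch_words[].
exists L; split.
  move=> p /mapP[a aW ->] /=; have [k0 qd _] := hkq a (Wadm a aW).
  by split => //; rewrite mulr_ge0// exprn_ge0// ltW.
move=> y t t0 yt.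
have By := sub_eball yt.
have mB : measurable (eball y t) by exact: measurable_eball.
have [mP eP] := mu_preimage_in_K k mB.
pose E a := h a @` eball y t.
pose U := \big[setU/set0]_(a <- W) E a.
have UE : U = branch_union M k x (eball y t) by rewrite /U -bigcup_seq.
have mU : measurable U by rewrite UE; exact: (measurable_branch_union ctl).
have UP : U `<=` preimage_in_K k (eball y t) by rewrite UE; exact: (branch_union_sub ctl).
have UD : U `<=` @cube R n 1 by move=> w /UP[_ Kw]; exact: K_cube.
have lamE a : a \in W -> lam (E a) =
    (((kq a).1 * (t / (qf (kq a).2 (vsub y x) - dot (kq a).2 (kq a).2 * t ^+ 2))) ^+ n * c)%:E.
  move=> aW; have [k0 _ /(_ y t t0 yt)[pos [y1 e']]] := hkq a (Wadm a aW).
  by rewrite /E e' lebesgue_eball// mulr_gt0// divr_gt0.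
have gE a w : a \in W -> E a w -> `|g w - g (h a x)| <= z.
  move=> aW [y' yB <-]; have aa := Wadm a aW.
  have [con _] := ad a aa; apply: le_trans (lg _ _) _.
  rewrite /z ler_wpM2l//; have [_ <- _] := (mem_branch_words _ _ _ _).1 aW.
  by apply: con; exact: By.
have [c1 c2] := disjoint_comparison mf mg f_ge0 muE (E := E) (c := fun a => g (h a x)) z0
  (branch_words_uniq M k x)
  (fun a aW => measurable_branch_eball ctl (Wadm a aW) t0 yt) (fun a _ => g0 (h a x))
  (fun a b aW bW => branch_disjoint ctl By aW bW) gE.
rewrite -/U -/W in c1 c2.
have err : (l1_error lam f g z U <= (e1 + e1)%:E)%E.
  rewrite EFinD /l1_error; apply: leeD.
    apply: le_trans eg; apply: ge0_subset_integral => //.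
    apply/measurable_EFinP/measurable_funTS.
    by apply: measurableT_comp => //; exact: measurable_funB.
  apply: (@le_trans _ _ (z%:E * lam (@cube R n 1))%E).
    by apply: lee_wpmul2l; [rewrite lee_fin|apply: le_measure; rewrite ?inE].
  by rewrite lE -EFinM lee_fin.
pose S := \sum_(a <- W) g (h a x) *
  (((kq a).1 * (t / (qf (kq a).2 (vsub y x) - dot (kq a).2 (kq a).2 * t ^+ 2))) ^+ n * c).
have SE : (\sum_(a <- W) (g (h a x))%:E * lam (E a) = S%:E)%E.
  rewrite /S -sumEFin big_seq [RHS]big_seq; apply: eq_bigr => a aW.
  by rewrite lamE// EFinM.
have SK : S = c * (t ^+ n * kernel_sum L (vsub y x) t).
  rewrite /S /kernel_sum /L big_map mulr_sumr mulr_sumr; apply: eq_bigr => a _ /=.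
  by rewrite !exprMn; ring.
pose m := fine (mu (eball y t)).
have mE : mu (eball y t) = m%:E by rewrite fineK// fin_num_measure.
have muU : (mu U <= mu (eball y t))%E by rewrite -eP; apply: le_measure; rewrite ?inE.
have muB : (mu (eball y t) <= mu U + e1%:E)%E.
  rewrite -eP -(setDUK UP) measureU//; [|exact: measurableD|exact: setDIK].
  apply: leeD => //; apply: le_trans hM; rewrite UE; apply: le_measure; rewrite ?inE.
  - by apply: measurableD => //; rewrite -UE.
  - by apply: measurableD => //; exact: (measurable_branch_union ctl).
  - exact: (branch_tail ctl).
have up : m <= S + (e1 + e1 + e1).
  rewrite -lee_fin -mE; apply: le_trans muB _.
  rewrite addrA EFinD; apply: leeD => //; apply: le_trans c1 _.
  by rewrite SE EFinD; apply: leeD.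
have lo : S <= m + (e1 + e1).
  rewrite -lee_fin -SE; apply: le_trans c2 _.
  by rewrite EFinD -mE; apply: leeD.
have -> : m / c - t ^+ n * kernel_sum L (vsub y x) t = (m - S) / c.
  by rewrite SK; field; rewrite lt0r_neq0.
rewrite normrM [`|c^-1|]gtr0_norm ?invr_gt0// ler_pdivrMr//.
have ee : e * c = e1 + e1 + e1 by rewrite /e1; field.
by rewrite ee ler_norml; apply/andP; split; lra.
Qed.

End Density.

End BranchSums.

(** * Ball averages *)

Section SigmaFiniteAlias.
Context d (T : measurableType d) (R : realType).
(* The theorem is about a plain measure; the alias gives it the sigma-finite structure needed
   for Radon-Nikodym and Tonelli, while staying convertible to it. *)
Definition sigma_finite_alias (lam : {measure set T -> \bar R}) of sigma_finite setT lam :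
  set T -> \bar R := lam.
Variables (lam : {measure set T -> \bar R}) (lam_sf : sigma_finite setT lam).
HB.instance Definition _ := isMeasure.Build d T R (sigma_finite_alias lam_sf)
  (measure0 lam) (@measure_ge0 _ _ _ lam) (@measure_semi_sigma_additive _ _ _ lam).
HB.instance Definition _ := Measure_isSigmaFinite.Build d T R (sigma_finite_alias lam_sf) lam_sf.
End SigmaFiniteAlias.

Section BallAverages.
Variables (R : realType) (n : nat).
Local Notation V := (n.-tuple R).
Variable lam : {sigma_finite_measure set V -> \bar R}.
Hypothesis lamP : is_lebesgue lam.
Variable mu : probability V R.
Variable f : V -> R.
Hypothesis mf : measurable_fun setT f.
Hypothesis f_ge0 : forall x, 0 <= f x.
Hypothesis intf : lam.-integrable setT (EFin \o f).
Hypothesis muE : forall A, measurable A -> mu A = (\int[lam]_(x in A) (f x)%:E)%E.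
Implicit Types (x y z : V) (t : R).

Definition mass_ratio y t := fine (mu (eball y t)) / ball_volume lam / t ^+ n.

Definition near_pairs t : set (V * V) := [set p | edist p.2 p.1 < t].

Lemma measurable_near_pairs t : measurable (near_pairs t).
Proof.
have m : measurable_fun [set: V * V] (fun p => edist p.2 p.1).
  by apply: measurable_fun_edist; [exact: measurable_snd|exact: measurable_fst].
have := measurable_fun_ltr m (measurable_cst t).
have mt : measurable [set true] by [].
move=> /(_ measurableT _ mt); rewrite setTI.
by congr (measurable _); apply/seteqP; split => y /=.
Qed.

Lemma measurable_mass_ratio t : measurable_fun setT (fun y => mass_ratio y t).
Proof.
have m := measurable_fun_xsection mu (measurable_near_pairs t).
apply: measurable_funM; last exact: measurable_cst.
apply: measurable_funM; last exact: measurable_cst.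
rewrite (_ : (fun y => _) = fine \o (mu \o xsection (near_pairs t))).
  by apply: measurableT_comp m; exact: fine_measurable.
by apply/funext => y /=; rewrite xsectionE.
Qed.

Variables (K : set V).
Hypothesis mK : measurable K.
Hypothesis K_cube1 : K `<=` @cube R n 1.
Local Notation D := (@cube R n 2).

Let mD : measurable D. Proof. exact: measurable_ebox. Qed.
Let intfD : lam.-integrable D (EFin \o f).
Proof. exact: integrableS intf. Qed.

Lemma eball_cube2 y t : K y -> t <= 1 -> eball y t `<=` D.
Proof.
move=> /K_cube1 /cubeP Ky t1 z zy; apply/cubeP => i.
have h : `|tnth z i - tnth y i| <= t.
  apply: le_trans (ltW zy); by have := tnth_le_enorm (vsub z y) i; rewrite tnthE.
have -> : tnth z i = (tnth z i - tnth y i) + tnth y i by rewrite subrK.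
by apply: le_trans (ler_normD _ _) _; have := Ky i; lra.
Qed.

Section Approximant.
Variables (g : V -> R) (C e : R).
Hypothesis mg : measurable_fun setT g.
Hypothesis g_ge0 : forall x, 0 <= g x.
Hypothesis C_ge0 : 0 <= C.
Hypothesis g_lip : forall x y, `|g x - g y| <= C * edist x y.
Hypothesis fg : (\int[lam]_(x in D) `|f x - g x|%:E <= e%:E)%E.

Let c := ball_volume lam.
Let c_gt0 : 0 < c. Proof. exact: ball_volume_gt0. Qed.

Let mfg (A : set V) : measurable_fun A (fun x => `|f x - g x|%:E).
Proof. exact: measurable_abs_sub. Qed.

Lemma mass_ratio_bound y t : K y -> 0 < t -> t <= 1 ->
  (`|mass_ratio y t - f y|%:E <= (`|f y - g y| + C * t)%:E +
    ((t ^+ n * c)^-1)%:E * \int[lam]_(z in eball y t) `|f z - g z|%:E)%E.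
Proof.
move=> Ky t0 t1; set J := (X in (_ <= _ + _ * X)%E).
have J0 : (0 <= J)%E by apply: integral_ge0 => z _; rewrite lee_fin.
have Je : (J <= e%:E)%E.
  apply: le_trans fg; apply: ge0_subset_integral => //; [exact: measurable_eball|].
  exact: eball_cube2.
have JE : J = (fine J)%:E by rewrite fineK// ge0_fin_numE// (le_lt_trans Je)// ltry.
have gb x : eball y t x -> `|g x - g y| <= C * t.
  by move=> xy; apply: le_trans (g_lip _ _) _; rewrite ler_wpM2l// ltW.
have Ct0 : 0 <= C * t by rewrite mulr_ge0// ltW.
have [h1 h2] := l1_error_piece mf mg f_ge0 muE Ct0 (measurable_eball y t) (g_ge0 y) gb.
have muy : mu (eball y t) = (fine (mu (eball y t)))%:E.
  by rewrite fineK// fin_num_measure//; exact: measurable_eball.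
have b0 : 0 < t ^+ n * c by rewrite mulr_gt0// exprn_gt0.
rewrite /mass_ratio -/c; set m := fine (mu _) in muy *.
have {}h1 : (m%:E <= (g y)%:E * (t ^+ n * c)%:E + (J + (C * t)%:E * (t ^+ n * c)%:E))%E.
  by rewrite -(lebesgue_eball lamP y t0) -muy; exact: h1.
have {}h2 : ((g y)%:E * (t ^+ n * c)%:E <= m%:E + (J + (C * t)%:E * (t ^+ n * c)%:E))%E.
  by rewrite -(lebesgue_eball lamP y t0) -muy; exact: h2.
move: h1 h2; rewrite JE -!EFinM -!EFinD !lee_fin.
move: (fine J) m {muy} => j m h1 h2.
have -> : m / c / t ^+ n - f y = (m - g y * (t ^+ n * c)) / (t ^+ n * c) - (f y - g y).
  by field; rewrite !gt_eqF// exprn_gt0.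
have main : `|(m - g y * (t ^+ n * c)) / (t ^+ n * c)| <= C * t + (t ^+ n * c)^-1 * j.
  rewrite normrM [`|_^-1|]gtr0_norm ?invr_gt0// ler_pdivrMr//.
  have -> : (C * t + (t ^+ n * c)^-1 * j) * (t ^+ n * c) = C * t * (t ^+ n * c) + j.
    by move: (t ^+ n * c) b0 => b b0; field; rewrite gt_eqF.
  by move: h1 h2; move: (t ^+ n * c) => b h1 h2; rewrite ler_norml; apply/andP; split; lra.
by apply: le_trans (ler_normB _ _) _; move: main; move: (`|_ / _|) ((_)^-1 * j) => p q; lra.
Qed.

(** After exchanging the integrals, each z is counted for the centres y within t of it, a set of
    volume [t^n c]. This cancels the normalisation of the averages. *)
Lemma tonelli_bound t : 0 < t -> t <= 1 ->
  (\int[lam]_(y in K) \int[lam]_(z in eball y t) `|f z - g z|%:E <= (t ^+ n * c * e)%:E)%E.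
Proof.
move=> t0 t1.
pose psi z : R := \1_D z * `|f z - g z|.
have psi0 z : 0 <= psi z by rewrite mulr_ge0.
have mpsi : measurable_fun setT psi.
  apply: measurable_funM; first exact: measurable_indic.
  by apply: measurableT_comp => //; exact: measurable_funB.
pose phi (p : V * V) : \bar R := (\1_(near_pairs t) p * psi p.2)%:E.
have mphi : measurable_fun setT phi.
  apply/measurable_EFinP; apply: measurable_funM.
    exact: measurable_indic (measurable_near_pairs t).
  by apply: measurableT_comp mpsi _; exact: measurable_snd.
have phi0 p : (0 <= phi p)%E by rewrite lee_fin mulr_ge0.
have inner y : K y -> (\int[lam]_(z in eball y t) `|f z - g z|%:E = \int[lam]_z phi (y, z))%E.
  move=> Ky; rewrite integral_mkcond; apply: eq_integral => z _.
  rewrite patchE /phi /psi /= !indicE.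
  have [zy|zy] := boolP (z \in eball y t).
    rewrite (_ : (y, z) \in near_pairs t); last by move: zy; rewrite !inE.
    by rewrite (_ : z \in D) ?mul1r//; move: zy; rewrite !inE; exact: eball_cube2.
  by rewrite (_ : ((y, z) \in near_pairs t) = false) ?mul0r//; apply/negbTE; move: zy; rewrite !notin_setE.
have -> : (\int[lam]_(y in K) \int[lam]_(z in eball y t) `|f z - g z|%:E =
    \int[lam]_(y in K) \int[lam]_z phi (y, z))%E.
  by apply: eq_integral => y; rewrite inE; exact: inner.
have mF := measurable_fun_fubini_tonelli_F (m2 := lam) _ mphi phi0.
apply: (@le_trans _ _ (\int[lam]_y \int[lam]_z phi (y, z))%E).
  by apply: ge0_subset_integral => // y _; apply: integral_ge0.
rewrite fubini_tonelli//.
have -> : (\int[lam]_z \int[lam]_y phi (y, z) = \int[lam]_z ((t ^+ n * c)%:E * (psi z)%:E))%E.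
  apply: eq_integral => z _; rewrite -(lebesgue_eball lamP z t0) muleC.
  rewrite -[in RHS](setIT (eball z t)) -integral_indic//; last exact: measurable_eball.
  rewrite -ge0_integralZl//; last by rewrite lee_fin.
    apply: eq_integral => y _; rewrite /phi /= -EFinM mulrC; congr (_ * _)%:E.
    by rewrite !indicE; congr ((nat_of_bool _)%:R); apply/idP/idP; rewrite !inE /near_pairs /eball /= edistC.
  by apply/measurable_EFinP; exact: measurable_indic (measurable_eball z t).
rewrite ge0_integralZl//; [|exact/measurable_EFinP|by move=> z _; rewrite lee_fin|].
  rewrite [X in (_ <= X)%E]EFinM; apply: lee_wpmul2l.
    by rewrite lee_fin mulr_ge0// ?exprn_ge0 ?ltW.
  apply: le_trans fg; rewrite [X in (_ <= X)%E]integral_mkcond le_eqVlt; apply/orP; left; apply/eqP.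
  apply: eq_integral => z _; rewrite patchE /psi indicE.
  by case: (z \in D); rewrite ?mul1r ?mul0r.
by rewrite lee_fin mulr_ge0// ?exprn_ge0 ?ltW.
Qed.

(** One e comes from [f - g] at the centre, the other from its ball averages, and the middle term
    from the variation of g over a ball. *)
Lemma mass_ratio_integral_bound t : 0 < t -> t <= 1 ->
  (\int[lam]_(y in K) `|mass_ratio y t - f y|%:E <=
    (e + C * t * fine (lam D) + e)%:E)%E.
Proof.
move=> t0 t1.
have b0 : 0 < t ^+ n * c by rewrite mulr_gt0// exprn_gt0.
have KD : K `<=` D by move=> y Ky; apply: (eball_cube2 Ky t1); exact: eball_center.
have mJ : measurable_fun K (fun y => \int[lam]_(z in eball y t) `|f z - g z|%:E)%E.
  have mind : measurable_fun setT (fun p : V * V => (\1_(near_pairs t) p * `|f p.2 - g p.2|)%:E).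
    apply/measurable_EFinP; apply: measurable_funM.
      exact: measurable_indic (measurable_near_pairs t).
    apply: (@measurableT_comp _ _ _ _ _ _ (fun z => `|f z - g z|)); last exact: measurable_snd.
    by apply: measurableT_comp => //; exact: measurable_funB.
  have := measurable_fun_fubini_tonelli_F (m2 := lam) _ mind _.
  rewrite (_ : fubini_F _ _ = (fun y => \int[lam]_(z in eball y t) `|f z - g z|%:E)%E).
    by move=> h; apply: measurable_funTS; apply: h => p; rewrite lee_fin mulr_ge0.
  apply/funext => y; rewrite /fubini_F [RHS]integral_mkcond; apply: eq_integral => z _.
  rewrite patchE /= indicE.
  have [zy|zy] := boolP (z \in eball y t).
    by rewrite (_ : (y, z) \in near_pairs t) ?mul1r//; move: zy; rewrite !inE.
  by rewrite (_ : ((y, z) \in near_pairs t) = false) ?mul0r//; apply/negbTE; move: zy; rewrite !notin_setE.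
have J0 y : (0 <= \int[lam]_(z in eball y t) `|f z - g z|%:E)%E.
  by apply: integral_ge0 => z _; rewrite lee_fin.
have Ct0 : 0 <= C * t by rewrite mulr_ge0// ltW.
have m1 : measurable_fun K (fun y => (`|f y - g y| + C * t)%:E).
  apply/measurable_EFinP/measurable_funTS; apply: measurable_funD; last exact: measurable_cst.
  by apply: measurableT_comp => //; exact: measurable_funB.
have m2 : measurable_fun K (fun y => ((t ^+ n * c)^-1)%:E *
    \int[lam]_(z in eball y t) `|f z - g z|%:E)%E.
  exact: measurable_funeM.
apply: (@le_trans _ _ (\int[lam]_(y in K) ((`|f y - g y| + C * t)%:E +
    ((t ^+ n * c)^-1)%:E * \int[lam]_(z in eball y t) `|f z - g z|%:E))%E).
  apply: ge0_le_integral => //.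
  - apply/measurable_EFinP/measurable_funTS; apply: measurableT_comp => //.
    by apply: measurable_funB => //; exact: measurable_mass_ratio.
  - exact: emeasurable_funD.
  - by move=> y Ky; exact: mass_ratio_bound.
have i0 : (0 <= ((t ^+ n * c)^-1)%:E :> \bar R)%E by rewrite lee_fin invr_ge0 ltW.
rewrite ge0_integralD//; [|by move=> y _; rewrite lee_fin addr_ge0|by move=> y _; rewrite mule_ge0].
rewrite EFinD; apply: leeD; last first.
  rewrite ge0_integralZl//; apply: le_trans (lee_wpmul2l i0 (tonelli_bound t0 t1)) _.
  by rewrite -EFinM mulrA mulVf ?mul1r// gt_eqF.
under eq_integral do rewrite EFinD.
rewrite ge0_integralD// EFinD; apply: leeD.
  by apply: le_trans fg; apply: ge0_subset_integral.
rewrite integral_cst// [X in (_ <= X)%E]EFinM fineK; last by rewrite ge0_fin_numE ?lebesgue_cube_lty.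
by apply: lee_wpmul2l; [rewrite lee_fin|apply: le_measure; rewrite ?inE].
Qed.

End Approximant.

Lemma mass_ratio_cvg_L1 :
  (\int[lam]_(y in K) `|mass_ratio y k.+1%:R^-1 - f y|%:E)%E @[k --> \oo] --> 0%E.
Proof.
have I0 k : (0 <= \int[lam]_(y in K) `|mass_ratio y k.+1%:R^-1 - f y|%:E)%E.
  by apply: integral_ge0 => y _; rewrite lee_fin.
suff H (e : R) : 0 < e -> \forall k \near \oo,
    (\int[lam]_(y in K) `|mass_ratio y k.+1%:R^-1 - f y|%:E <= e%:E)%E.
  apply/fine_cvgP; split.
    apply: filterS (H 1 ltr01) => k hk; rewrite ge0_fin_numE//.
    by apply: le_lt_trans hk _; rewrite ltry.
  apply/cvgrPdist_le => e e0; apply: filterS (H e e0) => k hk.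
  rewrite sub0r normrN ger0_norm ?fine_ge0//= -lee_fin fineK//.
  by rewrite ge0_fin_numE// (le_lt_trans hk)// ltry.
move=> e0; have e3 : 0 < e / 3 by rewrite divr_gt0.
have [g [C [mg g0 C0 lg eg]]] := lipschitz_density mD (lebesgue_cube_lty lamP 2) mf f_ge0 intfD e3.
pose l := fine (lam D); have l0 : 0 <= l by apply: fine_ge0.
have Cl : 0 < C * l + 1 by rewrite ltr_wpDl// mulr_ge0.
have : \forall k \near \oo, (harmonic k : R) < e / 3 / (C * l + 1).
  by apply: (@cvgr_lt _ _ _ _ _ _ (@cvg_harmonic R)); rewrite divr_gt0.
apply: filterS => k /=; rewrite ltr_pdivlMr// => hk.
have t0 : 0 < k.+1%:R^-1 :> R by rewrite invr_gt0.
have t1 : k.+1%:R^-1 <= 1 :> R by rewrite invf_le1// ler1n.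
apply: le_trans (mass_ratio_integral_bound mg g0 C0 lg eg t0 t1) _.
rewrite lee_fin -/l; move: (k.+1%:R^-1) t0 hk => t t0 hk.
have : C * t * l <= t * (C * l + 1) by nra.
lra.
Qed.

(** The ratios tend to F pointwise and to f in L^1, so Fatou gives [|F - f|] integral 0 on S. *)
Lemma mass_ratio_cvg_ae (S : set V) (F : V -> R) : measurable S -> S `<=` K ->
  measurable_fun S F ->
  (forall y, S y -> mass_ratio y k.+1%:R^-1 @[k --> \oo] --> F y) ->
  ae_eq lam S (EFin \o F) (EFin \o f).
Proof.
move=> mS SK mF cF.
have mk k : measurable_fun S (fun y => `|mass_ratio y k.+1%:R^-1 - f y|%:E).
  apply/measurable_EFinP/measurable_funTS; apply: measurableT_comp => //.
  by apply: measurable_funB => //; exact: measurable_mass_ratio.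
have := fatou lam mS mk (fun k y _ => normr_ge0 _).
have -> : limn_einf (fun k => \int[lam]_(y in S) `|mass_ratio y k.+1%:R^-1 - f y|%:E)%E = 0%E.
  apply: (cvg_limn_einf_sup _).1.
  apply: (@squeeze_cvge _ _ _ _ (fun=> 0%E) _
    (fun k => \int[lam]_(y in K) `|mass_ratio y k.+1%:R^-1 - f y|%:E)%E); last exact: mass_ratio_cvg_L1.
    apply: nearW => k; apply/andP; split; first by apply: integral_ge0 => y _; rewrite lee_fin.
    apply: ge0_subset_integral => //.
    apply/measurable_EFinP/measurable_funTS; apply: measurableT_comp => //.
    by apply: measurable_funB => //; exact: measurable_mass_ratio.
  exact: cvg_cst.
rewrite (_ : (\int[lam]_(y in S) _)%E = (\int[lam]_(y in S) `|(F y - f y)%:E|)%E); last first.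
  apply: eq_integral => y; rewrite inE => Sy; apply: (cvg_limn_einf_sup _).1.
  apply: cvg_EFin; first exact: nearW.
  by apply: cvg_norm; apply: cvgB; [exact: cF|exact: cvg_cst].
move=> le0.
have mFf : measurable_fun S (fun y => (F y - f y)%:E).
  by apply/measurable_EFinP; apply: measurable_funB => //; exact: measurable_funTS.
have : (\int[lam]_(y in S) `|(F y - f y)%:E|)%E = 0%E.
  by apply/eqP; rewrite eq_le le0 integral_ge0.
move=> /(ae_eq_integral_abs lam mS mFf); apply: filterS => y h Sy.
by have := h Sy; rewrite /= => -[/eqP]; rewrite subr_eq0 => /eqP ->.
Qed.

End BallAverages.

Lemma small_arg_ball (R : realType) (n : nat) (v : n.-tuple R) (C : R) : 0 < C ->
  enorm v <= (2 * C * n.+1%:R)^-1 -> small_arg v C.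
Proof.
move=> C0 hv; rewrite /small_arg.
have N0 : 0 < n.+1%:R :> R by [].
have : \sum_(i < n) `|tnth v i| <= n.+1%:R * (2 * C * n.+1%:R)^-1.
  apply: (@le_trans _ _ (\sum_(i < n) (2 * C * n.+1%:R)^-1)).
    by apply: ler_sum => i _; exact: le_trans (tnth_le_enorm _ _) hv.
  rewrite sumr_const card_ord -[X in X <= _]mulr_natl ler_wpM2r ?ler_nat//.
  by rewrite invr_ge0 mulr_ge0// mulr_ge0// ltW.
have -> : n.+1%:R * (2 * C * n.+1%:R)^-1 = (2 * C)^-1.
  by field; rewrite !gt_eqF.
move=> h; have := ler_wpM2l (ltW C0) h.
by have -> : C * (2 * C)^-1 = 2^-1 by field; rewrite gt_eqF.
Qed.

Theorem theorem5p1 (R : realType) (n : nat) (iota : n.-tuple R -> n.-tuple R)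
  (Z K : set (n.-tuple R))
  (lam : {measure set (n.-tuple R) -> \bar R})
  (mu : probability (n.-tuple R) R) :
  (0 < n)%N ->
  is_inversion iota ->
  is_lattice Z ->
  dirichlet_choice Z K ->
  measurable K ->
  integral_lattice Z ->
  unit_generated Z ->
  norm_euclidean K ->
  nicely_invertible iota Z ->
  remote3 Z K \/ remote7 Z K ->
  is_lebesgue lam ->
  (* mu is T-invariant *)
  (forall A, measurable A -> mu (cf_map iota Z K @^-1` A) = mu A) ->
  (* mu is equivalent to Lebesgue measure (on K) *)
  (forall A, measurable A -> (mu A = 0%E <-> lam (A `&` K) = 0%E)) ->
  exists f : n.-tuple R -> R,
    [/\ measurable_fun setT f,
        (forall A, measurable A -> mu A = (\int[lam]_(x in A) (f x)%:E)%E)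
      & let S := K `\` \bigcup_(k in [set: nat]) (iter k (cf_map iota Z K) @` eboundary K) in
        forall x, S x -> analytic_on f (ecomponent S x)].
Proof.
move=> n_gt0 iotaP Zlat Kdir mK Zint Zunit Keuclid Znice rem lamP mu_inv mu_ac.
pose slam : {sigma_finite_measure set (n.-tuple R) -> \bar R} :=
  sigma_finite_alias (lebesgue_sigma_finite lamP).
have slamP : is_lebesgue slam := lamP.
(* Equivalence is stated through [A] intersected with [K], which is null as soon as A is. *)
have dom : mu `<< slam.
  apply/null_content_dominatesP => A mA lA; apply/(mu_ac _ mA).
  apply/eqP; rewrite eq_le measure_ge0 andbT -[X in (_ <= X)%E]lA.
  by apply: le_measure; rewrite ?inE//; exact: measurableI.
have mu_K : mu (~` K) = 0%E.
  by apply/(mu_ac _ (measurableC mK)); rewrite setICl measure0.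
have [g [g0 gfin intg gE]] := radon_nikodym_sigma_finite dom.
pose f x := fine (g x).
have fE : EFin \o f = g by apply/funext => x; rewrite /= /f fineK.
have f_ge0 x : 0 <= f x by apply: fine_ge0.
have intf : slam.-integrable setT (EFin \o f) by rewrite fE.
have mf : measurable_fun setT f by apply/measurable_EFinP; exact: measurable_int intf.
have muE A : measurable A -> mu A = (\int[slam]_(x in A) (f x)%:E)%E.
  by move=> mA; rewrite gE// -fE.
have intf1 : slam.-integrable (@cube R n 1) (EFin \o f).
  by apply: integrableS intf => //; exact: measurable_ebox.
have kernel x : good iota Z K x -> exists2 D, 0 < D &
  (forall y, edist y x < D^-1 -> good iota Z K y) /\
  exists c, exists2 M, 0 <= M & bounded_coef c M (8 * D) /\
    forall y, small_arg (vsub y x) (8 * D) ->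
      mass_ratio slam mu y k.+1%:R^-1 @[k --> \oo] --> wsum c (vsub y x).
  move=> gx.
  have [D D0 [gD app]] := ball_mass_kernel n_gt0 iotaP Zlat Kdir mK Zint Zunit Keuclid Znice rem
    slamP mu_inv mu_K mf f_ge0 intf1 muE gx.
  exists D => //; split => //.
  exact: (mean_density_analytic D0 app).
(* The limit does not refer to an expansion point, so one function fits all local power series; off
   the good set the Radon-Nikodym density is kept. *)
pose F y := if `[< good iota Z K y >] then limn (fun k => mass_ratio slam mu y k.+1%:R^-1) else f y.
have gS : measurable (good iota Z K).
  apply: eopen_measurable => x /kernel[D D0 [gD _]].
  by exists D^-1; [rewrite invr_gt0|exact: gD].
have cF y : good iota Z K y -> mass_ratio slam mu y k.+1%:R^-1 @[k --> \oo] --> F y.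
  move=> gy; have [D D0 [_ [c [M _ [_ h]]]]] := kernel y gy.
  rewrite /F asboolT//.
  have cv := h y _; apply/cvg_ex; exists (wsum c (vsub y y)); apply: cv.
  by rewrite /small_arg big1 ?mulr0 ?invr_ge0// => i _; rewrite tnthE subrr normr0.
have mS : measurable_fun (good iota Z K) F.
  apply: (measurable_fun_cvg (h := fun k y => mass_ratio slam mu y k.+1%:R^-1)) => //.
  by move=> k; apply: measurable_funTS; exact: measurable_mass_ratio.
have mF : measurable_fun setT F.
  rewrite -(setUv (good iota Z K)); apply/measurable_funU; [exact: gS|exact: measurableC|].
  split => //; apply: (eq_measurable_fun f); last exact: measurable_funTS.
  by move=> y; rewrite inE /F => /= ng; rewrite asboolF.
have KC : K `<=` @cube R n 1 := K_cube Zlat Kdir Zint Zunit Keuclid.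
have SK : good iota Z K `<=` K by move=> y [].
have aeS := mass_ratio_cvg_ae slamP mf f_ge0 intf muE mK KC gS SK mS cF.
have aeT : ae_eq slam setT (EFin \o F) (EFin \o f).
  apply: filterS aeS => y h _; have [gy|ng] := pselect (good iota Z K y); first exact: h.
  by rewrite /= /F asboolF.
exists F; split => //.
  move=> A mA; rewrite muE//; apply: ae_eq_integral => //.
  - by apply: measurable_funTS; exact/measurable_EFinP.
  - by apply: measurable_funTS; exact/measurable_EFinP.
  - by apply: filterS aeT => y h _; exact: esym (h I).
(* Analyticity holds at every good point, and a component consists of good points. *)
move=> S x Sx x' [C [_ CS _ Cx']].
have gx' : good iota Z K x' := CS _ Cx'.
have [D D0 [gD [c [M M0 [bc h]]]]] := kernel x' gx'.
have D8 : 0 < 8 * D by rewrite mulr_gt0.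
have r0 : 0 < (2 * (8 * D) * n.+1%:R)^-1 by rewrite invr_gt0 !mulr_gt0.
(* This Euclidean radius forces [small_arg] at rate 8D, the sum of the coordinates costing the
   factor n+1. *)
exists (multi_coef c), (2 * (8 * D) * n.+1%:R)^-1 => // y yx _.
have sv : small_arg (vsub y x') (8 * D) by apply: small_arg_ball => //; exact: ltW.
split; first exact: (cvg_hom_part_abs M0 (ltW D8) bc sv).
have gy : good iota Z K y.
  apply: gD; apply: lt_le_trans yx _; rewrite lef_pV2 ?posrE ?mulr_gt0//.
  have : 1 <= n.+1%:R :> R by rewrite ler1n.
  nra.
have -> : F y = wsum c (vsub y x').
  exact: (cvg_unique _ (cF y gy) (h y sv)).
have -> : hom_part (multi_coef c) (vsub y x') = hsum c (vsub y x').
  by apply/funext => k; exact: hom_part_multi_coef.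
exact: (cvg_wsum M0 (ltW D8) bc sv).
Qed.
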